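(* For any $\mathcal F_1$-measurable random variable $\xi$ there exists an $\mathbb F$-adapted process $\psi=\{\psi_t,t\in[0,1]\}$ such that (i) for any $t<1$ and any $\alpha\in(1-H,1/2)$, $\|\psi\|_{\alpha,t}<\infty$ almost surely; (ii) $\lim_{t\to1-}\int_0^t\psi_s\,dB^H_s=\xi$ almost surely.
   Context: Let $(\Omega,\mathcal F,\mathsf P)$ be a complete probability space with a $\mathsf P$-complete left-continuous filtration $\mathbb F=\{\mathcal F_t,t\in[0,1]\}$. Let $B^H=\{B^H_t,t\in[0,1]\}$ be a fractional Brownian motion with Hurst parameter $H\in(1/2,1)$, i.e. an $\mathbb F$-adapted centered Gaussian process with $\mathsf E[B^H_tB^H_s]=\frac12(s^{2H}+t^{2H}-|s-t|^{2H})$, with continuous paths. For $\alpha>0$ and $t\in(0,1]$ define $$\|f\|_{\alpha,t}=\int_0^t\left(\frac{|f(s)|}{s^\alpha}+\int_0^s\frac{|f(s)-f(z)|}{(s-z)^{1+\alpha}}\,dz\right)ds.$$ Integrals with respect to $B^H$ are pathwise generalized Lebesgue--Stieltjes integrals: if $\|f\|_{\alpha,t}<\infty$ for some $\alpha\in(1-H,1)$, then $$\int_0^t f_s\,dB^H_s=\frac{1}{\Gamma(1-\alpha)\Gamma(\alpha)}\int_0^t\left(\frac{f(x)}{x^\alpha}+\alpha\int_0^x\frac{f(x)-f(u)}{(x-u)^{1+\alpha}}du\right)\left(\frac{B^H_t-B^H_x}{(t-x)^{1-\alpha}}+(1-\alpha)\int_x^t\frac{B^H_u-B^H_x}{(u-x)^{2-\alpha}}du\right)dx.$$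 Almost surely, the second factor is bounded in $x$, and the value does not depend on the choice of such $\alpha$. *)

(* Defs.v *)
From HB Require Import structures.
From mathcomp Require Import all_boot all_order all_algebra.
From mathcomp Require Import all_classical all_reals all_analysis.

Set Implicit Arguments.
Unset Strict Implicit.
Unset Printing Implicit Defensive.

Import Order.TTheory GRing.Theory Num.Theory.
Import numFieldNormedType.Exports.

Local Open Scope classical_set_scope.
Local Open Scope ring_scope.

(* Processes on [0,1] are functions X : R -> T -> R (time first); only the
   values at times t in [0,1] are ever constrained or used. *)

Section filtrations.
Context {d : measure_display} {T : measurableType d} {R : realType}.
Implicit Types (P : probability T R) (F : R -> set (set T)).

Definition measurable_wrt (G : set (set T)) (X : T -> R) : Prop :=
  forall B : set R, measurable B -> G (X @^-1` B).

(* A P-complete left-continuous filtration (F_t), t in [0,1]. *)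
Record is_complete_lc_filtration P F : Prop := {
  filtration_sigma : forall t : R, 0 <= t <= 1 -> sigma_algebra setT (F t);
  filtration_sub : forall t : R, 0 <= t <= 1 -> F t `<=` measurable;
  filtration_mono : forall s t : R, 0 <= s -> s <= t -> t <= 1 -> F s `<=` F t;
  filtration_complete : forall t : R, 0 <= t <= 1 -> P.-negligible `<=` F t;
  filtration_left_continuous : forall t : R, 0 < t <= 1 ->
    F t = <<s \bigcup_(s in [set s | 0 <= s < t]) F s >> }.

Definition adapted F (X : R -> T -> R) : Prop :=
  forall t, 0 <= t <= 1 -> measurable_wrt (F t) (X t).

End filtrations.

Section gaussian.
Context {d : measure_display} {T : measurableType d} {R : realType}.
Implicit Types P : probability T R.

(* [normal_prob m 0] is not the Dirac mass at m (the library makes it a uniform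
   law), so the degenerate Gaussian law has to be singled out. *)
Definition gaussian_law (m s : R) : set R -> \bar R :=
  if s == 0 then dirac m else normal_prob m s.

Definition gaussian_variable P (X : T -> R) : Prop :=
  measurable_fun [set: T] X /\
  exists m s : R, 0 <= s /\
    forall B : set R, measurable B -> pushforward P X B = gaussian_law m s B.

(* X is Gaussian iff every linear combination of its values is. *)
Definition gaussian_process P (X : R -> T -> R) : Prop :=
  forall (n : nat) (t c : 'I_n -> R), (forall i, 0 <= t i <= 1) ->
    gaussian_variable P (fun w => \sum_(i < n) c i * X (t i) w).

Record is_fBm P (F : R -> set (set T)) (H : R) (B : R -> T -> R) : Prop := {
  fBm_adapted : adapted F B;
  fBm_gaussian : gaussian_process P B;
  fBm_centered : forall t : R, 0 <= t <= 1 -> ('E_P[B t] = 0)%E;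
  fBm_cov : forall t s : R, 0 <= t <= 1 -> 0 <= s <= 1 ->
    ('E_P[fun w => (B t w * B s w)%R] =
      (2^-1 * (s `^ (2 * H) + t `^ (2 * H) - `|s - t| `^ (2 * H)))%:E)%E;
  fBm_continuous : forall w, {within `[0, 1]%classic, continuous (fun t => B t w)} }.

End gaussian.

Section generalized_lebesgue_stieltjes.
Context {R : realType}.
Notation mu := (@lebesgue_measure R).
Implicit Types (f g : R -> R) (alpha t H : R).

Definition alpha_norm alpha t f : \bar R :=
  (\int[mu]_(s in `[0%R, t])
     ((`|f s| / s `^ alpha)%:E +
      \int[mu]_(z in `[0%R, s])
        (`|f s - f z| / (s - z) `^ (1 + alpha))%:E))%E.

(* The library integral of a nonnegative function is total (it is a lower
   integral), so the measurability of f, implicit in the existence of the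
   Lebesgue integrals defining the norm, is required separately. *)
Definition alpha_norm_finite alpha t f : Prop :=
  measurable_fun `[0, t]%classic f /\ (alpha_norm alpha t f < +oo)%E.

Definition Gamma (a : R) : R :=
  \int[mu]_(x in `]0, +oo[) (x `^ (a - 1) * expR (- x)).

Definition gLS_integral_at alpha f g t : R :=
  (Gamma (1 - alpha) * Gamma alpha)^-1 *
  \int[mu]_(x in `[0, t])
    ((f x / x `^ alpha +
      alpha * \int[mu]_(u in `[0, x]) ((f x - f u) / (x - u) `^ (1 + alpha))) *
     ((g t - g x) / (t - x) `^ (1 - alpha) +
      (1 - alpha) *
        \int[mu]_(u in `[x, t]) ((g u - g x) / (u - x) `^ (2 - alpha)))).

(* The generalized Lebesgue-Stieltjes integral of f against g over [0,t]: the
   value at some alpha in (1-H,1) for which f has finite norm.  For almost every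
   path g of a fractional Brownian motion with Hurst parameter H the value is
   the same for all such alpha, so the choice is immaterial; it is meaningless
   when there is no such alpha. *)
Definition gLS_integral H f g t : R :=
  gLS_integral_at
    (get [set alpha | 1 - H < alpha < 1 /\ alpha_norm_finite alpha t f]) f g t.

End generalized_lebesgue_stieltjes.

(* Main.v *)
(** The integrand is piecewise constant on a deterministic grid accumulating at
    1.  By left continuity of the filtration, [xi] is the limit of variables
    [z_n] measurable with respect to [F (t_n)], where [t_n] increases to 1, and
    [P (|xi - z_n| > e_n)] is summable.  If [I_n] is the value of the integral at
    time [t_n], the block [[t_n, t_{n+1}]] has to contribute about
    [y = z_n - I_n], a variable known at time [t_n].  With
    [phi x = x^2 / (1 + x^2)], the integrand there is
    [y K phi' (K (B_{s_j} - B_{t_n}))] on the [j]-th interval of a fine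
    subdivision; its Riemann sums are
    [y phi (K (B_t - B_{t_n}))] up to the quadratic variation, which vanishes
    with the mesh because [2H > 1].  At [t_{n+1}] the factor [phi] is close to 1
    for [K] large since [B_{t_{n+1}} <> B_{t_n}] almost surely, and before that
    it stays in [[0, 1]], so the integral does not oscillate within a block by
    more than [|y|], which tends to 0 by the Borel-Cantelli lemma.

    For a step function the generalized Lebesgue-Stieltjes integral is the
    Riemann sum: this is the inversion, at the jump [b], of the right-sided
    fractional derivative of the path, obtained by regularizing the kernel
    [(u - x)^(alpha - 2)] into [(u - x + e)^(alpha - 2)].  It only requires the
    integral of [(x - b)^(-p) |B_u - B_x| (u - x)^(q - 2)] over [x < u] to be
    finite almost surely, which follows from the second moments of the
    increments, so that no Hoelder regularity of the paths is needed. *)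

Require Import Defs.
From mathcomp Require Import all_boot all_order all_algebra.
From mathcomp Require Import all_classical all_reals all_analysis.
From mathcomp Require Import measurable_realfun lra ring.

Set Implicit Arguments.
Unset Strict Implicit.

Import Order.TTheory GRing.Theory Num.Theory.
Import numFieldNormedType.Exports.

Local Open Scope classical_set_scope.
Local Open Scope ring_scope.

(** * Integrals of power functions *)

Section real_integrals.
Context {R : realType}.
Notation mu := (@lebesgue_measure R).
Implicit Types (a b x t u v : R) (f F : R -> R).

(** The exponent in [gLS_integral] is picked by a choice that may depend on the time and on the
    path. The identification with Riemann sums therefore has to hold on one event of full measure,
    for all exponents in (1 - H, 1) and all times at once. This is what a deterministic grid buys:
    the jump points are countably many, and countably many pairs of exponents suffice because a
    weighted energy controls every exponent between its own two. The price is that a deterministic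
    scale [K] and a deterministic mesh can be good only in probability, so each block carries an
    exceptional set of small measure.

    The integrand cannot anticipate the increment of the path over a block, not even its sign. Hence
    the shape of the profile: even, vanishing at 0 and tending to 1 at infinity, it sends every
    nonzero increment, once scaled by a large [K], close to the same value. Its second derivative is
    bounded, so that the error in Taylor's formula is controlled by squares of increments alone,
    however large these are. *)

Lemma ge0_integral_affine (k c : R) (f : R -> \bar R) : 0 < k ->
  measurable_fun [set: R] f -> (forall x, 0 <= f x)%E ->
  (\int[mu]_x f x = k%:E * \int[mu]_x f (k * x + c)%R)%E.
Proof.
move=> k0 mf f0.
pose phi : R -> measurableTypeR R := fun x => k * x + c.
have mphi : measurable_fun [set: R] phi.
  by apply: measurable_funD => //; apply: measurable_funM.
pose kk := NngNum (ltW k0).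
(* Uniqueness of Lebesgue measure reduces the change of variables to half-open intervals. *)
have nuE A : measurable A -> mu A = mscale kk (pushforward mu phi) A.
  move=> mA; apply: lebesgue_measure_unique => //= _ [[p q] _ <-].
  rewrite /mscale /= /pushforward.
  have -> : phi @^-1` `]p, q] = `](p - c) / k, (q - c) / k]%classic.
    apply/seteqP; split=> x /=; rewrite /phi !in_itv/= => /andP[h1 h2];
      apply/andP; split.
    - by rewrite ltr_pdivrMr//; lra.
    - by rewrite ler_pdivlMr//; lra.
    - by move: h1; rewrite ltr_pdivrMr//; lra.
    - by move: h2; rewrite ler_pdivlMr//; lra.
  rewrite !lebesgue_measure_itv/= !lte_fin ltr_pM2r ?invr_gt0// ltrD2r.
  case: ifPn => _; last by rewrite mule0.
  by rewrite -!EFinB -EFinM; congr EFin; field; lra.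
rewrite (eq_measure_integral (mscale kk (pushforward mu phi)))//=; last first.
  by move=> A mA _; exact: nuE.
rewrite ge0_integral_mscale//= ge0_integral_pushforward//=.
Qed.

Lemma measurable_fun_itvoo a b f : {in `]a, b[, continuous f} ->
  measurable_fun `]a, b[ f.
Proof.
move=> cf; apply: open_continuous_measurable_fun => //.
by move=> x; rewrite inE; exact: cf.
Qed.

(** The integrand may blow up at both ends: the fundamental theorem is applied on closed
    subintervals exhausting []a, b[], and monotone convergence passes to the limit. *)
Lemma ge0_FTC2_oo f F a b : a < b ->
  {in `]a, b[, forall x, 0 <= f x} -> {in `]a, b[, continuous f} ->
  {in `]a, b[, forall x, is_derive x 1 F (f x)} ->
  F x @[x --> a^'+] --> F a -> F x @[x --> b^'-] --> F b ->
  (\int[mu]_(x in `]a, b[) (f x)%:E = (F b - F a)%:E)%E.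
Proof.
move=> ab f0 cf dF Fa Fb.
(* The third keeps [a + h n < b - h n] already at [n = 0]. *)
pose h n : R := (b - a) / 3 / n.+1%:R.
have ba3 : 0 < (b - a) / 3 by lra.
have h0 n : 0 < h n by rewrite divr_gt0.
have hle n : h n <= (b - a) / 3.
  by rewrite ler_pdivrMr// ler_peMr ?(ltW ba3)// ler1n.
have hcvg : h n @[n --> \oo] --> 0.
  rewrite -(mulr0 ((b - a) / 3)); apply: cvgM; first exact: cvg_cst.
  exact: cvg_harmonic.
pose S n := `[a + h n, b - h n]%classic.
have Soo n : S n `<=` `]a, b[%classic.
  move=> x; rewrite /S /= !in_itv/= => /andP[h1 h2]; have := h0 n.
  by move=> h3; apply/andP; split; lra.
have SE : \bigcup_n S n = `]a, b[%classic.
  apply/seteqP; split=> [x [n _ /Soo]//|x]; rewrite /= in_itv/= => /andP[ax xb].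
  have e0 : 0 < Num.min (x - a) (b - x) by rewrite lt_min; apply/andP; split; lra.
  have [n _ /(_ n (leqnn n))] : \forall n \near \oo, h n < Num.min (x - a) (b - x).
    near=> n; have : `|h n| < Num.min (x - a) (b - x).
      near: n; move/cvgr0Pnorm_lt : hcvg => /(_ _ e0); exact.
    by rewrite gtr0_norm.
  rewrite lt_min => /andP[h1 h2]; exists n => //.
  by rewrite /S /= in_itv/=; apply/andP; split; lra.
have mf n : measurable_fun (S n) (EFin \o f).
  apply/measurable_EFinP; apply: (@measurable_funS _ _ _ _ `]a, b[%classic) => //.
  exact: measurable_fun_itvoo.
have ndS : nondecreasing_seq S.
  move=> m n mn; apply/subsetPset => x; rewrite /S/= !in_itv/= => /andP[h1 h2].
  have hmn : h n <= h m by rewrite ler_pM2l// lef_pV2 ?posrE// ler_nat.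
  by apply/andP; split; lra.
have H : (\int[mu]_(x in S n) (f x)%:E @[n --> \oo] -->
    \int[mu]_(x in `]a, b[) (f x)%:E)%E.
  rewrite -SE; apply: ge0_nondecreasing_set_cvg_integral => //.
  - by move=> n; exact: measurable_itv.
  - by move=> n x /Soo xab; rewrite lee_fin f0.
apply/esym; apply: cvg_unique H => //=.
have ES n : (\int[mu]_(x in S n) (f x)%:E = (F (b - h n) - F (a + h n))%:E)%E.
  have ltS : a + h n < b - h n by have := hle n; lra.
  have inS x : x \in `]a + h n, b - h n[ -> x \in `]a, b[.
    by move=> /subset_itv_oo_cc xS; apply: (Soo n).
  have inSc x : x \in `[a + h n, b - h n] -> x \in `]a, b[.
    by move=> xS; apply: (Soo n).
  have cF x : x \in `]a, b[ -> {for x, continuous F}.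
    move=> xab; apply: differentiable_continuous.
    by apply/derivable1_diffP; have [] := dF _ xab.
  rewrite /S (continuous_FTC2 (F := F)) ?EFinB//.
  - apply/continuous_within_itvP => //; split.
    + by move=> x /inS; exact: cf.
    + by apply: cvg_at_right_filter; apply/cf/inSc; rewrite bound_itvE ltW.
    + by apply: cvg_at_left_filter; apply/cf/inSc; rewrite bound_itvE ltW.
  - split.
    + by move=> x /inS xab; have [] := dF _ xab.
    + by apply: cvg_at_right_filter; apply/cF/inSc; rewrite bound_itvE ltW.
    + by apply: cvg_at_left_filter; apply/cF/inSc; rewrite bound_itvE ltW.
  - by move=> x /inS xab; rewrite derive1E; have [_ ->] := dF _ xab.
rewrite /=; under eq_fun do rewrite ES.
apply: cvg_EFin; first by near=> n.
rewrite [X in X --> _](_ : _ = (fun n => F (b - h n) - F (a + h n)) @ \oo)//.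
apply: cvgB.
- have /cvg_at_leftP/(_ (fun n => b - h n)) := Fb; apply.
  split; first by move=> n; have := h0 n; lra.
  rewrite -[X in _ --> X]subr0; apply: cvgB => //; exact: cvg_cst.
- have /cvg_at_rightP/(_ (fun n => a + h n)) := Fa; apply.
  split; first by move=> n; have := h0 n; lra.
  rewrite -[X in _ --> X]addr0; apply: cvgD => //; exact: cvg_cst.
Unshelve. all: by end_near. Qed.

End real_integrals.

Section powR_integrals.
Context {R : realType}.
Notation mu := (@lebesgue_measure R).
Implicit Types (a b c k p t u x : R).

Lemma powR1D x p : 0 < x -> x `^ (1 + p) = x * x `^ p.
Proof.
by move=> x0; rewrite powRD ?powRr1 ?ltW// (gt_eqF x0) implybT.
Qed.

Lemma is_derive_powR_affine k c p x : 0 < k * x + c ->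
  is_derive x 1 (fun y => (k * y + c) `^ p) (p * (k * x + c) `^ (p - 1) * k).
Proof.
move=> kx0.
have Dg : is_derive x (1 : R) (fun y : R => k * y + c) k.
  apply: is_derive_eq; rewrite addr0 /GRing.scale /=.
  by rewrite mulr1.
have Df : is_derive ((fun y : R => k * y + c) x) (1 : R) (fun y : R => y `^ p)
    (p * (k * x + c) `^ (p - 1)) by exact: is_derive1_powR.
exact: (@is_derive1_comp R (fun y : R => y `^ p) (fun y : R => k * y + c) x _ _ Df Dg).
Qed.

Lemma continuous_powR_affine k c p x : 0 < k * x + c ->
  {for x, continuous (fun y => (k * y + c) `^ p)}.
Proof.
move=> kx0; apply: differentiable_continuous; apply/derivable1_diffP.
by have [] := is_derive_powR_affine p kx0.
Qed.

Lemma cvg_powR_at_right b p : 0 < p -> (x - b) `^ p @[x --> b^'+] --> 0.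
Proof.
move=> p0; apply/cvg_at_rightP => u [u0 ub].
have /cvg_at_rightP/(_ (fun n => u n - b)) := powR_cvg0 p0; apply; split.
  by move=> n; rewrite subr_gt0.
by rewrite -(subrr b); apply: cvgB => //; exact: cvg_cst.
Qed.

Lemma cvg_powR_at_left t p : 0 < p -> (t - x) `^ p @[x --> t^'-] --> 0.
Proof.
move=> p0; apply/cvg_at_leftP => u [u0 ub].
have /cvg_at_rightP/(_ (fun n => t - u n)) := powR_cvg0 p0; apply; split.
  by move=> n; rewrite subr_gt0.
by rewrite -(subrr t); apply: cvgB => //; exact: cvg_cst.
Qed.

Lemma integral_powR_left b t p : b < t -> p < 1 ->
  (\int[mu]_(x in `]b, t[) ((x - b) `^ (- p))%:E =
     ((t - b) `^ (1 - p) / (1 - p))%:E)%E.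
Proof.
move=> bt p1; pose F x := (x - b) `^ (1 - p) / (1 - p).
have dF x : b < x -> is_derive x 1 F ((x - b) `^ (- p)).
  move=> bx; rewrite /F.
  have H : is_derive x 1 (fun y : R => (1 * y + - b) `^ (1 - p))
      ((1 - p) * (1 * x + - b) `^ (1 - p - 1) * 1).
    by apply: is_derive_powR_affine; rewrite mul1r subr_gt0.
  have -> : (fun y => (y - b) `^ (1 - p) / (1 - p)) =
      (1 - p)^-1 \*: (fun y : R => (1 * y + - b) `^ (1 - p)).
    by apply/funext => y; rewrite /= mul1r mulrC.
  apply: is_derive_eq; rewrite /GRing.scale /= mul1r mulr1.
  by rewrite mulrA mulVf ?mul1r; [congr (_ `^ _); lra | lra].
have cF x : b < x -> {for x, continuous F}.
  move=> bx; apply: differentiable_continuous; apply/derivable1_diffP.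
  by have [] := dF x bx.
have F0 : F b = 0 by rewrite /F subrr powR0 ?mul0r//; lra.
rewrite (ge0_FTC2_oo (F := F)) ?F0 ?subr0//.
- by move=> x _; exact: powR_ge0.
- move=> x; rewrite in_itv/= => /andP[bx _].
  have -> : (fun x => (x - b) `^ (- p)) = (fun y => (1 * y + - b) `^ (- p)).
    by apply/funext => y; rewrite mul1r.
  by apply: continuous_powR_affine; lra.
- by move=> x; rewrite in_itv/= => /andP[bx _]; exact: dF.
- rewrite -(mul0r (1 - p)^-1); apply: cvgM; last exact: cvg_cst.
  by apply: cvg_powR_at_right; lra.
- by apply: cvg_at_left_filter; exact: cF.
Qed.

Lemma integral_powR_right b t p : b < t -> p < 1 ->
  (\int[mu]_(x in `]b, t[) ((t - x) `^ (- p))%:E =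
     ((t - b) `^ (1 - p) / (1 - p))%:E)%E.
Proof.
move=> bt p1; pose F x := - ((t - x) `^ (1 - p) / (1 - p)).
have dF x : x < t -> is_derive x 1 F ((t - x) `^ (- p)).
  move=> bx; rewrite /F.
  have H : is_derive x 1 (fun y : R => (-1 * y + t) `^ (1 - p))
      ((1 - p) * (-1 * x + t) `^ (1 - p - 1) * -1).
    by apply: is_derive_powR_affine; lra.
  have -> : (fun y => - ((t - y) `^ (1 - p) / (1 - p))) =
      (- (1 - p)^-1) \*: (fun y : R => (-1 * y + t) `^ (1 - p)).
    by apply/funext => y; rewrite /= mulN1r (addrC (- y)) /GRing.scale /= mulNr mulrC.
  apply: is_derive_eq; rewrite /GRing.scale /= mulN1r (addrC (- x)) mulrN1 mulrNN.
  by rewrite mulrA mulVf ?mul1r; [congr (_ `^ _); lra | lra].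
have cF x : x < t -> {for x, continuous F}.
  move=> bx; apply: differentiable_continuous; apply/derivable1_diffP.
  by have [] := dF x bx.
have F0 : F t = 0 by rewrite /F subrr powR0 ?mul0r ?oppr0//; lra.
rewrite (ge0_FTC2_oo (F := F)) ?F0 ?sub0r ?opprK//.
- by move=> x _; exact: powR_ge0.
- move=> x; rewrite in_itv/= => /andP[_ bx].
  have -> : (fun x => (t - x) `^ (- p)) = (fun y => (-1 * y + t) `^ (- p)).
    by apply/funext => y; rewrite mulN1r (addrC (- y)).
  by apply: continuous_powR_affine; lra.
- by move=> x; rewrite in_itv/= => /andP[_ bx]; exact: dF.
- by apply: cvg_at_right_filter; exact: cF.
- rewrite -oppr0 -(mul0r (1 - p)^-1); apply: cvgN; apply: cvgM; last exact: cvg_cst.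
  by apply: cvg_powR_at_left; lra.
Qed.

(* The case [p = 1] is excluded since the primitive is then a logarithm. *)
Lemma integral_powR_affine k c a b p : a < b -> k != 0 -> p != 1 ->
  {in `[a, b], forall x, 0 < k * x + c} ->
  (\int[mu]_(x in `]a, b[) ((k * x + c) `^ (- p))%:E =
    (((k * b + c) `^ (1 - p) - (k * a + c) `^ (1 - p)) / (k * (1 - p)))%:E)%E.
Proof.
move=> ab k0 p1 pos; pose F x := (k * x + c) `^ (1 - p) / (k * (1 - p)).
have p10 : 1 - p != 0 by rewrite subr_eq0 eq_sym.
have dF x : x \in `[a, b] -> is_derive x 1 F ((k * x + c) `^ (- p)).
  move=> /pos kx; rewrite /F.
  have H := is_derive_powR_affine (1 - p) kx.
  have -> : (fun y => (k * y + c) `^ (1 - p) / (k * (1 - p))) =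
      (k * (1 - p))^-1 \*: (fun y : R => (k * y + c) `^ (1 - p)).
    by apply/funext => y; rewrite /= mulrC.
  apply: is_derive_eq; rewrite /GRing.scale /=.
  have -> : 1 - p - 1 = - p by ring.
  by field; rewrite k0 p10.
have cF x : x \in `[a, b] -> {for x, continuous F}.
  move=> bx; apply: differentiable_continuous; apply/derivable1_diffP.
  by have [] := dF x bx.
rewrite (ge0_FTC2_oo (F := F)) ?mulrBl//.
- by move=> x _; exact: powR_ge0.
- move=> x /subset_itv_oo_cc xab.
  by apply: continuous_powR_affine; exact: pos.
- by move=> x /subset_itv_oo_cc; exact: dF.
- by apply: cvg_at_right_filter; apply: cF; rewrite bound_itvE ltW.
- by apply: cvg_at_left_filter; apply: cF; rewrite bound_itvE ltW.
Qed.

(** The two exponents add up to -2, so that a primitive is elementary: a multiple of the power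
    [1 - al] of [(x - b) / (c - x)]. With [c = u + e] this integrates the regularized kernel in its
    left variable. *)
Lemma integral_powR_kernel (al : R) b u c : 0 < al < 1 -> b < u -> u < c ->
  (\int[mu]_(x in `]b, u[) ((x - b) `^ (- al) * (c - x) `^ (al - 2))%:E =
    ((u - b) `^ (1 - al) * (c - u) `^ (al - 1) / ((1 - al) * (c - b)))%:E)%E.
Proof.
move=> /andP[al0 al1] bu uc.
pose F x := (x - b) `^ (1 - al) * (c - x) `^ (al - 1) / ((1 - al) * (c - b)).
have dF x : b < x -> x < c ->
    is_derive x 1 F ((x - b) `^ (- al) * (c - x) `^ (al - 2)).
  move=> bx xc; rewrite /F.
  have H1 : is_derive x 1 (fun y : R => (1 * y + - b) `^ (1 - al))
      ((1 - al) * (1 * x + - b) `^ (1 - al - 1) * 1).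
    by apply: is_derive_powR_affine; rewrite mul1r subr_gt0.
  have H2 : is_derive x 1 (fun y : R => (-1 * y + c) `^ (al - 1))
      ((al - 1) * (-1 * x + c) `^ (al - 1 - 1) * -1).
    by apply: is_derive_powR_affine; lra.
  have -> : (fun y => (y - b) `^ (1 - al) * (c - y) `^ (al - 1) / ((1 - al) * (c - b)))
    = ((1 - al) * (c - b))^-1 \*: ((fun y : R => (1 * y + - b) `^ (1 - al)) *
       (fun y : R => (-1 * y + c) `^ (al - 1))).
    apply/funext => y; rewrite mulrC.
    have -> : y - b = 1 * y + - b by ring.
    by have -> : c - y = -1 * y + c by ring.
  apply: is_derive_eq; rewrite /GRing.scale /= mul1r mulN1r (addrC (- x)).
  have -> : 1 - al - 1 = - al by ring.
  have -> : al - 1 - 1 = al - 2 by ring.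
  have xb0 : 0 < x - b by lra.
  have cx0 : 0 < c - x by lra.
  have -> : (x - b) `^ (1 - al) = (x - b) * (x - b) `^ (- al).
    by rewrite powR1D.
  have -> : (c - x) `^ (al - 1) = (c - x) * (c - x) `^ (al - 2).
    have -> : al - 1 = 1 + (al - 2) by ring.
    by rewrite powR1D.
  by field; apply/andP; split; lra.
have cF x : b < x -> x < c -> {for x, continuous F}.
  move=> bx xc; apply: differentiable_continuous; apply/derivable1_diffP.
  by have [] := dF x bx xc.
have F0 : F b = 0 by rewrite /F subrr powR0 ?mul0r//; lra.
rewrite (ge0_FTC2_oo (F := F)) ?F0 ?subr0//.
- by move=> x _; rewrite mulr_ge0// powR_ge0.
- move=> x; rewrite in_itv/= => /andP[bx xu].
  have -> : (fun x => (x - b) `^ (- al) * (c - x) `^ (al - 2)) =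
    (fun y => (1 * y + - b) `^ (- al)) \* (fun y => (-1 * y + c) `^ (al - 2)).
    by apply/funext => y; rewrite /= mul1r mulN1r (addrC (- y)).
  by apply: continuousM; apply: continuous_powR_affine; lra.
- by move=> x; rewrite in_itv/= => /andP[bx xu]; apply: dF => //; lra.
- rewrite -[X in _ --> X](mul0r ((c - b) `^ (al - 1) / ((1 - al) * (c - b)))).
  rewrite /F; under eq_fun do rewrite -mulrA.
  apply: cvgM; first by apply: cvg_powR_at_right; lra.
  apply: cvgM; last exact: cvg_cst.
  apply: cvg_at_right_filter.
  have -> : (fun x => (c - x) `^ (al - 1)) = (fun y => (-1 * y + c) `^ (al - 1)).
    by apply/funext => y; rewrite mulN1r (addrC (- y)).
  have -> : c - b = -1 * b + c by ring.
  by apply: continuous_powR_affine; lra.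
- by apply: cvg_at_left_filter; apply: cF => //; lra.
Qed.

End powR_integrals.

Ltac measurability := repeat first
  [ exact: measurable_cst | exact: measurable_id | exact: measurable_fst
  | exact: measurable_snd | assumption
  | apply: (measurableT_comp (measurable_powR _))
  | apply: (measurableT_comp (@measurable_expR _))
  | apply: (measurableT_comp (@normr_measurable _ _))
  | apply: measurable_fun_ifT | apply: measurable_and
  | apply: measurable_fun_ltr | apply: measurable_fun_ler
  | apply: measurable_funD | apply: measurable_funB
  | apply: measurable_funM | apply: measurable_funN ].

(** * The beta integral and the Gamma function *)

Section beta.
Context {R : realType}.
Notation mu := (@lebesgue_measure R).
Implicit Types (al : R).

(** Its integral is Euler's beta function at [(1 - al, al)]. *)
Definition beta_kernel al (v : R) : R :=
  if 0 < v then v `^ (- al) * (1 + v) `^ (- 1) else 0.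

Lemma measurable_beta_kernel al : measurable_fun setT (beta_kernel al).
Proof. by rewrite /beta_kernel; measurability. Qed.

Lemma beta_kernel_ge0 al v : 0 <= beta_kernel al v.
Proof. by rewrite /beta_kernel; case: ifP => // _; rewrite mulr_ge0 ?powR_ge0. Qed.

Definition gamma_density al (x : R) : R :=
  if 0 < x then x `^ (al - 1) * expR (- x) else 0.

Lemma measurable_gamma_density al : measurable_fun setT (gamma_density al).
Proof. by rewrite /gamma_density; measurability. Qed.

Lemma gamma_density_ge0 al x : 0 <= gamma_density al x.
Proof.
by rewrite /gamma_density; case: ifP => // _; rewrite mulr_ge0 ?powR_ge0// expR_ge0.
Qed.

Lemma GammaE al : Gamma al = fine (\int[mu]_x (gamma_density al x)%:E)%E.
Proof.
rewrite /Gamma /Rintegral integral_mkcond; congr fine.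
apply: eq_integral => x _; rewrite patchE /gamma_density.
case: ifPn; first by rewrite inE/= in_itv/= andbT => ->.
by move/negP; rewrite inE/= in_itv/= andbT => /negP/negbTE ->.
Qed.

Lemma integral_expR_rate (r : R) : 0 < r ->
  (\int[mu]_x (if 0 < x then expR (- (r * x)) else 0)%:E = (r `^ (- 1))%:E)%E.
Proof.
move=> r0; rewrite powR_inv1 ?ltW//.
transitivity (\int[mu]_(x in `]0%R, +oo[) ((r^-1)%:E * (exponential_pdf r x)%:E))%E.
  rewrite [RHS]integral_mkcond; apply: eq_integral => x _; rewrite patchE.
  case: ifPn => x0; first last.
    by rewrite memNset//= in_itv/= andbT; apply/negP.
  rewrite mem_set/= ?in_itv/= ?x0//.
  by rewrite exponential_pdfE ?ltW// mulNr -EFinM mulKf// gt_eqF.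
have mE : measurable_fun setT (exponential_pdf r) by exact: measurable_exponential_pdf.
rewrite ge0_integralZl//=; last 3 first.
- by apply/measurable_EFinP; apply: measurable_funS mE.
- by move=> x _; rewrite lee_fin exponential_pdf_ge0// ltW.
- by rewrite lee_fin invr_ge0 ltW.
rewrite integral_itv_obnd_cbnd; last first.
  by apply/measurable_EFinP; apply: measurable_funS mE.
rewrite [X in (_ * X)%E](_ : _ = 1%E) ?mule1//.
rewrite -[RHS](@integral_exponential_pdf _ r r0) integral_mkcond.
apply: eq_integral => x _; rewrite patchE; case: ifPn => // /negP.
by rewrite inE/= in_itv/= andbT => /negP; rewrite -ltNge => /lt0_exponential_pdf ->.
Qed.

(* Tonelli after the substitution [x = y v] in the first factor. *)
Lemma Gamma_mul_ereal al :
  ((\int[mu]_x (gamma_density (1 - al) x)%:E) *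
   (\int[mu]_y (gamma_density al y)%:E) = \int[mu]_v (beta_kernel al v)%:E)%E.
Proof.
set g1 := (\int[mu]_x _)%E.
have g10 : (0 <= g1)%E.
  by apply: integral_ge0 => x _; rewrite lee_fin gamma_density_ge0.
rewrite muleC -ge0_integralZr//; last 2 first.
- by apply/measurable_EFinP; exact: measurable_gamma_density.
- by move=> x _; rewrite lee_fin gamma_density_ge0.
pose K (y v : R) : R := if (0 < y) && (0 < v)
  then v `^ (- al) * expR (- ((1 + v) * y)) else 0.
have K0 y v : 0 <= K y v.
  by rewrite /K; case: ifP => // _; rewrite mulr_ge0 ?powR_ge0// expR_ge0.
have mK : measurable_fun setT (fun z : R * R => K z.1 z.2).
  by rewrite /K; measurability.
transitivity (\int[mu]_y \int[mu]_v (K y v)%:E)%E.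
  apply: eq_integral => y _; rewrite /gamma_density.
  case: ifPn => y0; last first.
    rewrite mul0e integral0_eq// => v _.
    by rewrite /K (negbTE y0).
  rewrite /g1 (ge0_integral_affine 0 y0); last 2 first.
  - by apply/measurable_EFinP; exact: measurable_gamma_density.
  - by move=> x; rewrite lee_fin gamma_density_ge0.
  rewrite muleA -EFinM -ge0_integralZl//; last 3 first.
  - apply/measurable_EFinP.
    apply: (@measurableT_comp _ _ _ _ _ _ (gamma_density (1 - al))).
      exact: measurable_gamma_density.
    by measurability.
  - by move=> x _; rewrite lee_fin gamma_density_ge0.
  - by rewrite lee_fin !mulr_ge0 ?powR_ge0 ?expR_ge0// ltW.
  apply: eq_integral => v _; rewrite -EFinM; congr EFin.
  rewrite /K /gamma_density y0 addr0 pmulr_rgt0//=; case: ifPn => v0; last by rewrite mulr0.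
  rewrite powRM ?ltW//.
  have -> : 1 - al - 1 = - al by ring.
  have -> : expR (- ((1 + v) * y)) = expR (- y) * expR (- (y * v)).
    by rewrite -expRD; congr expR; ring.
  have -> : y `^ (al - 1) = y `^ (al) / y by rewrite powRB ?powRr1 ?ltW// (gt_eqF y0) implybT.
  have -> : y `^ al = (y `^ (- al))^-1 by rewrite powRN invrK.
  by field; rewrite !gt_eqF// powR_gt0.
transitivity (\int[mu]_v \int[mu]_y (K y v)%:E)%E.
  apply: (@fubini_tonelli _ _ _ _ _ mu mu (fun z : R * R => (K z.1 z.2)%:E)).
    by apply/measurable_EFinP.
  by move=> z; rewrite lee_fin.
apply: eq_integral => v _; rewrite /beta_kernel; case: ifPn => v0; last first.
  by rewrite integral0_eq// => y _; rewrite /K (negbTE v0) andbF.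
transitivity (\int[mu]_y ((v `^ (- al))%:E *
    (if 0 < y then expR (- ((1 + v) * y)) else 0)%:E))%E.
  apply: eq_integral => y _; rewrite -EFinM /K v0 andbT.
  by case: ifP; rewrite ?mulr0.
rewrite ge0_integralZl//=; last 3 first.
- by apply/measurable_EFinP; measurability.
- by move=> x _; rewrite lee_fin; case: ifP => // _; rewrite expR_ge0.
- by rewrite lee_fin powR_ge0.
by rewrite integral_expR_rate ?EFinM//; lra.
Qed.

End beta.

Section beta_finite.
Context {R : realType}.
Notation mu := (@lebesgue_measure R).
Implicit Types (al : R).

Lemma cvgy_powRN al : 0 < al -> (v : R) `^ (- al) @[v --> +oo] --> 0.
Proof.
move=> al0; apply/cvgr0Pnorm_lt => e e0; near=> v.
have v0 : 0 < v by near: v; exact: nbhs_pinfty_gt.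
have ve : (e `^ al^-1)^-1 < v by near: v; exact: nbhs_pinfty_gt.
rewrite ger0_norm ?powR_ge0//.
have -> : e = (e `^ (- al^-1)) `^ (- al).
  by rewrite -powRrM mulrNN mulVf ?gt_eqF// powRr1// ltW.
rewrite !powRN ltf_pV2 ?posrE ?powR_gt0//; last by rewrite invr_gt0 powR_gt0.
rewrite gt0_ltr_powR ?nnegrE ?invr_ge0 ?powR_ge0 ?(ltW v0)//.
Unshelve. all: by end_near. Qed.

Lemma integral_powR_y al : 0 < al ->
  (\int[mu]_(v in `[1%R, +oo[) (v `^ (- (1 + al)))%:E = (al^-1)%:E)%E.
Proof.
move=> al0; pose F (v : R) : R := - (v `^ (- al) / al).
have dF (v : R) : 0 < v -> is_derive v (1 : R) F (v `^ (- (1 + al))).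
  move=> v0.
  have H : is_derive v (1 : R) (fun y : R => (1 * y + 0) `^ (- al))
      (- al * (1 * v + 0) `^ (- al - 1) * 1).
    by apply: is_derive_powR_affine; lra.
  have -> : F = (- al^-1) \*: (fun y : R => (1 * y + 0) `^ (- al)).
    apply/funext => y; rewrite /F /= mul1r addr0 /GRing.scale /=.
    by rewrite mulNr mulrC.
  apply: is_derive_eq; rewrite /GRing.scale /= mul1r addr0 mulr1.
  have -> : - al - 1 = - (1 + al) by ring.
  by field; rewrite gt_eqF.
have cF (v : R) : 0 < v -> {for v, continuous F}.
  move=> v0; apply: differentiable_continuous; apply/derivable1_diffP.
  by have [] := dF v v0.
have cf (v : R) : 0 < v -> {for v, continuous (fun v : R => v `^ (- (1 + al)))}.
  move=> v0.
  have -> : (fun v : R => v `^ (- (1 + al))) = (fun y : R => (1 * y + 0) `^ (- (1 + al))).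
    by apply/funext => y; rewrite mul1r addr0.
  by apply: continuous_powR_affine; lra.
rewrite (@ge0_continuous_FTC2y _ _ F 1 0).
- by rewrite /F powR1 sub0e -EFinN opprK mul1r.
- by move=> v _; exact: powR_ge0.
- apply/continuous_within_itvcyP; split.
    by move=> v; rewrite in_itv/= andbT => v1; apply: cf; lra.
  by apply: cvg_at_right_filter; apply: cf.
- rewrite -oppr0 -(mul0r al^-1); apply: cvgN; apply: cvgM; last exact: cvg_cst.
  exact: cvgy_powRN.
- by move=> v v1; have [] := dF v _ => //; lra.
- by apply: cvg_at_right_filter; apply: cF.
- by move=> v; rewrite in_itv/= andbT => v1; rewrite derive1E; have [|_ ->] := dF v _ => //; lra.
Qed.

(** The factor [1 / (1 + v)] is at most 1 on []0, 1[] and at most [1 / v] beyond, which leaves an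
    integrable power on each side. *)
Lemma beta_kernel_lty al : 0 < al < 1 ->
  (\int[mu]_v (beta_kernel al v)%:E < +oo)%E.
Proof.
move=> /andP[al0 al1].
pose w1 (v : R) : R := if (0 < v) && (v < 1) then (v - 0) `^ (- al) else 0.
pose w2 (v : R) : R := if 1 <= v then v `^ (- (1 + al)) else 0.
have mw1 : measurable_fun setT w1 by rewrite /w1; measurability.
have mw2 : measurable_fun setT w2 by rewrite /w2; measurability.
have w10 v : 0 <= w1 v by rewrite /w1; case: ifP => // _; rewrite powR_ge0.
have w20 v : 0 <= w2 v by rewrite /w2; case: ifP => // _; rewrite powR_ge0.
apply: (@le_lt_trans _ _ (\int[mu]_v ((w1 v)%:E + (w2 v)%:E))%E).
  apply: ge0_le_integral => //.
  - by move=> v _; rewrite lee_fin beta_kernel_ge0.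
  - by apply/measurable_EFinP; exact: measurable_beta_kernel.
  - by apply: emeasurable_funD; exact/measurable_EFinP.
  move=> v _; rewrite -EFinD lee_fin /beta_kernel; case: ifPn => v0; last first.
    by rewrite addr_ge0.
  have le1 : (1 + v) `^ (- 1) <= 1.
    by rewrite powR_inv1 ?invf_le1//; lra.
  rewrite /w1 /w2 v0 subr0 /=; case: ltP => v1; last first.
    have -> : - (1 + al) = - al + - 1 by ring.
    rewrite add0r [leRHS]powRD; last first.
      by rewrite (gt_eqF v0) implybT.
    rewrite ler_wpM2l ?powR_ge0// !powR_inv1; [|lra|lra].
    by rewrite lef_pV2 ?posrE; lra.
  by rewrite addr0 ler_piMr ?powR_ge0.
rewrite ge0_integralD//; last 4 first.
- by move=> v _; rewrite lee_fin.
- exact/measurable_EFinP.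
- by move=> v _; rewrite lee_fin.
- exact/measurable_EFinP.
apply: lte_add_pinfty.
- rewrite [X in (X < _)%E](_ : _ =
    (\int[mu]_(v in `]0%R, 1%R[) ((v - 0) `^ (- al))%:E)%E).
    by rewrite integral_powR_left// ltry.
  rewrite [RHS]integral_mkcond; apply: eq_integral => v _; rewrite patchE /w1.
  by rewrite mem_setE in_itv/=; case: ifP.
- rewrite [X in (X < _)%E](_ : _ =
    (\int[mu]_(v in `[1%R, +oo[) (v `^ (- (1 + al)))%:E)%E).
    by rewrite integral_powR_y// ltry.
  rewrite [RHS]integral_mkcond; apply: eq_integral => v _; rewrite patchE /w2.
  by rewrite mem_setE in_itv/= andbT; case: ifP.
Qed.

Lemma beta_kernel_gt0 al : 0 < al < 1 ->
  (0 < \int[mu]_v (beta_kernel al v)%:E)%E.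
Proof.
move=> /andP[al0 al1].
pose w (v : R) : R := if (0 < v) && (v < 1) then 2^-1 else 0.
apply: (@lt_le_trans _ _ (\int[mu]_v (w v)%:E)%E); last first.
  apply: ge0_le_integral => //.
  - by move=> v _; rewrite lee_fin /w; case: ifP.
  - by apply/measurable_EFinP; rewrite /w; measurability.
  - by apply/measurable_EFinP; exact: measurable_beta_kernel.
  move=> v _; rewrite lee_fin /w /beta_kernel; case: ifPn => [/andP[v0 v1]|_]; last first.
    by case: ifP => // _; rewrite mulr_ge0 ?powR_ge0.
  rewrite v0 powR_inv1; last lra.
  rewrite -[leLHS]mul1r; apply: ler_pM => //.
    have : v `^ 0 <= v `^ (- al) by apply: ger_powR; [apply/andP; split|]; lra.
    by rewrite powRr0.
  by rewrite lef_pV2 ?posrE; lra.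
rewrite [X in (_ < X)%E](_ : _ = (\int[mu]_(v in `]0%R, 1%R[) (2^-1)%:E)%E).
  by rewrite integral_cst//= lebesgue_measure_itv/= lte_fin ltr01 -EFinB -EFinM lte_fin; lra.
rewrite [RHS]integral_mkcond; apply: eq_integral => v _; rewrite patchE /w.
by rewrite mem_setE in_itv/=; case: ifP.
Qed.

(** [Gamma] is a real number obtained through [fine], so both integrals must be shown finite. Their
    product is positive and finite, whereas an infinite factor would make it zero or infinite. *)
Lemma Gamma_mul al : 0 < al < 1 ->
  Gamma (1 - al) * Gamma al = fine (\int[mu]_v (beta_kernel al v)%:E)%E.
Proof.
move=> al01; rewrite !GammaE -Gamma_mul_ereal.
set g1 := (\int[mu]_x _)%E; set g2 := (\int[mu]_x _)%E.
have g10 : (0 <= g1)%E.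
  by apply: integral_ge0 => x _; rewrite lee_fin gamma_density_ge0.
have g20 : (0 <= g2)%E.
  by apply: integral_ge0 => x _; rewrite lee_fin gamma_density_ge0.
have p0 := beta_kernel_gt0 al01; have py := beta_kernel_lty al01.
move: p0 py; rewrite -Gamma_mul_ereal -/g1 -/g2.
move: g10 g20; case: g1 => [r| |]; case: g2 => [s| |] //=.
- move=> r0 _; have [->|rn0] := eqVneq r 0; first by rewrite mul0e ltxx.
  by rewrite gt0_muley// lte_fin lt_neqAle eq_sym rn0.
- move=> _ r0; have [->|rn0] := eqVneq s 0; first by rewrite mule0 ltxx.
  by rewrite gt0_mulye// lte_fin lt_neqAle eq_sym rn0.
Qed.

Lemma fine_beta_gt0 al : 0 < al < 1 ->
  0 < fine (\int[mu]_v (beta_kernel al v)%:E)%E.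
Proof.
by move=> al01; rewrite fine_gt0// beta_kernel_gt0// beta_kernel_lty.
Qed.

End beta_finite.

(** * Inversion of the right-sided fractional derivative *)

Section integrability.
Context {d : measure_display} {T : measurableType d} {R : realType}.
Variable m : {measure set T -> \bar R}.

Lemma integrable_le (f h : T -> R) : measurable_fun setT f ->
  (forall x, `|f x| <= h x) -> m.-integrable setT (EFin \o h) ->
  m.-integrable setT (EFin \o f).
Proof.
move=> mf fh ih; apply: le_integrable ih => //; first exact/measurable_EFinP.
by move=> x _ /=; rewrite lee_fin (le_trans (fh x))// ler_norm.
Qed.

Lemma ge0_integrable (f : T -> R) : measurable_fun setT f ->
  (forall x, 0 <= f x) -> (\int[m]_x (f x)%:E < +oo)%E ->
  m.-integrable setT (EFin \o f).
Proof.
move=> mf f0 fy; apply/integrableP; split; first exact/measurable_EFinP.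
by under eq_integral do rewrite /= ger0_norm//.
Qed.

Lemma integrable_scale (k : R) (f : T -> R) : m.-integrable setT (EFin \o f) ->
  m.-integrable setT (EFin \o (fun x => k * f x)).
Proof. exact: (@integrableZl _ _ _ _ _ _ k (EFin \o f)). Qed.

End integrability.

Lemma integrable_tensor {d1 d2 : measure_display} {T1 : measurableType d1}
    {T2 : measurableType d2} {R : realType}
    (m1 : {sigma_finite_measure set T1 -> \bar R})
    (m2 : {sigma_finite_measure set T2 -> \bar R}) (f : T1 -> R) (h : T2 -> R) :
  m1.-integrable setT (EFin \o f) -> m2.-integrable setT (EFin \o h) ->
  (m1 \x m2)%E.-integrable setT (EFin \o (fun z => f z.1 * h z.2)).
Proof.
move=> fi hi.
have mf : measurable_fun setT f by apply/measurable_EFinP; exact: measurable_int fi.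
have mh : measurable_fun setT h by apply/measurable_EFinP; exact: measurable_int hi.
apply/integrable12ltyP.
  apply/measurable_EFinP; apply: measurable_funM.
    exact: (measurableT_comp mf measurable_fst).
  exact: (measurableT_comp mh measurable_snd).
have /integrableP[_ fy] := fi; have /integrableP[_ hy] := hi.
rewrite (_ : (\int[m1]_x _)%E = (\int[m1]_x `|(f x)%:E| * \int[m2]_y `|(h y)%:E|)%E).
  by rewrite lte_mul_pinfty// ?integral_ge0// ge0_fin_numE// integral_ge0.
rewrite -ge0_integralZr//; last 2 first.
- by apply: measurableT_comp => //; exact/measurable_EFinP.
- exact: integral_ge0.
apply: eq_integral => x _; rewrite -ge0_integralZl//; last first.
  by apply: measurableT_comp => //; exact/measurable_EFinP.
by apply: eq_integral => y _; rewrite /= normrM EFinM.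
Qed.

Lemma integrable_fubini_G {d1 d2 : measure_display} {T1 : measurableType d1}
    {T2 : measurableType d2} {R : realType}
    (m1 : {sigma_finite_measure set T1 -> \bar R})
    (m2 : {sigma_finite_measure set T2 -> \bar R}) (f : T1 * T2 -> \bar R) :
  (m1 \x m2)%E.-integrable setT f -> m2.-integrable setT (fubini_G m1 f).
Proof.
move=> fi; have mf : measurable_fun setT f by exact: measurable_int fi.
have maf : measurable_fun setT (fun y => \int[m1]_x `|f (x, y)|)%E.
  apply: (measurable_fun_fubini_tonelli_G (abse \o f)) => //=.
  exact: measurableT_comp.
apply/integrableP; split; first exact: measurable_fubini_G fi.
apply: (le_lt_trans _ ((integrable21ltyP m1 m2 mf).1 fi)).
apply: ge0_le_integral => //.
  by apply: measurableT_comp => //; exact: measurable_fubini_G fi.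
by move=> y _; apply: le_abse_integral => //; exact: measurableT_comp.
Qed.

Section affine_signed.
Context {R : realType}.
Notation mu := (@lebesgue_measure R).

Lemma integral_affine (k c : R) (f : R -> R) : 0 < k ->
  mu.-integrable setT (EFin \o f) ->
  (\int[mu]_x (f x)%:E = \int[mu]_x (k * f (k * x + c))%:E)%E.
Proof.
move=> k0 fi.
have mf : measurable_fun setT f by apply/measurable_EFinP; exact: measurable_int fi.
pose fp x := Num.max (f x) 0; pose fn x := Num.max (- f x) 0.
have fE x : f x = fp x - fn x.
  rewrite /fp /fn; case: (leP (f x) 0) => f0; case: (leP (- f x) 0) => f1; lra.
have mfp : measurable_fun setT fp by apply: measurable_maxr.
have mfn : measurable_fun setT fn.
  by apply: measurable_maxr => //; apply: measurable_funN.
have fp0 x : 0 <= fp x by rewrite /fp le_max lexx orbT.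
have fn0 x : 0 <= fn x by rewrite /fn le_max lexx orbT.
have fnorm : mu.-integrable setT (EFin \o (fun x => `|f x|)).
  by have := integrable_abse fi.
have ifp : mu.-integrable setT (EFin \o fp).
  apply: integrable_le fnorm => // x; rewrite ger0_norm// /fp ge_max normr_ge0.
  by rewrite ler_norm.
have ifn : mu.-integrable setT (EFin \o fn).
  apply: integrable_le fnorm => // x; rewrite ger0_norm// /fn ge_max normr_ge0.
  by rewrite -normrN ler_norm.
have aff (h : R -> R) : measurable_fun setT h -> (forall x, 0 <= h x) ->
    mu.-integrable setT (EFin \o h) ->
    mu.-integrable setT (EFin \o (fun x => k * h (k * x + c))) /\
    (\int[mu]_x (h x)%:E = \int[mu]_x (k * h (k * x + c))%:E)%E.
  move=> mh h0 ih.
  have mhk : measurable_fun setT (fun x => h (k * x + c)).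
    by apply: (measurableT_comp mh); measurability.
  have E : (\int[mu]_x (h x)%:E = \int[mu]_x (k * h (k * x + c))%:E)%E.
    transitivity (k%:E * \int[mu]_x (h (k * x + c))%:E)%E.
      apply: (ge0_integral_affine c k0 (f := EFin \o h)).
        exact/measurable_EFinP.
      by move=> x; rewrite lee_fin.
    rewrite -ge0_integralZl//.
    - exact/measurable_EFinP.
    - by move=> x _; rewrite lee_fin.
    - by rewrite lee_fin ltW.
  split=> //; apply: ge0_integrable.
  - by apply: measurable_funM.
  - by move=> x; rewrite mulr_ge0// ltW.
  - rewrite -E; have /integrableP[_] := ih.
    by under eq_integral do rewrite /= ger0_norm//.
have [ip Ep] := aff fp mfp fp0 ifp; have [in_ En] := aff fn mfn fn0 ifn.
under eq_integral do rewrite fE EFinB.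
under [in RHS]eq_integral do rewrite fE mulrBr EFinB.
by rewrite !integralB_EFin// Ep En.
Qed.

End affine_signed.

Lemma ler_powRN {R : realType} (p x y : R) : 0 <= p -> 0 < x -> x <= y ->
  y `^ (- p) <= x `^ (- p).
Proof.
move=> p0 x0 xy; have y0 := lt_le_trans x0 xy.
by rewrite !powRN lef_pV2 ?posrE ?powR_gt0// ge0_ler_powR ?nnegrE ?(ltW x0) ?(ltW y0).
Qed.

Section weights.
Context {R : realType}.
Notation mu := (@lebesgue_measure R).
Implicit Types (al b t : R).

Lemma integral_if_itvoo b t (f : R -> R) :
  (\int[mu]_x (if (b < x)%R && (x < t)%R then f x else 0%R)%:E =
   \int[mu]_(x in `]b, t[) (f x)%:E)%E.
Proof.
rewrite [RHS]integral_mkcond; apply: eq_integral => v _; rewrite patchE.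
by rewrite mem_setE in_itv/=; case: ifP.
Qed.

Definition left_weight al b t (x : R) : R :=
  if (b < x) && (x < t) then (x - b) `^ (- al) else 0.

Lemma left_weight_ge0 al b t x : 0 <= left_weight al b t x.
Proof. by rewrite /left_weight; case: ifP; rewrite ?powR_ge0. Qed.

Lemma measurable_left_weight al b t : measurable_fun setT (left_weight al b t).
Proof. by rewrite /left_weight; measurability. Qed.

Lemma integrable_left_weight al b t : al < 1 ->
  mu.-integrable setT (EFin \o left_weight al b t).
Proof.
move=> al1; apply: ge0_integrable.
- exact: measurable_left_weight.
- exact: left_weight_ge0.
rewrite integral_if_itvoo; have [bt|tb] := ltP b t.
  by rewrite integral_powR_left// ltry.
by rewrite set_itv_ge ?integral_set0 ?ltry// bnd_simp -leNgt.
Qed.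

Lemma integrable_right_weight al b t : al < 1 ->
  mu.-integrable setT
    (EFin \o (fun x => if (b < x) && (x < t) then (t - x) `^ (- al) else 0)).
Proof.
move=> al1; apply: ge0_integrable.
- by measurability.
- by move=> x; case: ifP; rewrite ?powR_ge0.
rewrite integral_if_itvoo; have [bt|tb] := ltP b t.
  by rewrite integral_powR_right// ltry.
by rewrite set_itv_ge ?integral_set0 ?ltry// bnd_simp -leNgt.
Qed.

(** On each side of the midpoint one of the two factors is bounded by its value at distance
    [(t - b) / 2], and the other is an integrable power. *)
Lemma integrable_beta_weight al b t : 0 < al < 1 ->
  mu.-integrable setT
    (EFin \o (fun x => if (b < x) && (x < t)
      then (x - b) `^ (- al) * (t - x) `^ (al - 1) else 0)).
Proof.
move=> /andP[al0 al1].
pose h := (t - b) / 2.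
pose D x := h `^ (al - 1) * left_weight al b t x +
  h `^ (- al) * (if (b < x) && (x < t) then (t - x) `^ (- (1 - al)) else 0).
have iD : mu.-integrable setT (EFin \o D).
  rewrite (_ : EFin \o D = (fun x => (h `^ (al - 1))%:E * (left_weight al b t x)%:E +
    (h `^ (- al))%:E * (if (b < x)%R && (x < t)%R then (t - x) `^ (- (1 - al)) else 0)%:E)%E)//.
  apply: integrableD => //; apply: integrableZl => //.
    exact: integrable_left_weight.
  by apply: integrable_right_weight; lra.
apply: integrable_le iD; first by measurability.
move=> x; rewrite /D /left_weight; case: ifP => [/andP[bx xt]|_]; last first.
  by rewrite !mulr0 addr0 normr0.
have h0 : 0 < h by rewrite /h; lra.
have -> : - (1 - al) = al - 1 by ring.
rewrite ger0_norm ?mulr_ge0 ?powR_ge0//.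
have [xh|hx] := leP (x - b) h.
  apply: ler_wpDr; first by rewrite mulr_ge0 ?powR_ge0.
  rewrite mulrC ler_wpM2r ?powR_ge0//.
  have -> : al - 1 = - (1 - al) by ring.
  by apply: ler_powRN; move: xh; rewrite /h; lra.
apply: ler_wpDl; first by rewrite mulr_ge0 ?powR_ge0.
by rewrite ler_wpM2r ?powR_ge0// ler_powRN//; lra.
Qed.

End weights.

Section inversion.
Context {R : realType}.
Notation mu := (@lebesgue_measure R).
Variables (al b t M : R) (g : R -> R).
Hypotheses (al01 : 0 < al < 1) (bt : b < t) (gM : forall x, `|g x| <= M).
Hypothesis (mg : measurable_fun setT g).

Let al0 : 0 < al. Proof. by case/andP: al01. Qed.
Let al1 : al < 1. Proof. by case/andP: al01. Qed.
Let M0 : 0 <= M. Proof. by rewrite (le_trans _ (gM 0)). Qed.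

(** At [e = 0], the double integral in the pairing of [(x - b)^(- al)] with the right-sided Marchaud
    derivative of [g]; a positive [e] removes the singularity on the diagonal. *)
Definition marchaud (e : R) (z : R * R) : R :=
  if [&& b < z.1, z.1 < z.2 & z.2 < t] then
    (z.1 - b) `^ (- al) * (g z.2 - g z.1) * (z.2 - z.1 + e) `^ (al - 2)
  else 0.

Definition boundary (e : R) (x : R) : R :=
  if (b < x) && (x < t)
  then (x - b) `^ (- al) * g x * (t - x + e) `^ (al - 1) else 0.

(** [g] against an approximate point mass at [b]: as [e] tends to 0, the weight concentrates at [b]
    and its total mass tends to the integral of [beta_kernel]. *)
Definition concentration (e : R) (x : R) : R :=
  if (b < x) && (x < t)
  then g x * (e `^ al * (x - b) `^ (- al) * (x - b + e) `^ (- 1)) else 0.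

Let mg1 : measurable_fun setT (fun z : R * R => g z.1).
Proof. exact: (measurableT_comp mg measurable_fst). Qed.

Let mg2 : measurable_fun setT (fun z : R * R => g z.2).
Proof. exact: (measurableT_comp mg measurable_snd). Qed.

Lemma measurable_marchaud e : measurable_fun setT (marchaud e).
Proof. by rewrite /marchaud; measurability. Qed.

Lemma integrable_boundary (e : R) : 0 <= e ->
  mu.-integrable setT (EFin \o boundary e).
Proof.
move=> e0; have ib := integrable_beta_weight b t al01.
have {}ib := integrable_scale M ib.
apply: integrable_le ib.
  by rewrite /boundary; measurability.
move=> x; rewrite /boundary; case: ifP => [/andP[bx xt]|_]; last first.
  by rewrite mulr0 normr0.
rewrite !normrM !(ger0_norm (powR_ge0 _ _)) (mulrC _ `|g x|) -mulrA.
apply: ler_pM => //; first by rewrite mulr_ge0 ?powR_ge0.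
rewrite ler_wpM2l ?powR_ge0//.
have -> : al - 1 = - (1 - al) by ring.
by have := al1; have := al0; move=> *; apply: ler_powRN; lra.
Qed.

Lemma integrable_concentration (e : R) : 0 < e ->
  mu.-integrable setT (EFin \o concentration e).
Proof.
move=> e0; have ib := integrable_left_weight b t al1.
have {}ib := integrable_scale (M * (e `^ al * e `^ (- 1))) ib.
apply: integrable_le ib.
  by rewrite /concentration; measurability.
move=> x; rewrite /concentration /left_weight; case: ifP => [/andP[bx xt]|_]; last first.
  by rewrite mulr0 normr0.
rewrite !normrM !(ger0_norm (powR_ge0 _ _)) -!mulrA; apply: ler_pM => //.
  by rewrite !mulr_ge0 ?powR_ge0.
rewrite ler_wpM2l ?powR_ge0// mulrC ler_wpM2r ?powR_ge0//.
by have := al1; have := al0; move=> *; apply: ler_powRN; lra.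
Qed.

(** For [e > 0] the kernel is bounded by [e^(al - 2)], so the terms in [g z.2] and in [g z.1] can be
    integrated separately. The kernel at [e = 0] is not integrable near the diagonal, and only the
    difference makes sense there. *)
Lemma integrable_split_kernel (e : R) (k : R * R -> R) : 0 < e ->
  measurable_fun setT k -> (forall z, `|k z| <= M) ->
  (mu \x mu)%E.-integrable setT (EFin \o (fun z : R * R =>
    if [&& b < z.1, z.1 < z.2 & z.2 < t] then
      (z.1 - b) `^ (- al) * k z * (z.2 - z.1 + e) `^ (al - 2) else 0)).
Proof.
move=> e0 mk kM.
have i1 := integrable_left_weight b t al1.
have i2 := integrable_left_weight b t (ltr01 : (0 : R) < 1).
have ib := integrable_scale (M * e `^ (al - 2)) (integrable_tensor i1 i2).
apply: integrable_le ib; first by measurability.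
move=> [x u] /=; case: ifPn => [/and3P[bx xu ut]|_]; last first.
  rewrite normr0 !mulr_ge0 ?powR_ge0 ?left_weight_ge0//.
rewrite /left_weight bx ut (lt_trans bx xu) (lt_trans xu ut) oppr0 powRr0 mulr1.
rewrite !normrM !(ger0_norm (powR_ge0 _ _)) (mulrC _ `|k _|) -!mulrA.
apply: ler_pM => //; first by rewrite mulr_ge0 ?powR_ge0.
rewrite mulrC ler_wpM2r ?powR_ge0//.
have -> : al - 2 = - (2 - al) by ring.
by have := al1; have := al0; move=> *; apply: ler_powRN; lra.
Qed.

(** The term in [g z.2] is integrated over [z.1] first and the term in [g z.1] over [z.2] first, so
    that both become integrals against a single value of [g]. The contributions carrying
    [e^(al - 1)] nearly cancel: they have the factor [(x - b) / (x - b + e) - 1 = - e / (x - b +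
    e)], which produces [concentration]. *)
Lemma integral_marchaud (e : R) : 0 < e ->
  (\int[mu \x mu]_z (marchaud e z)%:E =
   (1 - al)^-1%:E * (\int[mu]_x (boundary e x)%:E -
                     \int[mu]_x (concentration e x)%:E))%E.
Proof.
move=> e0; have := al1; have := al0; move=> a0 a1.
have h1 : 1 - al != 0 by lra.
pose ind (z : R * R) := [&& b < z.1, z.1 < z.2 & z.2 < t].
pose U (z : R * R) := if ind z then
  (z.1 - b) `^ (- al) * g z.2 * (z.2 - z.1 + e) `^ (al - 2) else 0.
pose V (z : R * R) := if ind z then
  (z.1 - b) `^ (- al) * g z.1 * (z.2 - z.1 + e) `^ (al - 2) else 0.
have iU : (mu \x mu)%E.-integrable setT (EFin \o U).
  exact: integrable_split_kernel.
have iV : (mu \x mu)%E.-integrable setT (EFin \o V).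
  exact: integrable_split_kernel.
transitivity (\int[mu \x mu]_z ((U z)%:E - (V z)%:E))%E.
  apply: eq_integral => z _; rewrite -EFinB; congr EFin.
  rewrite /marchaud /U /V /ind; case: ifP => _; last by rewrite subr0.
  by rewrite mulrBr mulrBl.
rewrite integralB_EFin//.
rewrite -(integral21_prod_meas1 iU) -(integral12_prod_meas1 iV).
rewrite -integralB//; [|exact: integrable_fubini_G|exact: integrable_fubini_F].
rewrite -integralB_EFin//; last 2 first.
- by apply: integrable_boundary; exact: ltW.
- exact: integrable_concentration.
under [in RHS]eq_integral do rewrite -EFinB.
rewrite -integralZl//; last first.
  rewrite (_ : (fun x => _) = (EFin \o boundary e) \- (EFin \o concentration e))%E//.
  by apply: integrableB => //; [apply: integrable_boundary; exact: ltW|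
    exact: integrable_concentration].
apply: eq_integral => x _ /=; rewrite -EFinM.
rewrite [X in (X - _)%E](_ : _ = (if (b < x) && (x < t) then
    g x * ((x - b) `^ (1 - al) * e `^ (al - 1) / ((1 - al) * (x + e - b))) else 0)%:E); last first.
  rewrite /fubini_G /=; case: ifPn => [/andP[bx xt]|nx]; last first.
    rewrite integral0_eq// => y _; rewrite /U /ind /=.
    case: ifPn => // /and3P[h2 h3 h4]; move: nx; rewrite (lt_trans h2 h3) h4 //.
  rewrite EFinM; have xe : x < x + e by lra.
  have bxe := integral_powR_kernel al01 bx xe.
  have exE : x + e - x = e by ring.
  rewrite exE in bxe; rewrite -bxe -integral_if_itvoo -integralZl//; last first.
    apply: ge0_integrable.
    - by measurability.
    - by move=> y; case: ifP => // _; rewrite mulr_ge0 ?powR_ge0.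
    - by rewrite integral_if_itvoo bxe ltry.
  apply: eq_integral => y _; rewrite -EFinM; congr EFin; rewrite /U /ind /= xt andbT.
  case: ifPn => _; last by rewrite mulr0.
  by rewrite mulrAC mulrC (_ : x + e - y = x - y + e)//; ring.
rewrite [X in (_ - X)%E](_ : _ = (if (b < x) && (x < t) then
    (x - b) `^ (- al) * g x *
      (((t - x + e) `^ (al - 1) - e `^ (al - 1)) / (al - 1)) else 0)%:E); last first.
  rewrite /fubini_F /=; case: ifPn => [/andP[bx xt]|nx]; last first.
    rewrite integral0_eq// => y _; rewrite /V /ind /=.
    case: ifPn => // /and3P[h2 h3 h4]; move: nx; rewrite (lt_trans h3 h4) h2 //.
  have pos : {in `[x, t], forall y, 0 < 1 * y + (e - x)}.
    by move=> y; rewrite in_itv/= => /andP[xy yt]; lra.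
  have a12 : 2 - al != 1 by lra.
  have xte := integral_powR_affine xt (oner_neq0 R) a12 pos.
  rewrite EFinM.
  have -> : ((t - x + e) `^ (al - 1) - e `^ (al - 1)) / (al - 1) =
    ((1 * t + (e - x)) `^ (1 - (2 - al)) - (1 * x + (e - x)) `^ (1 - (2 - al))) /
      (1 * (1 - (2 - al))).
    have -> : 1 - (2 - al) = al - 1 by ring.
    have -> : 1 * t + (e - x) = t - x + e by ring.
    by have -> : 1 * x + (e - x) = e; [ring | rewrite mul1r].
  rewrite -xte -integral_if_itvoo -integralZl//; last first.
    apply: ge0_integrable.
    - by measurability.
    - by move=> y; case: ifP => // _; rewrite ?powR_ge0.
    - by rewrite integral_if_itvoo xte ltry.
  apply: eq_integral => y _; rewrite -EFinM; congr EFin; rewrite /V /ind /= bx /=.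
  case: ifPn => _; last by rewrite mulr0.
  have -> : 1 * y + (e - x) = y - x + e by ring.
  by have -> : - (2 - al) = al - 2 by ring.
rewrite -EFinB; congr EFin; rewrite /boundary /concentration.
case: ifPn => [/andP[bx xt]|_]; last by rewrite !subr0 mulr0.
rewrite powR_inv1; last lra.
have -> : (x - b) `^ (1 - al) = (x - b) * (x - b) `^ (- al).
  by apply: powR1D; lra.
have -> : e `^ al = e * e `^ (al - 1).
  by rewrite -powR1D//; congr (_ `^ _); ring.
field.
by apply/and3P; split; lra.
Qed.

Let eps (n : nat) : R := n.+1%:R^-1.
Let eps0 n : 0 < eps n. Proof. by rewrite invr_gt0. Qed.
Let cvg_eps : eps n @[n --> \oo] --> 0. Proof. exact: cvg_harmonic. Qed.

Let cvg_powR_eps (y p : R) : 0 < y -> (y + eps n) `^ p @[n --> \oo] --> y `^ p.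
Proof.
move=> y0; have cp : {for y, continuous (fun z : R => z `^ p)}.
  have -> : (fun z : R => z `^ p) = (fun z => (1 * z + 0) `^ p).
    by apply/funext => z; rewrite mul1r addr0.
  by apply: continuous_powR_affine; rewrite mul1r addr0.
have H : y + eps n @[n --> \oo] --> y.
  by rewrite -[X in _ --> X]addr0; apply: cvgD cvg_eps; exact: cvg_cst.
exact: (cvg_comp _ _ H cp).
Qed.

Hypothesis iM : (mu \x mu)%E.-integrable setT (EFin \o marchaud 0).
Hypothesis cg : g x @[x --> b] --> g b.

(** The kernel decreases in [e], so the integrand at [e = 0], integrable by [iM], dominates all the
    others. *)
Lemma cvg_integral_marchaud :
  (\int[mu \x mu]_z (marchaud (eps n) z)%:E @[n --> \oo] -->
   \int[mu \x mu]_z (marchaud 0 z)%:E)%E.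
Proof.
have := al1; have := al0; move=> a0 a1.
apply: (@dominated_cvg _ _ _ (mu \x mu)%E setT measurableT
  (fun n => EFin \o marchaud (eps n)) (EFin \o marchaud 0)
  (EFin \o (fun z => `|marchaud 0 z|))) => //.
- by move=> n; apply/measurable_EFinP; exact: measurable_marchaud.
- move=> z _; apply: cvg_EFin; first by apply: nearW.
  rewrite /comp /marchaud /=; case: ifPn => [/and3P[h1 h2 h3]|_]; last exact: cvg_cst.
  apply: cvgM; first exact: cvg_cst.
  by rewrite addr0; apply: cvg_powR_eps; lra.
- exact: integrable_abse iM.
- move=> n z _; rewrite lee_fin /marchaud.
  case: ifPn => [/and3P[h1 h2 h3]|_]; last by rewrite normr0.
  rewrite addr0 !normrM !(ger0_norm (powR_ge0 _ _)) ler_wpM2l ?mulr_ge0 ?powR_ge0//.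
  have -> : al - 2 = - (2 - al) by ring.
  by apply: ler_powRN; [lra|lra|rewrite lerDl ltW].
Qed.

Lemma cvg_integral_boundary :
  (\int[mu]_x (boundary (eps n) x)%:E @[n --> \oo] -->
   \int[mu]_x (boundary 0 x)%:E)%E.
Proof.
have := al1; have := al0; move=> a0 a1.
apply: (@dominated_cvg _ _ _ mu setT measurableT
  (fun n => EFin \o boundary (eps n)) (EFin \o boundary 0)
  (EFin \o (fun z => `|boundary 0 z|))) => //.
- by move=> n; apply: measurable_int (integrable_boundary (ltW (eps0 n))).
- move=> z _; apply: cvg_EFin; first by apply: nearW.
  rewrite /comp /boundary /=; case: ifPn => [/andP[h1 h2]|_]; last exact: cvg_cst.
  apply: cvgM; first exact: cvg_cst.
  by rewrite addr0; apply: cvg_powR_eps; lra.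
- exact: integrable_abse (integrable_boundary (lexx 0)).
- move=> n z _; rewrite lee_fin /boundary; case: ifPn => [/andP[h1 h2]|_]; last by rewrite normr0.
  rewrite addr0 !normrM !(ger0_norm (powR_ge0 _ _)) ler_wpM2l ?mulr_ge0 ?powR_ge0//.
  have -> : al - 1 = - (1 - al) by ring.
  by apply: ler_powRN; [lra|lra|rewrite lerDl ltW].
Qed.

Lemma integrable_beta_kernel : mu.-integrable setT (EFin \o beta_kernel al).
Proof.
apply: ge0_integrable.
- exact: measurable_beta_kernel.
- exact: beta_kernel_ge0.
- exact: beta_kernel_lty.
Qed.

(* The rescaling [x = b + e v] turns the kernel into a fixed integrable one. *)
Lemma cvg_integral_concentration :
  (\int[mu]_x (concentration (eps n) x)%:E @[n --> \oo] -->
   (g b)%:E * \int[mu]_v (beta_kernel al v)%:E)%E.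
Proof.
have := al1; have := al0; move=> a0 a1.
pose f n (v : R) : R := if eps n * v < t - b then g (eps n * v + b) * beta_kernel al v else 0.
rewrite -integralZl//; last exact: integrable_beta_kernel.
rewrite [X in X @ _ --> _](_ : _ = (fun n => \int[mu]_v (f n v)%:E)%E); last first.
  apply/funext => n; rewrite (integral_affine b (eps0 n)); last exact: integrable_concentration.
  apply: eq_integral => v _; congr EFin; rewrite /concentration /f /beta_kernel.
  rewrite ltrDr pmulr_rgt0//; case: ifPn => [/andP[v0 vt]|]; last first.
    rewrite negb_and => /orP[|] h; first by rewrite (negbTE h) !mulr0; case: ifP.
    by rewrite mulr0 ltrBrDr (negbTE h).
  rewrite v0 ltrBrDr vt addrK powRM ?ltW//.
  have -> : eps n * v + eps n = eps n * (1 + v) by ring.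
  rewrite powRM ?ltW//; last by lra.
  rewrite (powR_inv1 (ltW (eps0 n))) powRN.
  by field; rewrite gt_eqF//= gt_eqF// powR_gt0.
have mf n : measurable_fun setT (f n).
  apply: measurable_fun_ifT; first by measurability.
    apply: measurable_funM; last exact: measurable_beta_kernel.
    by apply: (measurableT_comp mg); measurability.
  exact: measurable_cst.
apply: (@dominated_cvg _ _ _ mu setT measurableT (fun n => EFin \o f n)
  (fun v => (g b)%:E * (beta_kernel al v)%:E)%E
  (EFin \o (fun v => M * beta_kernel al v))) => //.
- by move=> n; have /measurable_EFinP := mf n.
- move=> v _; apply: cvg_EFin; first by apply: nearW.
  rewrite /comp /=.
  have ev : eps n * v @[n --> \oo] --> 0.
    by rewrite -(mul0r v); apply: cvgM => //; exact: cvg_cst.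
  have tb : 0 < t - b by rewrite subr_gt0.
  have Hn : \forall n \near \oo, g (eps n * v + b) * beta_kernel al v = f n v.
    near=> n; rewrite /f ifT//; near: n.
    by move/cvgr_lt : ev; apply.
  apply: cvg_trans; first by apply: near_eq_cvg; exact: Hn.
  apply: cvgM; last exact: cvg_cst.
  have H : eps n * v + b @[n --> \oo] --> b.
    by rewrite -[X in _ --> X]add0r; apply: cvgD => //; exact: cvg_cst.
  exact: (cvg_comp _ _ H cg).
- by apply: integrable_scale; exact: integrable_beta_kernel.
- move=> n v _; rewrite lee_fin /f; case: ifPn => _; last first.
    by rewrite normr0 mulr_ge0// beta_kernel_ge0.
  by rewrite normrM (ger0_norm (beta_kernel_ge0 _ _)) ler_wpM2r ?beta_kernel_ge0.
Unshelve. all: by end_near. Qed.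

Lemma integral_marchaud0 :
  (\int[mu \x mu]_z (marchaud 0 z)%:E = (1 - al)^-1%:E *
    (\int[mu]_x (boundary 0 x)%:E - (g b)%:E * \int[mu]_v (beta_kernel al v)%:E))%E.
Proof.
apply: cvg_unique cvg_integral_marchaud _ => //=.
under eq_fun do rewrite integral_marchaud//.
have fb : (\int[mu]_x (boundary 0 x)%:E \is a fin_num)%E.
  by apply: integrable_fin_num => //; exact: (integrable_boundary (lexx 0)).
have fk : (\int[mu]_v (beta_kernel al v)%:E \is a fin_num)%E.
  by apply: integrable_fin_num => //; exact: integrable_beta_kernel.
apply: cvgeM => //.
- by apply: mule_def_fin => //; rewrite fin_numB fb fin_numM.
- exact: cvg_cst.
- apply: cvgeB => //; first by rewrite fin_num_adde_defl// fin_numN fin_numM.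
  + exact: cvg_integral_boundary.
  + exact: cvg_integral_concentration.
Qed.

End inversion.

Section ae_integrable.
Context {d : measure_display} {T : measurableType d} {R : realType}.
Variable m : {measure set T -> \bar R}.

Lemma ae_eq_integralT (f h : T -> \bar R) : measurable_fun setT f ->
  measurable_fun setT h -> (\forall x \ae m, f x = h x) ->
  (\int[m]_x f x = \int[m]_x h x)%E.
Proof. by move=> mf mh fh; apply: ae_eq_integral => //; apply: filterS fh => x + _. Qed.

Lemma ae_eq_integrable (f h : T -> \bar R) : measurable_fun setT f ->
  (\forall x \ae m, f x = h x) -> m.-integrable setT h -> m.-integrable setT f.
Proof.
move=> mf fh ih; apply/integrableP; split=> //; have /integrableP[mh] := ih.
rewrite (@ae_eq_integral _ _ _ m setT (fun x => `|h x|)%E (fun x => `|f x|)%E)//.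
- exact: measurableT_comp.
- exact: measurableT_comp.
- by apply: filterS fh => x + _ => ->.
Qed.

End ae_integrable.

Section RL_derivative.
Context {R : realType}.
Notation mu := (@lebesgue_measure R).
Implicit Types (al b t : R) (g : R -> R).

Lemma Rintegral_itvcc a b (h : R -> R) : measurable_fun setT h ->
  \int[mu]_(u in `[a, b]) h u =
  fine (\int[mu]_u (if (a < u)%R && (u < b)%R then h u else 0%R)%:E)%E.
Proof.
move=> mh; rewrite /Rintegral integral_itv_bndoo ?integral_if_itvoo//.
by apply/measurable_EFinP; exact: measurable_funS mh.
Qed.

(** Integrability of the slices is not assumed, so the measurability part of Tonelli's theorem is
    applied to the positive and negative parts separately. *)
Lemma measurable_fine_integral (h : R * R -> R) : measurable_fun setT h ->
  measurable_fun setT (fun x => fine (\int[mu]_u (h (x, u))%:E)%E).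
Proof.
move=> mh; apply: measurableT_comp; first exact: fine_measurable.
have mp : measurable_fun setT (fun z => Num.max (h z) 0) by exact: measurable_maxr.
have mn : measurable_fun setT (fun z => Num.max (- h z) 0).
  by apply: measurable_maxr => //; exact: measurable_funN.
rewrite (_ : (fun x => _) = (fun x =>
    \int[mu]_u (Num.max (h (x, u)) 0)%:E - \int[mu]_u (Num.max (- h (x, u)) 0)%:E))%E.
  apply: emeasurable_funB.
  - apply: (@measurable_fun_fubini_tonelli_F _ _ _ _ _ mu (fun z => (Num.max (h z) 0)%:E)).
      exact/measurable_EFinP.
    by move=> z; rewrite lee_fin le_max lexx orbT.
  - apply: (@measurable_fun_fubini_tonelli_F _ _ _ _ _ mu (fun z => (Num.max (- h z) 0)%:E)).
      exact/measurable_EFinP.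
    by move=> z; rewrite lee_fin le_max lexx orbT.
apply/funext => x; rewrite integralE; congr (_ - _)%E; apply: eq_integral => u _.
- by rewrite funeposE EFin_max.
- by rewrite funenegE EFin_max.
Qed.

(* The factor depending on the integrator in the generalized
   Lebesgue-Stieltjes integral. *)
Definition right_derivative al t g (x : R) : R :=
  (g t - g x) / (t - x) `^ (1 - al) +
  (1 - al) * \int[mu]_(u in `[x, t]) ((g u - g x) / (u - x) `^ (2 - al)).

Lemma right_derivativeE al t g x : measurable_fun setT g ->
  right_derivative al t g x = (g t - g x) * (t - x) `^ (al - 1) +
  (1 - al) * fine (\int[mu]_u (if (x < u)%R && (u < t)%R
     then (g u - g x) * (u - x) `^ (al - 2) else 0%R)%:E)%E.
Proof.
move=> mg; rewrite /right_derivative -powRN opprB.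
rewrite (_ : (fun u => _) = (fun u => (g u - g x) * (u - x) `^ (al - 2))).
  by rewrite Rintegral_itvcc//; measurability.
by apply/funext => u; rewrite -powRN opprB.
Qed.

Lemma measurable_right_derivative al t g : measurable_fun setT g ->
  measurable_fun setT (right_derivative al t g).
Proof.
move=> mg.
rewrite (_ : right_derivative al t g = (fun x => (g t - g x) * (t - x) `^ (al - 1) +
  (1 - al) * fine (\int[mu]_u (if (x < u)%R && (u < t)%R
     then (g u - g x) * (u - x) `^ (al - 2) else 0%R)%:E)%E)); last first.
  by apply/funext => x; rewrite right_derivativeE.
have mg1 : measurable_fun setT (fun z : R * R => g z.1).
  exact: (measurableT_comp mg measurable_fst).
have mg2 : measurable_fun setT (fun z : R * R => g z.2).
  exact: (measurableT_comp mg measurable_snd).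
apply: measurable_funD; first by measurability.
apply: measurable_funM; first exact: measurable_cst.
apply: (measurable_fine_integral (h := fun z : R * R =>
  if (z.1 < z.2) && (z.2 < t) then (g z.2 - g z.1) * (z.2 - z.1) `^ (al - 2) else 0)).
by measurability.
Qed.

(* Inversion of the right-sided fractional derivative of order [1 - al], taken
   at [b]. *)
Lemma integral_right_derivative al b t M g : 0 < al < 1 -> b < t ->
  (forall x, `|g x| <= M) -> measurable_fun setT g -> g x @[x --> b] --> g b ->
  (mu \x mu)%E.-integrable setT (EFin \o marchaud al b t g 0) ->
  mu.-integrable setT
    (EFin \o (fun x => left_weight al b t x * right_derivative al t g x)) /\
  (\int[mu]_x (left_weight al b t x * right_derivative al t g x)%:E =
    ((g t - g b) * fine (\int[mu]_v (beta_kernel al v)%:E))%:E)%E.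
Proof.
move=> al01 bt gM mg cg iM; have /andP[al0 al1] := al01.
(* Subtracting the constant [g t] does not change the increments, and turns the boundary term of the
   derivative into [- boundary] for [G]. *)
pose G x := g x - g t.
have GM x : `|G x| <= M + M by rewrite (le_trans (ler_normB _ _))// lerD.
have mG : measurable_fun setT G by rewrite /G; measurability.
have cG : G x @[x --> b] --> G b by apply: cvgB => //; exact: cvg_cst.
have GE : marchaud al b t G 0 = marchaud al b t g 0.
  apply/funext => z; rewrite /marchaud /G; case: ifP => // _.
  by congr (_ * _ * _); ring.
have iG : (mu \x mu)%E.-integrable setT (EFin \o marchaud al b t G 0) by rewrite GE.
have iF := integrable_fubini_F iG.
have ib : mu.-integrable setT (EFin \o boundary al b t G 0).
  exact: integrable_boundary (lexx 0).
pose K x := left_weight al b t x * right_derivative al t g x.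
pose D := (fun x => (1 - al)%:E * fubini_F mu (EFin \o marchaud al b t G 0) x
   - (boundary al b t G 0 x)%:E)%E.
have mK : measurable_fun setT K.
  apply: measurable_funM; first exact: measurable_left_weight.
  exact: measurable_right_derivative.
have iZ : mu.-integrable setT
    (fun x => (1 - al)%:E * fubini_F mu (EFin \o marchaud al b t G 0) x)%E.
  exact: integrableZl.
have iD : mu.-integrable setT D by exact: integrableB.
(* Integrability of the slices, known for almost every [x], allows the power of [x - b] to be pulled
   out of the inner integral. *)
have KD : \forall x \ae mu, (K x)%:E = D x.
  apply: filterS (ae_integrable1 iG) => x ix.
  rewrite /K /D /left_weight /boundary; case: ifPn => [/andP[bx xt]|nx]; last first.
    rewrite mul0r sube0 /fubini_F integral0_eq ?mule0// => u _ /=.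
    rewrite /marchaud /=; case: ifPn => // /and3P[h1 h2 h3].
    by move: nx; rewrite h1 (lt_trans h2 h3).
  have xb : 0 < x - b by lra.
  pose J (u : R) := if (x < u) && (u < t) then (g u - g x) * (u - x) `^ (al - 2) else 0.
  have sliceE u : marchaud al b t G 0 (x, u) = (x - b) `^ (- al) * J u.
    rewrite /marchaud /J bx /=; case: ifP => _; last by rewrite mulr0.
    by rewrite addr0 -mulrA /G; congr (_ * (_ * _)); ring.
  have pn0 : (x - b) `^ (- al) != 0 by rewrite gt_eqF// powR_gt0.
  have iJ : mu.-integrable setT (EFin \o J).
    have := integrable_scale ((x - b) `^ (- al))^-1 ix.
    by apply: eq_integrable => // u _; rewrite /= sliceE mulKf.
  have -> : fubini_F mu (EFin \o marchaud al b t G 0) x =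
      ((x - b) `^ (- al) * fine (\int[mu]_u (J u)%:E))%:E.
    rewrite EFinM fineK; last exact: integrable_fin_num.
    rewrite -integralZl//; apply: eq_integral => u _ /=.
    by rewrite sliceE.
  rewrite -EFinM -EFinB right_derivativeE//; congr EFin.
  by rewrite /G addr0; ring.
have iK : mu.-integrable setT (EFin \o K).
  by apply: (ae_eq_integrable _ KD) => //; exact/measurable_EFinP.
split=> //.
rewrite (ae_eq_integralT _ (measurable_int _ iD) KD); last exact/measurable_EFinP.
rewrite /D integralB//.
rewrite integralZl// integral12_prod_meas1// (integral_marchaud0 al01 bt GM mG iG cG).
rewrite muleA -EFinM mulfV ?mul1e; last by lra.
have fb : (\int[mu]_x (boundary al b t G 0 x)%:E \is a fin_num)%E.
  exact: integrable_fin_num.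
have fk : (\int[mu]_v (beta_kernel al v)%:E \is a fin_num)%E.
  by apply: integrable_fin_num => //; exact: integrable_beta_kernel.
rewrite -(fineK fb) -(fineK fk) -EFinM -!EFinB /=; congr EFin.
by rewrite /G; ring.
Qed.

End RL_derivative.

(** * Generalized Lebesgue-Stieltjes integrals of step functions *)

Section integral_bigsum.
Context {d : measure_display} {T : measurableType d} {R : realType}.
Variables (m : {measure set T -> \bar R}) (D : set T) (mD : measurable D).
Variables (I : eqType) (c : I -> R) (f : I -> T -> R).

Lemma integrable_bigsum (r : seq I) :
  (forall i, i \in r -> m.-integrable D (EFin \o f i)) ->
  m.-integrable D (EFin \o (fun x => \sum_(i <- r) c i * f i x)).
Proof.
move=> ir.
rewrite (_ : EFin \o _ = (fun x => \sum_(i <- r | i \in r) (c i * f i x)%:E)%E).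
  apply: integrable_sum => // j /ir ij.
  exact: (@integrableZl _ _ _ _ _ _ (c j) (EFin \o f j)).
by apply/funext => x /=; rewrite -big_seq sumEFin.
Qed.

Lemma Rintegral_bigsum (r : seq I) :
  (forall i, i \in r -> m.-integrable D (EFin \o f i)) ->
  \int[m]_(x in D) (\sum_(i <- r) c i * f i x) =
    \sum_(i <- r) c i * \int[m]_(x in D) f i x.
Proof.
elim: r => [_|i r IH ir].
  rewrite big_nil; under eq_Rintegral do rewrite big_nil.
  by rewrite /Rintegral integral0.
have ir' j : j \in r -> m.-integrable D (EFin \o f j).
  by move=> jr; apply: ir; rewrite in_cons jr orbT.
rewrite big_cons -IH//; under eq_Rintegral do rewrite big_cons.
have ii : m.-integrable D (EFin \o f i) by apply: ir; rewrite mem_head.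
have ic : m.-integrable D (EFin \o (fun x => c i * f i x)).
  exact: (@integrableZl _ _ _ _ _ _ (c i) (EFin \o f i)).
by rewrite RintegralD// ?RintegralZl//; exact: integrable_bigsum.
Qed.

End integral_bigsum.

Section step_functions.
Context {R : realType}.
Notation mu := (@lebesgue_measure R).
Implicit Types (al b t x : R) (g : R -> R) (s : seq (R * R)).

(** The pairs are (height, position). The strict inequality makes the function left continuous: its
    value at [x] involves only jumps strictly before [x], which is what adaptedness will need. *)
Definition step s (x : R) : R := \sum_(p <- s) p.1 * (p.2 < x)%R%:R.

Lemma step_nil x : step [::] x = 0. Proof. by rewrite /step big_nil. Qed.

Lemma step_cons p s x : step (p :: s) x = p.1 * (p.2 < x)%R%:R + step s x.
Proof. by rewrite /step big_cons. Qed.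

Lemma measurable_ltr_indic b : measurable_fun setT (fun x : R => (b < x)%R%:R : R).
Proof.
rewrite (_ : (fun x => _) = (fun x : R => if b < x then 1 else 0)).
  by measurability.
by apply/funext => x; case: (b < x).
Qed.

Lemma measurable_step s : measurable_fun setT (step s).
Proof.
elim: s => [|p s IH].
  by rewrite (_ : step _ = cst 0)//; apply/funext => x; rewrite step_nil.
rewrite (_ : step _ = fun x => p.1 * (p.2 < x)%R%:R + step s x); last first.
  by apply/funext => x; rewrite step_cons.
apply: measurable_funD => //; apply: measurable_funM => //.
exact: measurable_ltr_indic.
Qed.

(** Only [u <= b < x] contributes, and there [x - u] stays away from 0, so the power is integrated
    without a singularity. *)
Lemma integral_jump al b x : 0 < al < 1 -> 0 <= b ->
  (\int[mu]_(u in `[0%R, x])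
     (((b < x)%R%:R - (b < u)%R%:R) * (x - u) `^ (- (1 + al)))%:E =
   (if (b < x)%R then ((x - b) `^ (- al) - x `^ (- al)) / al else 0%R)%:E)%E.
Proof.
move=> /andP[al0 al1] b0; case: ifPn => bx; last first.
  rewrite integral0_eq// => u; rewrite /= in_itv/= => /andP[u0 ux].
  rewrite (_ : b < u = false) ?subrr ?mul0r//.
  by apply/negbTE; apply: contra bx => /lt_le_trans; apply.
rewrite (_ : (\int[mu]_(u in _) _)%E =
    (\int[mu]_(u in `[0%R, b]) ((x - u) `^ (- (1 + al)))%:E)%E); last first.
  rewrite integral_mkcond [RHS]integral_mkcond; apply: eq_integral => u _.
  rewrite !patchE !mem_setE !in_itv/=; have [ub|bu] := leP u b.
    by rewrite (ltW (le_lt_trans ub bx)) !andbT; case: ifP => // _; rewrite subr0 mul1r.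
  by rewrite andbF; case: ifP => // _; rewrite subrr mul0r.
have m0 : measurable_fun `]0, b[ (EFin \o (fun u => (x - u) `^ (- (1 + al)))).
  apply/measurable_EFinP; apply: (@measurable_funS _ _ _ _ setT) => //.
  by measurability.
move: b0; rewrite le_eqVlt => /predU1P[<-|b0].
  by rewrite set_itv1 integral_set1 subr0 subrr mul0r.
rewrite integral_itv_bndoo//.
have pos : {in `[0, b], forall u, 0 < -1 * u + x}.
  by move=> u; rewrite in_itv/= => /andP[_ ub]; lra.
have n1 : (-1 : R) != 0 by lra.
have al1n : 1 + al != 1 by lra.
have := integral_powR_affine b0 n1 al1n pos.
rewrite (_ : (\int[mu]_(u in _) _)%E = (\int[mu]_(u in `]0%R, b[)
    ((x - u) `^ (- (1 + al)))%:E)%E); last first.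
  by apply: eq_integral => u _; congr ((_ `^ _)%:E); ring.
move=> ->; congr EFin.
have -> : 1 - (1 + al) = - al by ring.
have -> : -1 * b + x = x - b by ring.
have -> : -1 * 0 + x = x by ring.
by rewrite mulN1r opprK.
Qed.

Lemma integrable_jump al b x : 0 < al < 1 -> 0 <= b ->
  mu.-integrable `[0, x] (EFin \o (fun u =>
     ((b < x)%R%:R - (b < u)%R%:R) * (x - u) `^ (- (1 + al)))).
Proof.
move=> al01 b0; apply/integrableP; split.
  apply/measurable_EFinP; apply: (@measurable_funS _ _ _ _ setT) => //.
  apply: measurable_funM; last by measurability.
  by apply: measurable_funB => //; exact: measurable_ltr_indic.
under eq_integral => u.
  rewrite inE/= in_itv/= => /andP[u0 ux].
  rewrite ger0_norm; last first.
    rewrite mulr_ge0 ?powR_ge0// subr_ge0 ler_nat.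
    by case: (ltP b u) => // bu; rewrite (lt_le_trans bu ux).
  over.
by rewrite integral_jump// ltry.
Qed.

(** For a single jump, the term [x^(- al)] due to the origin cancels against the one in
    [integral_jump], and the pure power that the inversion formula expects remains. *)
Lemma left_derivative_step al s x : 0 < al < 1 -> 0 <= x ->
  {in s, forall p, 0 <= p.2} ->
  step s x / x `^ al +
    al * \int[mu]_(u in `[0, x]) ((step s x - step s u) / (x - u) `^ (1 + al)) =
  \sum_(p <- s) p.1 * (if p.2 < x then (x - p.2) `^ (- al) else 0).
Proof.
move=> al01 x0 s0; have /andP[al0 al1] := al01.
rewrite (_ : \int[mu]_(u in _) _ = \int[mu]_(u in `[0, x]) (\sum_(p <- s)
    p.1 * (((p.2 < x)%R%:R - (p.2 < u)%R%:R) * (x - u) `^ (- (1 + al))))); last first.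
  apply: eq_Rintegral => u _; rewrite -powRN /step -sumrB mulr_suml.
  by apply: eq_bigr => p _; rewrite -mulrBr mulrA.
rewrite Rintegral_bigsum//; last by move=> p ps; apply: integrable_jump => //; exact: s0.
rewrite /step mulr_suml mulr_sumr -big_split/=; apply: eq_big_seq => p ps.
rewrite /Rintegral integral_jump//=; last exact: s0.
case: (ltP p.2 x) => px; last by rewrite !mulr0 mul0r addr0.
by rewrite -powRN mulr1; field; rewrite gt_eqF.
Qed.

(** By linearity it suffices to treat one jump, where the inversion formula yields the increment of
    [g] times the beta integral; this constant is exactly the normalizing product of Gamma values. A
    jump at or after [t] contributes nothing, which [Num.min] encodes. *)
Lemma gLS_step al s t M g (f : R -> R) : 0 < al < 1 -> 0 <= t ->
  (forall x, `|g x| <= M) -> continuous g ->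
  {in s, forall p, 0 <= p.2} ->
  {in s, forall p, p.2 < t ->
    (mu \x mu)%E.-integrable setT (EFin \o marchaud al p.2 t g 0)} ->
  (forall x, 0 <= x <= t -> f x = step s x) ->
  gLS_integral_at al f g t = \sum_(p <- s) p.1 * (g t - g (Num.min p.2 t)).
Proof.
move=> al01 t0 gM cg s0 iM fs.
have mg : measurable_fun setT g by exact: continuous_measurable_fun.
have C0 := fine_beta_gt0 al01; have CE := Gamma_mul al01.
rewrite /gLS_integral_at CE; set C := fine _ in C0 *.
pose w (p : R * R) (x : R) := left_weight al p.2 t x * right_derivative al t g x.
have wi p : p \in s -> mu.-integrable setT (EFin \o w p) /\
    (\int[mu]_x (w p x)%:E = ((g t - g (Num.min p.2 t)) * C)%:E)%E.
  move=> ps; have [pt|tp] := ltP p.2 t.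
    apply: (integral_right_derivative al01 pt gM) => //; first exact: cg.
    exact: iM.
  have w0 x : w p x = 0.
    rewrite /w /left_weight ifF ?mul0r//; apply/negbTE.
    by rewrite negb_and -!leNgt; case: (leP x p.2) => //= px; rewrite (le_trans tp)// ltW.
  rewrite subrr mul0r; split; last by rewrite integral0_eq// => x _; rewrite w0.
  rewrite (_ : EFin \o w p = cst 0%E); first exact: integrable0.
  by apply/funext => x /=; rewrite w0.
rewrite (_ : \int[mu]_(x in _) _ = \int[mu]_(x in `[0, t])
    (\sum_(p <- s) p.1 * ((if p.2 < x then (x - p.2) `^ (- al) else 0) *
       right_derivative al t g x))); last first.
  apply: eq_Rintegral => x; rewrite inE/= in_itv/= => /andP[x0 xt].
  rewrite (_ : \int[mu]_(u in `[0, x]) _ = \int[mu]_(u in `[0, x])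
      ((step s x - step s u) / (x - u) `^ (1 + al))); last first.
    apply: eq_Rintegral => u; rewrite inE/= in_itv/= => /andP[u0 ux].
    by rewrite !fs ?x0 ?u0//= (le_trans ux).
  rewrite fs ?x0// left_derivative_step// mulr_suml.
  by apply: eq_bigr => p _; rewrite mulrA.
have wE p x : p \in s -> x \in `[0, t[ -> w p x =
    (if p.2 < x then (x - p.2) `^ (- al) else 0) * right_derivative al t g x.
  by move=> ps; rewrite in_itv/= => /andP[x0 xt]; rewrite /w /left_weight xt andbT.
have wio p : p \in s -> mu.-integrable `[0, t[ (EFin \o (fun x =>
    (if p.2 < x then (x - p.2) `^ (- al) else 0) * right_derivative al t g x)).
  move=> ps; have [ip _] := wi p ps.
  have : mu.-integrable `[0, t[ (EFin \o w p) by exact: integrableS ip.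
  by apply: eq_integrable => // x; rewrite inE/= => xt; congr EFin; exact: wE.
(* The endpoint [t] is discarded because [left_weight] vanishes there. *)
rewrite -Rintegral_itv_bndo_bndc; last first.
  exact: integrable_bigsum.
rewrite Rintegral_bigsum// mulr_sumr; apply: eq_big_seq => p ps.
have [ip ep] := wi p ps.
rewrite (_ : \int[mu]_(x in _) _ = (g t - g (Num.min p.2 t)) * C); last first.
  rewrite /Rintegral -[RHS]/(fine _%:E) -ep; congr fine.
  rewrite integral_mkcond; apply: eq_integral => x _; rewrite patchE.
  case: ifPn => [|nx]; first by rewrite inE/= => xt; rewrite wE.
  rewrite /w /left_weight ifF ?mul0r//; apply/negbTE; apply: contra nx.
  move=> /andP[px xt]; rewrite inE/= in_itv/= xt andbT.
  by rewrite (le_trans (s0 _ ps))// ltW.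
by rewrite mulrCA (mulrC _ C) mulKf// gt_eqF.
Qed.

End step_functions.

(** * Finiteness of the fractional norm of a step function *)

Section alpha_norm_step.
Context {R : realType}.
Notation mu := (@lebesgue_measure R).
Implicit Types (al t x : R) (s : seq (R * R)).

(** For [z <= x] the difference of a unit jump is nonnegative, so the triangle inequality bounds the
    inner integral by the exact integrals of single jumps, which are at most [(x - b)^(- al) / al]
    and hence integrable in [x]. *)
Lemma alpha_norm_step al s t (f : R -> R) : 0 < al < 1 -> 0 <= t ->
  {in s, forall p, 0 <= p.2} ->
  (forall x, 0 <= x <= t -> f x = step s x) -> alpha_norm_finite al t f.
Proof.
move=> al01 t0 s0 fs; have /andP[al0 al1] := al01; split.
  apply: (eq_measurable_fun (step s)).
    by move=> x; rewrite inE/= in_itv/= => xt; rewrite fs.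
  by apply: (@measurable_funS _ _ _ _ setT) => //; exact: measurable_step.
have jump_ge0 p x z : z <= x -> 0 <= (p < x)%R%:R - (p < z)%R%:R :> R.
  move=> zx; rewrite subr_ge0 ler_nat; case: (ltP p z) => // pz.
  by rewrite (lt_le_trans pz zx).
pose c (p : R * R) := `|p.1|.
pose J (p : R * R) (x z : R) : R :=
  ((p.2 < x)%R%:R - (p.2 < z)%R%:R) * (x - z) `^ (- (1 + al)).
pose jump (p : R * R) (x : R) : R := if p.2 < x
  then ((x - p.2) `^ (- al) - x `^ (- al)) / al else 0.
pose inner (x : R) := (\int[mu]_(z in `[0%R, x])
  (`|step s x - step s z| * (x - z) `^ (- (1 + al)))%:E)%E.
have inner_ge0 x : (0 <= inner x)%E.
  by apply: integral_ge0 => z _; rewrite lee_fin mulr_ge0 ?powR_ge0.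
have inner_le x : 0 <= x -> (inner x <= (\sum_(p <- s) c p * jump p x)%:E)%E.
  move=> x0.
  have Ji p : p \in s -> mu.-integrable `[0, x] (EFin \o J p x).
    by move=> ps; apply: integrable_jump => //; exact: s0.
  have JR : \int[mu]_(z in `[0, x]) (\sum_(p <- s) c p * J p x z) =
      \sum_(p <- s) c p * jump p x.
    rewrite Rintegral_bigsum//; apply: eq_big_seq => p ps.
    by rewrite /Rintegral /J integral_jump//; exact: s0.
  rewrite -JR /Rintegral fineK; last first.
    by apply: integrable_fin_num => //; exact: integrable_bigsum.
  apply: ge0_le_integral => //.
  - by move=> z _; rewrite lee_fin mulr_ge0 ?powR_ge0.
  - apply/measurable_EFinP; apply: (@measurable_funS _ _ _ _ setT) => //.
    have ms := measurable_step s; by measurability.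
  - exact: (measurable_int _ (integrable_bigsum _ _ Ji)).
  move=> z; rewrite /= in_itv/= => /andP[z0 zx]; rewrite lee_fin.
  rewrite /step -sumrB.
  apply: (@le_trans _ _ ((\sum_(p <- s) c p * ((p.2 < x)%R%:R - (p.2 < z)%R%:R)) *
     (x - z) `^ (- (1 + al)))).
    rewrite ler_wpM2r ?powR_ge0// (le_trans (ler_norm_sum _ _ _))//.
    by apply: ler_sum => p _; rewrite -mulrBr normrM (ger0_norm (jump_ge0 _ _ _ zx)).
  by rewrite mulr_suml; apply: ler_sum => p _; rewrite /J mulrA.
have minner : measurable_fun setT inner.
  rewrite (_ : inner = fun x => (\int[mu]_z (if (0 <= z)%R && (z <= x)%R then
    `|step s x - step s z| * (x - z) `^ (- (1 + al)) else 0%R)%:E)%E); last first.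
    apply/funext => x; rewrite /inner integral_mkcond; apply: eq_integral => z _.
    by rewrite patchE mem_setE in_itv/=; case: ifP.
  apply: (@measurable_fun_fubini_tonelli_F _ _ _ _ _ mu (fun z : R * R =>
    (if (0 <= z.2) && (z.2 <= z.1) then
    `|step s z.1 - step s z.2| * (z.1 - z.2) `^ (- (1 + al)) else 0)%:E)).
    apply/measurable_EFinP.
    have m1 : measurable_fun setT (fun z : R * R => step s z.1).
      exact: (measurableT_comp (measurable_step s) measurable_fst).
    have m2 : measurable_fun setT (fun z : R * R => step s z.2).
      exact: (measurableT_comp (measurable_step s) measurable_snd).
    by measurability.
  by move=> z; rewrite lee_fin; case: ifP => // _; rewrite mulr_ge0 ?powR_ge0.
(* The 1 accounts for [|f x| / x^al] and [al^-1] for the inner integral; with [t + 1] the weight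
   does not vanish at [x = t]. *)
pose bound (x : R) := \sum_(p <- s) (c p * (1 + al^-1)) * left_weight al p.2 (t + 1) x.
have ib : mu.-integrable `[0, t] (EFin \o bound).
  apply: (@integrableS _ _ _ mu setT) => //; apply: integrable_bigsum => // p _.
  exact: integrable_left_weight.
rewrite /alpha_norm.
apply: (@le_lt_trans _ _ (\int[mu]_(x in `[0%R, t]) (bound x)%:E)%E); last first.
  have /integrableP[_] := ib; apply: le_lt_trans.
  apply: ge0_le_integral => //.
  - move=> x _; rewrite lee_fin; apply: sumr_ge0 => p _.
    by rewrite !mulr_ge0 ?normr_ge0 ?left_weight_ge0// addr_ge0// invr_ge0 ltW.
  - exact: measurable_int ib.
  - by apply: measurableT_comp => //; exact: measurable_int ib.
  - by move=> x _ /=; rewrite lee_fin ler_norm.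
rewrite (_ : (\int[mu]_(x in _) _)%E = (\int[mu]_(x in `[0%R, t])
    ((`|step s x| * x `^ (- al))%:E + inner x))%E); last first.
  apply: eq_integral => x; rewrite inE/= in_itv/= => /andP[x0 xt].
  rewrite fs ?x0// -powRN; congr (_ + _)%E; apply: eq_integral => z.
  rewrite inE/= in_itv/= => /andP[z0 zx].
  by rewrite fs ?z0 ?(le_trans zx xt)// -powRN.
apply: ge0_le_integral => //.
- by move=> x _; rewrite adde_ge0// lee_fin mulr_ge0 ?powR_ge0.
- apply: (@measurable_funS _ _ _ _ setT) => //; apply: emeasurable_funD => //.
  by apply/measurable_EFinP; have ms := measurable_step s; measurability.
- exact: measurable_int ib.
move=> x; rewrite /= in_itv/= => /andP[x0 xt].
apply: (@le_trans _ _ ((\sum_(p <- s) c p * ((p.2 < x)%R%:R * x `^ (- al)))%:E +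
   (\sum_(p <- s) c p * jump p x)%:E)%E).
  apply: leeD; last exact: inner_le.
  rewrite lee_fin; apply: (@le_trans _ _ ((\sum_(p <- s) c p * (p.2 < x)%R%:R) * x `^ (- al))).
    rewrite ler_wpM2r ?powR_ge0// (le_trans (ler_norm_sum _ _ _))//.
    by apply: ler_sum => p _; rewrite normrM (ger0_norm (ler0n _ _)).
  by rewrite mulr_suml; apply: ler_sum => p _; rewrite mulrA.
rewrite -EFinD lee_fin -big_split/= /bound big_seq [leRHS]big_seq.
apply: ler_sum => p ps; rewrite -mulrDr -mulrA ler_wpM2l ?normr_ge0//.
rewrite /jump /left_weight; case: (ltP p.2 x) => px; last first.
  by rewrite mul0r add0r mulr0.
have xt1 : x < t + 1 by lra.
have p0 := s0 _ ps.
have le1 : x `^ (- al) <= (x - p.2) `^ (- al) by apply: ler_powRN; lra.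
rewrite xt1 /= (_ : true%:R = 1 :> R)// mul1r [leRHS]mulrDl mul1r lerD//.
by rewrite mulrC ler_wpM2l ?invr_ge0 ?(ltW al0)// gerBl powR_ge0.
Qed.

End alpha_norm_step.

(** * Moments and paths of fractional Brownian motion *)

Section energy.
Context {R : realType}.
Notation mu := (@lebesgue_measure R).
Implicit Types (b t p q al : R) (g : R -> R).

Definition energy p q b g (z : R * R) : R :=
  if [&& b < z.1, z.1 < z.2 & z.2 < 1] then
    (z.1 - b) `^ (- p) * `|g z.2 - g z.1| * (z.2 - z.1) `^ (q - 2) else 0.

Lemma energy_ge0 p q b g z : 0 <= energy p q b g z.
Proof. by rewrite /energy; case: ifP => // _; rewrite !mulr_ge0 ?powR_ge0. Qed.

Lemma integrable_marchaud_energy p q b t al g : 0 <= b -> t <= 1 ->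
  al <= p -> q <= al -> measurable_fun setT g ->
  (mu \x mu)%E.-integrable setT (EFin \o energy p q b g) ->
  (mu \x mu)%E.-integrable setT (EFin \o marchaud al b t g 0).
Proof.
move=> b0 t1 alp qal mg; apply: integrable_le; first exact: measurable_marchaud.
move=> [x u]; rewrite /marchaud.
case: ifPn => [/and3P[/= bx xu ut]|_]; last by rewrite normr0 energy_ge0.
rewrite /energy /= bx xu (lt_le_trans ut t1) /= addr0 !normrM !(ger0_norm (powR_ge0 _ _)).
apply: ler_pM; rewrite ?mulr_ge0 ?powR_ge0//.
  by rewrite ler_wpM2r// ger_powR ?lerN2//; apply/andP; split; lra.
by rewrite ger_powR ?lerD2r//; apply/andP; split; lra.
Qed.

(** The integral over [u] is at most [1 / (1 - r)] uniformly in [x], and the remaining weight is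
    integrable because [p < 1]. *)
Lemma integral_energy_bound p r b : p < 1 -> r < 1 -> 0 <= b ->
  (\int[mu]_x \int[mu]_u (if [&& b < x, x < u & u < 1]%R then
    ((x - b) `^ (- p) * (u - x) `^ (- r))%R else 0%R)%:E < +oo)%E.
Proof.
move=> p1 r1 b0.
pose k (z : R * R) : R := if [&& b < z.1, z.1 < z.2 & z.2 < 1] then
    (z.1 - b) `^ (- p) * (z.2 - z.1) `^ (- r) else 0.
have k0 z : 0 <= k z by rewrite /k; case: ifP => // _; rewrite mulr_ge0 ?powR_ge0.
have mk : measurable_fun setT k by rewrite /k; measurability.
change (\int[mu]_x \int[mu]_u (k (x, u))%:E < +oo)%E.
have := integrable_scale (1 - r)^-1 (integrable_left_weight b 1 p1).
move=> /integrableP[_]; apply: le_lt_trans; apply: ge0_le_integral => //.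
- by move=> x _; apply: integral_ge0 => u _; rewrite lee_fin.
- apply: (@measurable_fun_fubini_tonelli_F _ _ _ _ _ mu (EFin \o k)).
    exact/measurable_EFinP.
  by move=> z; rewrite lee_fin.
- apply/measurable_EFinP; have := measurable_left_weight p b 1 => m.
  by apply: (measurableT_comp (@normr_measurable _ _)); measurability.
move=> x _ /=; rewrite /k /left_weight /=.
have [bx|xb] /= := ltP b x; last by rewrite integral0_eq.
have [x1|x1] := ltP x 1; last first.
  rewrite integral0_eq// => u _; case: ifP => // /andP[xu u1].
  by have := lt_trans xu u1; rewrite ltNge x1.
apply: (@le_trans _ _ (\int[mu]_u (((x - b) `^ (- p))%:E *
   (if (x < u)%R && (u < 1)%R then (u - x) `^ (- r) else 0%R)%:E))%E).
  rewrite le_eqVlt; apply/orP; left; apply/eqP.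
  by apply: eq_integral => u _; rewrite -EFinM; case: ifP => //; rewrite mulr0.
rewrite ge0_integralZl//=; last 3 first.
- by apply/measurable_EFinP; measurability.
- by move=> u _; rewrite lee_fin; case: ifP => // _; rewrite powR_ge0.
- by rewrite lee_fin powR_ge0.
rewrite integral_if_itvoo integral_powR_left// -EFinM lee_fin ger0_norm; last first.
  by rewrite mulr_ge0 ?powR_ge0// invr_ge0; lra.
rewrite mulrC ler_wpM2r ?powR_ge0// ler_piMl ?invr_ge0; [by []|lra|].
have : (1 - x) `^ (1 - r) <= 1 `^ (1 - r) by rewrite ge0_ler_powR ?nnegrE//; lra.
by rewrite powR1.
Qed.

End energy.

Section fBm_moments.
Context {d : measure_display} {T : measurableType d} {R : realType}.
Variables (P : probability T R) (F : R -> set (set T)) (H : R) (B : R -> T -> R).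
Hypotheses (hF : is_complete_lc_filtration P F) (hH : 2^-1 < H < 1)
  (hB : is_fBm P F H B).
Notation mu := (@lebesgue_measure R).
Implicit Types (t u x : R).

Lemma measurable_wrt_fun t (X : T -> R) : 0 <= t <= 1 ->
  measurable_wrt (F t) X -> measurable_fun setT X.
Proof.
move=> t01 mX _ A mA; rewrite setTI; apply: (filtration_sub hF t01).
exact: mX.
Qed.

Lemma measurable_fBm t : 0 <= t <= 1 -> measurable_fun setT (B t).
Proof. by move=> t01; apply: (measurable_wrt_fun t01); exact: (fBm_adapted hB). Qed.

Lemma fBm_sqr t : 0 <= t <= 1 ->
  (\int[P]_w (B t w * B t w)%:E = (t `^ (2 * H))%:E)%E.
Proof.
have /andP[H0 H1] := hH.
move=> t01; have := fBm_cov hB t01 t01; rewrite unlock => ->.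
rewrite subrr normr0 powR0 ?subr0; last by lra.
by congr EFin; field.
Qed.

Lemma integrable_fBm_sqr t : 0 <= t <= 1 ->
  P.-integrable setT (EFin \o (fun w => B t w * B t w)).
Proof.
move=> t01; have mB := measurable_fBm t01; apply: ge0_integrable.
- exact: measurable_funM.
- by move=> w; rewrite -expr2 sqr_ge0.
- by rewrite fBm_sqr// ltry.
Qed.

Lemma integrable_fBm_mul t u : 0 <= t <= 1 -> 0 <= u <= 1 ->
  P.-integrable setT (EFin \o (fun w => B t w * B u w)).
Proof.
move=> t01 u01; have mt := measurable_fBm t01; have mu_ := measurable_fBm u01.
have i2 := integrableD measurableT (integrable_fBm_sqr t01) (integrable_fBm_sqr u01).
apply: (@integrable_le _ _ _ P _ (fun w => B t w * B t w + B u w * B u w)) i2.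
  exact: measurable_funM.
move=> w; rewrite ler_norml; apply/andP; split; nra.
Qed.

Lemma fBm_increment_sqr t u : 0 <= t <= 1 -> 0 <= u <= 1 ->
  (\int[P]_w ((B u w - B t w) ^+ 2)%:E = (`|u - t| `^ (2 * H))%:E)%E.
Proof.
move=> t01 u01.
have it := integrable_fBm_sqr t01; have iu := integrable_fBm_sqr u01.
have iut := integrable_fBm_mul u01 t01.
have iS := integrableD measurableT iu it.
transitivity (\int[P]_w ((B u w * B u w + B t w * B t w)%:E -
   (2 * (B u w * B t w))%:E))%E.
  by apply: eq_integral => w _; rewrite -EFinB; congr EFin; ring.
rewrite integralB_EFin//; last exact: integrable_scale.
rewrite (_ : (\int[P]_w (2 * (B u w * B t w))%:E)%E = ((2 : R)%:E *
   \int[P]_w (B u w * B t w)%:E)%E); last by rewrite -integralZl.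
rewrite (_ : (\int[P]_w (B u w * B u w + B t w * B t w)%:E)%E =
   (\int[P]_w (B u w * B u w)%:E + \int[P]_w (B t w * B t w)%:E)%E); last first.
  by rewrite -integralD_EFin.
have := fBm_cov hB u01 t01; rewrite unlock => ->.
rewrite !fBm_sqr// -EFinD; congr EFin.
by rewrite distrC; field.
Qed.

Lemma integrable_fBm_increment_sqr t u : 0 <= t <= 1 -> 0 <= u <= 1 ->
  P.-integrable setT (EFin \o (fun w => (B u w - B t w) ^+ 2)).
Proof.
move=> t01 u01; have mt := measurable_fBm t01; have mu_ := measurable_fBm u01.
apply: ge0_integrable.
- by apply: measurable_funX; apply: measurable_funB.
- by move=> w; rewrite sqr_ge0.
- by rewrite fBm_increment_sqr// ltry.
Qed.

(* [|y| <= (y^2 / c + c) / 2] with [c = |u - t|^H]. *)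
Lemma fBm_increment_abs t u : 0 <= t <= 1 -> 0 <= u <= 1 -> t != u ->
  (\int[P]_w `|B u w - B t w|%:E <= (`|u - t| `^ H)%:E)%E.
Proof.
move=> t01 u01 tu; have mt := measurable_fBm t01; have mu_ := measurable_fBm u01.
set c := _ `^ H; have c0 : 0 < c by rewrite powR_gt0// normr_gt0 subr_eq0 eq_sym.
have is_ := integrable_scale (2 * c)^-1 (integrable_fBm_increment_sqr t01 u01).
have ic : P.-integrable setT (EFin \o (fun _ : T => c / 2)).
  exact: finite_measure_integrable_cst.
apply: (@le_trans _ _ (\int[P]_w ((2 * c)^-1 * (B u w - B t w) ^+ 2 + c / 2)%:E)%E).
  apply: ge0_le_integral => //.
  - apply/measurable_EFinP; apply: (measurableT_comp (@normr_measurable _ _)).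
    exact: measurable_funB.
  - exact: (measurable_int _ (integrableD measurableT is_ ic)).
  move=> w _; rewrite lee_fin; set y := _ - _.
  have -> : y ^+ 2 = `|y| ^+ 2 by rewrite real_normK// num_real.
  rewrite -subr_ge0 (_ : _ - _ = (2 * c)^-1 * (`|y| - c) ^+ 2); last by field; lra.
  by rewrite mulr_ge0 ?sqr_ge0// invr_ge0; lra.
have cE : (\int[P]_w ((B u w - B t w) ^+ 2)%:E = (c ^+ 2)%:E)%E.
  rewrite fBm_increment_sqr// /c expr2 -powRD ?mulr2n ?mulrDl ?mul1r//.
  by apply/implyP => _; rewrite normr_eq0 subr_eq0 eq_sym.
rewrite (_ : (\int[P]_w _)%E = (\int[P]_w ((2 * c)^-1 * (B u w - B t w) ^+ 2)%:E +
   \int[P]_w (c / 2)%:E)%E); last by rewrite -integralD_EFin.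
rewrite (_ : (\int[P]_w ((2 * c)^-1 * _)%:E)%E = ((2 * c)^-1%:E * (c ^+ 2)%:E)%E); last first.
  by rewrite -cE -integralZl//; exact: integrable_fBm_increment_sqr.
rewrite integral_cst//= [X in (_ + _ * X)%E](probability_setT P) mule1.
rewrite -EFinM -EFinD lee_fin le_eqVlt; apply/orP; left; apply/eqP.
by field; lra.
Qed.

End fBm_moments.

(** * Joint measurability of processes with continuous paths *)

Section joint_measurability.
Context {d : measure_display} {T : measurableType d} {R : realType}.
Variable X : R -> T -> R.
Hypotheses (mX : forall t : R, 0 <= t <= 1 -> measurable_fun setT (X t))
  (cX : forall w, {within `[0, 1]%classic, continuous (fun t => X t w)}).

Let grid (n : nat) (z : T * R) : R := \sum_(k < n.+1)
  (if (k%:R <= z.2 * n.+1%:R) && (z.2 * n.+1%:R < k.+1%:R)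
   then X (k%:R / n.+1%:R) z.1 else 0).

Let measurable_grid n : measurable_fun setT (grid n).
Proof.
apply: measurable_sum => k.
have mk : measurable_fun setT (fun z : T * R => X (k%:R / n.+1%:R) z.1).
  apply: (measurableT_comp (mX _) measurable_fst).
  by rewrite divr_ge0//= ler_pdivrMr// mul1r ler_nat ltnW.
by measurability.
Qed.

Let gridE n w (x : R) : 0 <= x < 1 ->
  grid n (w, x) = X ((Num.truncn (x * n.+1%:R))%:R / n.+1%:R) w.
Proof.
move=> /andP[x0 x1]; have xn0 : 0 <= x * n.+1%:R by rewrite mulr_ge0.
have lt : (Num.truncn (x * n.+1%:R) < n.+1)%N.
  by rewrite truncn_lt_nat// gtr_pMl.
rewrite /grid (bigD1 (Ordinal lt))//= truncn_itv// big1 ?addr0// => k kn.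
case: ifPn => // /truncn_def kE; case/negP: kn; apply/eqP/val_inj => /=.
by rewrite kE.
Qed.

(** The process is the pointwise limit of its discretizations, frozen at the left endpoints of the
    cells of length [1 / (n + 1)]. Joint measurability is what permits the exchange of expectation
    and time integrals. *)
Lemma measurable_continuous_process :
  measurable_fun setT (fun z : T * R => if (0 <= z.2) && (z.2 < 1) then X z.2 z.1 else 0).
Proof.
apply: (measurable_fun_cvg measurable_grid) => -[w x] _ /=.
case: ifPn => [x01|nx]; last first.
  rewrite [X in X @ _ --> _](_ : _ = cst 0); first exact: cvg_cst.
  apply/funext => n; rewrite /grid big1// => k _ /=; case: ifPn => // /andP[h1 h2].
  case/negP: nx; apply/andP; split.
    by rewrite -(pmulr_lge0 _ (ltr0Sn R n)) (le_trans _ h1)// ler0n.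
  rewrite -(ltr_pM2r (ltr0Sn R n)) mul1r (lt_le_trans h2)// ler_nat.
  exact: ltn_ord.
have -> : grid ^~ (w, x) = (fun n => X ((Num.truncn (x * n.+1%:R))%:R / n.+1%:R) w).
  by apply/funext => n; rewrite gridE.
have /andP[x0 x1] := x01.
(* At 0 the path is continuous from the right only, but every discretization takes the exact value
   there. *)
have [x0'|x0'] := eqVneq x 0.
  rewrite x0' (_ : (fun n => _) = cst (X 0 w)); first exact: cvg_cst.
  by apply/funext => n; rewrite mul0r truncn0 mul0r.
have [cx _ _] := (continuous_within_itvP _ ltr01).1 (@cX w).
have {}cx : {for x, continuous (fun t => X t w)}.
  by apply: cx; rewrite in_itv/= x1 andbT lt_neqAle eq_sym x0'.
have H : (Num.truncn (x * n.+1%:R))%:R / n.+1%:R @[n --> \oo] --> x.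
  apply: (@squeeze_cvgr _ _ _ _ (fun n => x - n.+1%:R^-1) (fun=> x)).
  - apply: nearW => n; have xn0 : 0 <= x * n.+1%:R by rewrite mulr_ge0.
    have /andP[h1 h2] := truncn_itv xn0.
    rewrite ler_pdivrMr// h1 andbT ler_pdivlMr// mulrBl mulVf// lerBlDr.
    by rewrite (le_trans (ltW h2))// -natr1.
  - rewrite -[X in _ --> X]subr0; apply: cvgB; first exact: cvg_cst.
    exact: cvg_harmonic.
  - exact: cvg_cst.
exact: (cvg_comp _ _ H cx).
Qed.

End joint_measurability.

Section fBm_paths.
Context {d : measure_display} {T : measurableType d} {R : realType}.
Variables (P : probability T R) (F : R -> set (set T)) (H : R) (B : R -> T -> R).
Hypotheses (hF : is_complete_lc_filtration P F) (hH : 2^-1 < H < 1)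
  (hB : is_fBm P F H B).
Notation mu := (@lebesgue_measure R).
Implicit Types (t u x : R).

(** The increment is Gaussian. A nondegenerate law has no atoms, and a point mass charges 0 only if
    the increment vanishes almost surely, which contradicts its variance [|u - t|^(2H)]. *)
Lemma fBm_neq t u : 0 <= t <= 1 -> 0 <= u <= 1 -> t != u ->
  P [set w | B u w - B t w = 0] = 0%E.
Proof.
move=> t01 u01 tu.
have mX : measurable_fun setT (fun w => B u w - B t w).
  by apply: measurable_funB; apply: (measurable_fBm hF hB).
have mE : measurable [set w | B u w - B t w = 0].
  by have := mX measurableT [set 0] (measurable_set1 0); rewrite setTI.
have tm (i : 'I_2) : 0 <= (if i == ord0 then u else t) <= 1 by case: ifP.
have [_ [m [s [_ law]]]] := fBm_gaussian hB (fun i : 'I_2 => if i == ord0 then 1 else -1) tm.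
have := law [set 0] (measurable_set1 0).
rewrite /pushforward (_ : _ @^-1` [set 0] = [set w | B u w - B t w = 0]); last first.
  have E w : \sum_(i < 2) (if i == ord0 then 1 else -1) *
      B (if i == ord0 then u else t) w = B u w - B t w.
    by rewrite !big_ord_recl big_ord0 /=; ring.
  by apply/seteqP; split=> w /=; rewrite E.
rewrite /gaussian_law; case: ifPn => [s0|_ ->]; last first.
  by rewrite /normal_prob integral_set1.
rewrite diracE; case: (boolP (m \in _)) => [_ /= P1|_ //].
have z0 : P [set w | B u w - B t w != 0] = 0%E.
  rewrite (_ : [set w | _ != _] = ~` [set w | B u w - B t w = 0]).
    by rewrite probability_setC ?P1 ?subee.
  by apply/seteqP; split=> w /= /eqP.
have : (\int[P]_w ((B u w - B t w) ^+ 2)%:E = 0)%E.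
  rewrite (ae_eq_integralT (h := cst 0%E)) ?integral0//.
  - by apply/measurable_EFinP; exact: measurable_funX.
  - exists [set w | B u w - B t w != 0]; split => //.
      rewrite (_ : [set w | _ != _] = ~` [set w | B u w - B t w = 0]).
        exact: measurableC.
      by apply/seteqP; split=> w /= /eqP.
    by move=> w /= h; apply/eqP => w0; apply: h; rewrite w0 expr0n.
rewrite (fBm_increment_sqr hF hH hB)// => /eqP; rewrite eqe powR_eq0 normr_eq0.
by rewrite subr_eq0 eq_sym (negbTE tu).
Qed.

End fBm_paths.

(** * Extension of paths from the unit interval to the line *)

Section clip.
Context {R : realType}.
Implicit Types (u v : R) (f : R -> R).

(** Composition with this projection turns a path on [[0, 1]] into a bounded continuous function on
    the line, as the inversion formula assumes. *)
Definition clip u : R := if u < 0 then 0 else if u <= 1 then u else 1.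

Lemma clip01 u : 0 <= clip u <= 1.
Proof.
by rewrite /clip; case: (ltP u 0) => u0; case: (leP u 1) => u1; apply/andP; split; lra.
Qed.

Lemma clip_id u : 0 <= u <= 1 -> clip u = u.
Proof.
by move=> /andP[u0 u1]; rewrite /clip u1 ltNge u0.
Qed.

Lemma continuous_clip : continuous clip.
Proof.
move=> u; apply/cvgrPdist_le => e e0; near=> v.
have uv : `|u - v| <= e by near: v; exact: (@cvgr_dist_le _ _ _ _ _ id).
apply: le_trans uv; rewrite /clip.
have := ler_norm (u - v); have := ler_norm (- (u - v)); rewrite normrN => h1 h2.
rewrite ler_norml; case: (ltP u 0) => u0; case: (ltP v 0) => v0;
  case: (leP u 1) => u1; case: (leP v 1) => v1; apply/andP; split; lra.
Unshelve. all: by end_near. Qed.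

Lemma continuous_comp_clip f : {within `[0, 1]%classic, continuous f} ->
  continuous (f \o clip).
Proof.
move=> cf u; have cu : `[0, 1]%classic (clip u) by rewrite /= in_itv/= clip01.
move=> A nA.
have : nbhs_subspace (clip u : subspace `[0, 1]%classic) (f @^-1` A) := cf (clip u) A nA.
rewrite -(nbhs_subspace_in cu) /within /= => nA'.
have near_u : \forall v \near u, `[0, 1]%classic (clip v) -> A (f (clip v)).
  exact: continuous_clip nA'.
apply: (@filterS _ (nbhs u) _ _ _ _ near_u) => v; apply.
by rewrite /= in_itv/= clip01.
Qed.

Lemma bounded_comp_clip f : {within `[0, 1]%classic, continuous f} ->
  exists M, forall u, `|f (clip u)| <= M.
Proof.
move=> cf; have [c1 _ h1] := EVT_max ler01 cf; have [c2 _ h2] := EVT_min ler01 cf.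
exists (`|f c1| + `|f c2|) => u.
have cu : clip u \in `[0, 1] by rewrite in_itv/= clip01.
have := h1 _ cu; have := h2 _ cu; have := ler_norm (f c1); have := ler_norm (- f c2).
have := normr_ge0 (f c1); have := normr_ge0 (f c2).
by rewrite normrN ler_norml => *; apply/andP; split; lra.
Qed.

Lemma gLS_integral_at_eq al f g1 g2 t :
  (forall x, 0 <= x <= t -> g1 x = g2 x) -> 0 <= t ->
  gLS_integral_at al f g1 t = gLS_integral_at al f g2 t.
Proof.
move=> g12 t0; rewrite /gLS_integral_at; congr (_ * _).
apply: eq_Rintegral => x; rewrite inE/= in_itv/= => /andP[x0 xt].
rewrite !g12 ?x0 ?t0 ?lexx//; congr (_ * (_ + _ * _)).
apply: eq_Rintegral => u; rewrite inE/= in_itv/= => /andP[xu ut].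
by rewrite g12// (le_trans x0 xu).
Qed.

End clip.

(** * Almost sure finiteness of the weighted energies *)

Section fBm_energy.
Context {d : measure_display} {T : measurableType d} {R : realType}.
Variables (P : probability T R) (F : R -> set (set T)) (H : R) (B : R -> T -> R).
Hypotheses (hF : is_complete_lc_filtration P F) (hH : 2^-1 < H < 1)
  (hB : is_fBm P F H B).
Notation mu := (@lebesgue_measure R).
Implicit Types (t u x b p q : R).

Let Bt (w : T) u : R := if (0 <= u) && (u < 1) then B u w else 0.

Let mBt : measurable_fun setT (fun z : T * R => Bt z.1 z.2).
Proof.
apply: measurable_continuous_process; first exact: measurable_fBm hF hB.
exact: fBm_continuous hB.
Qed.

Let E b p q (y : T * R * R) : R := energy p q b (Bt y.1.1) (y.1.2, y.2).

Let measurable_E b p q : measurable_fun setT (E b p q).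
Proof.
have m1 : measurable_fun setT (fun y : T * R * R => Bt y.1.1 y.1.2).
  exact: (measurableT_comp mBt measurable_fst).
have mx : measurable_fun setT (fun y : T * R * R => y.1.2).
  exact: (measurableT_comp measurable_snd measurable_fst).
have m2 : measurable_fun setT (fun y : T * R * R => Bt y.1.1 y.2).
  apply: (measurableT_comp mBt (g := fun y : T * R * R => (y.1.1, y.2))).
  apply: measurable_fun_pair; last exact: measurable_snd.
  exact: (measurableT_comp measurable_fst measurable_fst).
by rewrite /E /energy; measurability.
Qed.

(** By Tonelli's theorem the expected energy is finite: since [E|B_u - B_x| <= (u - x)^H], the
    kernel becomes [(u - x)^(q - 2 + H)], whose exponent exceeds -1 exactly when [q > 1 - H]. *)
Lemma ae_integrable_energy b p q : 0 <= b -> p < 1 -> 1 - H < q ->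
  {ae P, forall w, (mu \x mu)%E.-integrable setT
    (EFin \o energy p q b (fun u => B (clip u) w))}.
Proof.
move=> b0 p1 qH; have E0 y : 0 <= E b p q y by exact: energy_ge0.
have mE := measurable_E b p q.
have mEe : measurable_fun setT (EFin \o E b p q) by exact/measurable_EFinP.
have Ee0 y : (0 <= (EFin \o E b p q) y)%E by rewrite lee_fin.
pose W (y : T * R) := (\int[mu]_u (E b p q (y, u))%:E)%E.
have mW : measurable_fun setT W.
  exact: (@measurable_fun_fubini_tonelli_F _ _ _ _ _ mu _ mEe Ee0).
have W0 y : (0 <= W y)%E by apply: integral_ge0 => u _; exact: Ee0.
pose V (w : T) := (\int[mu]_x W (w, x))%E.
have mV : measurable_fun setT V.
  exact: (@measurable_fun_fubini_tonelli_F _ _ _ _ _ mu _ mW W0).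
have V0 w : (0 <= V w)%E by apply: integral_ge0.
have iV : P.-integrable setT V.
  apply/integrableP; split => //; under eq_integral do rewrite gee0_abs//.
  rewrite /V (@fubini_tonelli _ _ _ _ _ P mu _ mW W0).
  have r1 : 2 - q - H < 1 by lra.
  apply: le_lt_trans (integral_energy_bound p1 r1 b0).
  pose k (z : R * R) : R := if [&& b < z.1, z.1 < z.2 & z.2 < 1] then
    (z.1 - b) `^ (- p) * (z.2 - z.1) `^ (- (2 - q - H)) else 0.
  have k0 z : (0 <= (EFin \o k) z)%E.
    by rewrite lee_fin /k; case: ifP => // _; rewrite mulr_ge0 ?powR_ge0.
  have mk : measurable_fun setT (EFin \o k).
    by apply/measurable_EFinP; rewrite /k; measurability.
  apply: ge0_le_integral => //.
  - by move=> x _; exact: integral_ge0.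
  - exact: (@measurable_fun_fubini_tonelli_G _ _ _ _ _ P _ mW W0).
  - exact: (@measurable_fun_fubini_tonelli_F _ _ _ _ _ mu _ mk k0).
  move=> x _.
  have mEx : measurable_fun setT (fun y : T * R => (E b p q (y.1, x, y.2))%:E).
    apply: (measurableT_comp mEe (g := fun y : T * R => (y.1, x, y.2))).
    apply: measurable_fun_pair; last exact: measurable_snd.
    by apply: measurable_fun_pair; [exact: measurable_fst|exact: measurable_cst].
  rewrite /W (@fubini_tonelli _ _ _ _ _ P mu _ mEx) => [|y]; last exact: Ee0.
  apply: ge0_le_integral => //.
  - by move=> u _; apply: integral_ge0 => w _; exact: Ee0.
  - apply: (@measurable_fun_fubini_tonelli_G _ _ _ _ _ P _ mEx).
    by move=> y; exact: Ee0.
  - exact: (measurableT_comp mk (pair1_measurable x)).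
  move=> u _; rewrite /E /energy /=.
  have [|_] := ifPn; last by rewrite integral0.
  move=> /and3P[bx xu u1].
  have x01 : 0 <= x <= 1 by apply/andP; split; lra.
  have u01 : 0 <= u <= 1 by apply/andP; split; lra.
  have x0 : 0 <= x by lra.
  have u0 : 0 <= u by lra.
  have xu1 : x < 1 by lra.
  have mx := measurable_fBm hF hB x01; have mu_ := measurable_fBm hF hB u01.
  apply: (@le_trans _ _ (\int[P]_w (((x - b) `^ (- p) * (u - x) `^ (q - 2))%:E *
     `|B u w - B x w|%:E))%E).
    rewrite le_eqVlt; apply/orP; left; apply/eqP; apply: eq_integral => w _.
    by rewrite /Bt u0 u1 x0 xu1 -EFinM /=; congr EFin; rewrite mulrAC.
  rewrite ge0_integralZl//; last 2 first.
  - apply/measurable_EFinP; apply: (measurableT_comp (@normr_measurable _ _)).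
    exact: measurable_funB.
  - by rewrite lee_fin mulr_ge0 ?powR_ge0.
  have xnu : x != u by rewrite lt_eqF.
  have := fBm_increment_abs hF hH hB x01 u01 xnu.
  rewrite (ger0_norm (_ : 0 <= u - x)); last by lra.
  move=> le1; have c0 : (0 <= ((x - b) `^ (- p) * (u - x) `^ (q - 2))%:E)%E.
    by rewrite lee_fin mulr_ge0 ?powR_ge0.
  apply: (le_trans (lee_wpmul2l c0 le1)).
  rewrite -EFinM lee_fin -mulrA ler_wpM2l ?powR_ge0// -powRD; last first.
    by apply/implyP => _; lra.
  by rewrite le_eqVlt; apply/orP; left; apply/eqP; congr (_ `^ _); ring.
apply: filterS (integrable_ae measurableT iV) => w /(_ I) Vw.
rewrite (_ : energy p q b _ = energy p q b (Bt w)); last first.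
  apply/funext => z; rewrite /energy; case: ifP => // /and3P[bz z12 z21].
  by rewrite !clip_id /Bt; try (apply/andP; split); try lra; rewrite !ifT//;
    apply/andP; split; lra.
apply/integrable12ltyP.
  apply/measurable_EFinP; apply: (measurableT_comp mE (g := fun z : R * R => (w, z.1, z.2))).
  apply: measurable_fun_pair => //.
  exact: (measurableT_comp (pair1_measurable w) measurable_fst).
under eq_integral do under eq_integral do rewrite gee0_abs ?lee_fin ?energy_ge0//.
by move: Vw; rewrite ge0_fin_numE.
Qed.

End fBm_energy.

(** * Approximation by random variables known before time 1 *)

Section small_sets.
Context {d : measure_display} {T : measurableType d} {R : realType}.
Variable P : probability T R.

Lemma measurable_gt_set (Y : T -> R) (c : R) : measurable_fun setT Y ->
  measurable [set w | c < Y w].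
Proof.
move=> mY; have := mY measurableT `]c, +oo[%classic (measurable_itv _).
rewrite setTI (_ : _ @^-1` _ = [set w | c < Y w])//.
by apply/seteqP; split=> w /=; rewrite in_itv/= andbT.
Qed.

Lemma small_tail (E : nat -> set T) (e : R) : (forall n, measurable (E n)) ->
  (forall m n, (m <= n)%N -> E n `<=` E m) -> P (\bigcap_n E n) = 0%E ->
  0 < e -> exists n, (P (E n) <= e%:E)%E.
Proof.
move=> mE dE E0 e0.
have : (P \o E) n @[n --> \oo] --> P (\bigcap_n E n).
  apply: nonincreasing_cvg_mu => //.
  - by rewrite (le_lt_trans (probability_le1 _ _)) ?ltry.
  - exact: bigcapT_measurable.
  - by move=> m n mn; apply/subsetPset; exact: dE.
rewrite E0 => /fine_cvgP[_ /cvgrPdist_le /(_ _ e0)[n _ /(_ n (leqnn n))]].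
rewrite /= sub0r normrN ger0_norm ?fine_ge0// => h; exists n.
by rewrite -(@fineK _ (P (E n))) ?fin_num_measure// lee_fin.
Qed.

(** Continuity from above, applied to the events that some later deviation exceeds [c]; these
    decrease, and their intersection lies in [N0]. *)
Lemma small_deviation (Y : nat -> T -> R) (N0 : set T) (c e : R) :
  (forall n, measurable_fun setT (Y n)) -> measurable N0 -> P N0 = 0%E ->
  (forall w, ~ N0 w -> Y n w @[n --> \oo] --> 0) -> 0 < c -> 0 < e ->
  exists n N, [/\ measurable N, (P N <= e%:E)%E & forall w, ~ N w ->
    forall m, (n <= m)%N -> `|Y m w| <= c].
Proof.
move=> mY mN0 PN0 cY c0 e0.
pose A m := [set w | c < `|Y m w|].
have mA m : measurable (A m).
  apply: measurable_gt_set; apply: (measurableT_comp (@normr_measurable _ _)).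
  exact: mY.
pose E n := \bigcup_(m in [set m | (n <= m)%N]) A m.
have mE n : measurable (E n) by apply: bigcup_measurable => k _; exact: mA.
have [n Pn] : exists n, (P (E n) <= e%:E)%E.
  apply: small_tail => //.
    by move=> m n mn w [k /= nk Ak]; exists k => //=; exact: leq_trans nk.
  apply: (@subset_measure0 _ _ _ _ (\bigcap_n E n) N0) => //.
    exact: bigcapT_measurable.
  move=> w Ew; apply: contrapT => nw.
  have /cvgr0Pnorm_le /(_ _ c0)[n _ h] := cY w nw.
  have [m /= nm] := Ew n I; rewrite /A /= ltNge => /negP; apply.
  exact: h.
exists n, (E n); split=> // w nEw m nm; rewrite leNgt; apply/negP => h.
by apply: nEw; exists m.
Qed.

End small_sets.

(** * Calculus of random variables measurable for a sub-sigma-algebra *)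

Section measurable_wrt_theory.
Context {d : measure_display} {T : measurableType d} {R : realType}.
Variable G : set (set T).
Hypothesis sG : sigma_algebra setT G.
Implicit Types X Y : T -> R.

Lemma measurable_wrtP X : measurable_wrt G X <->
  @measurable_fun _ _ (g_sigma_algebraType G) R setT X.
Proof.
have E A : <<s G >> A = G A by rewrite (sigma_algebra_id sG).
split=> [mX _ A mA|mX A mA].
  by rewrite setTI; rewrite /measurable/= E; exact: mX.
have := mX measurableT A mA.
by rewrite setTI /measurable/= E.
Qed.

Lemma measurable_wrt_comp (f : R -> R) X : measurable_fun setT f ->
  measurable_wrt G X -> measurable_wrt G (fun w => f (X w)).
Proof.
by move=> mf /measurable_wrtP mX; apply/measurable_wrtP; exact: (measurableT_comp mf).
Qed.

Lemma measurable_wrt_cst (c : R) : measurable_wrt G (fun=> c).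
Proof. by apply/measurable_wrtP; exact: measurable_cst. Qed.

Lemma measurable_wrtD X Y : measurable_wrt G X -> measurable_wrt G Y ->
  measurable_wrt G (fun w => X w + Y w).
Proof.
move=> /measurable_wrtP mX /measurable_wrtP mY; apply/measurable_wrtP.
exact: measurable_funD.
Qed.

Lemma measurable_wrtB X Y : measurable_wrt G X -> measurable_wrt G Y ->
  measurable_wrt G (fun w => X w - Y w).
Proof.
move=> /measurable_wrtP mX /measurable_wrtP mY; apply/measurable_wrtP.
exact: measurable_funB.
Qed.

Lemma measurable_wrtM X Y : measurable_wrt G X -> measurable_wrt G Y ->
  measurable_wrt G (fun w => X w * Y w).
Proof.
move=> /measurable_wrtP mX /measurable_wrtP mY; apply/measurable_wrtP.
exact: measurable_funM.
Qed.

Lemma measurable_wrt_max X Y : measurable_wrt G X -> measurable_wrt G Y ->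
  measurable_wrt G (fun w => Num.max (X w) (Y w)).
Proof.
move=> /measurable_wrtP mX /measurable_wrtP mY; apply/measurable_wrtP.
exact: measurable_maxr.
Qed.

Lemma measurable_wrt_sum (I : Type) (r : seq I) (X : I -> T -> R) :
  (forall i, measurable_wrt G (X i)) ->
  measurable_wrt G (fun w => \sum_(i <- r) X i w).
Proof.
move=> mX; apply/measurable_wrtP; apply: measurable_sum => i.
exact/measurable_wrtP.
Qed.

Lemma measurable_wrt_indic (A : set T) : G A -> measurable_wrt G (\1_A : T -> R).
Proof.
move=> GA; apply/measurable_wrtP; apply: measurable_indic.
by rewrite /measurable/= (sigma_algebra_id sG).
Qed.

End measurable_wrt_theory.

(** * Density of the random variables known before time 1 *)

Section approximation.
Context {d : measure_display} {T : measurableType d} {R : realType}.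
Variables (P : probability T R) (F : R -> set (set T)).
Hypothesis hF : is_complete_lc_filtration P F.
Implicit Types X Y : T -> R.

(** Closeness in probability, with the exceptional set explicit. The time [s] is strictly below 1 so
    that a grid time can be placed at or after it. *)
Definition approximable X := forall e : R, 0 < e -> exists s Y N,
  [/\ 0 <= s < 1, measurable_wrt (F s) Y, measurable N, (P N <= e%:E)%E &
      forall w, ~ N w -> `|X w - Y w| <= e].

Let sF s : 0 <= s < 1 -> sigma_algebra setT (F s).
Proof.
move=> /andP[s0 s1]; apply: (filtration_sigma hF); apply/andP; split => //.
exact: ltW.
Qed.

Let wrt_mono s s' X : 0 <= s -> s <= s' -> s' < 1 -> measurable_wrt (F s) X ->
  measurable_wrt (F s') X.
Proof.
move=> s0 ss' s1 mX A mA; apply: (filtration_mono hF s0 ss' (ltW s1)).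
exact: mX.
Qed.

Lemma approximable_self s X : 0 <= s < 1 -> measurable_wrt (F s) X -> approximable X.
Proof.
move=> s01 mX e e0; exists s, X, set0; split=> //.
  by rewrite measure0 lee_fin ltW.
by move=> w _; rewrite subrr normr0 ltW.
Qed.

(** Both approximations are measurable at the later of their two times, which is still below 1, and
    the Lipschitz bound adds their errors. *)
Lemma approximable_op2 (f : R -> R -> R) X Y :
  (forall G X Y, sigma_algebra setT G -> measurable_wrt G X ->
     measurable_wrt G Y -> measurable_wrt G (fun w => f (X w) (Y w))) ->
  (forall a b a' b' : R, `|f a b - f a' b'| <= `|a - a'| + `|b - b'|) ->
  approximable X -> approximable Y -> approximable (fun w => f (X w) (Y w)).
Proof.
move=> mf Lf aX aY e e0; have e20 : 0 < e / 2 by lra.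
have [s [X' [N [/andP[s0 s1] mX mN PN hN]]]] := aX _ e20.
have [s' [Y' [N' [/andP[s0' s1'] mY mN' PN' hN']]]] := aY _ e20.
pose r := Num.max s s'.
have r01 : 0 <= r < 1 by rewrite /r le_max s0/= gt_max s1.
have /andP[r0 r1] := r01.
exists r, (fun w => f (X' w) (Y' w)), (N `|` N'); split=> //.
- apply: mf; first exact: sF.
    by apply: (@wrt_mono s) => //; rewrite /r le_max lexx.
  by apply: (@wrt_mono s') => //; rewrite /r le_max lexx orbT.
- exact: measurableU.
- apply: (le_trans (measureU2 _ _ _)) => //.
  by rewrite (_ : e%:E = (e / 2)%:E + (e / 2)%:E)%E ?leeD// -EFinD; congr EFin; lra.
- move=> w /not_orP[nN nN']; apply: (le_trans (Lf _ _ _ _)).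
  by have := hN w nN; have := hN' w nN'; lra.
Qed.

Lemma approximableD X Y : approximable X -> approximable Y ->
  approximable (fun w => X w + Y w).
Proof.
apply: (approximable_op2 (f := fun a b => a + b)).
  by move=> G X' Y' sG; exact: measurable_wrtD.
by move=> a b a' b'; rewrite opprD addrACA ler_normD.
Qed.

Lemma approximableB X Y : approximable X -> approximable Y ->
  approximable (fun w => X w - Y w).
Proof.
apply: (approximable_op2 (f := fun a b => a - b)).
  by move=> G X' Y' sG; exact: measurable_wrtB.
move=> a b a' b'; rewrite (_ : _ - _ = (a - a') - (b - b')); last by ring.
exact: ler_normB.
Qed.

Lemma approximable_max X Y : approximable X -> approximable Y ->
  approximable (fun w => Num.max (X w) (Y w)).
Proof.
apply: (approximable_op2 (f := fun a b => Num.max a b)).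
  by move=> G X' Y' sG; exact: measurable_wrt_max.
move=> a b a' b'.
have := ler_norm (a - a'); have := ler_norm (- (a - a')).
have := ler_norm (b - b'); have := ler_norm (- (b - b')); rewrite !normrN => h1 h2 h3 h4.
have h5 := normr_ge0 (a - a'); have h6 := normr_ge0 (b - b').
rewrite ler_norml; case: (leP a b) => ab; case: (leP a' b') => ab';
  apply/andP; split; lra.
Qed.

Lemma approximable_cst (c : R) : approximable (fun=> c).
Proof.
apply: (@approximable_self 0); first by rewrite lexx ltr01.
by apply: measurable_wrt_cst; apply: sF; rewrite lexx ltr01.
Qed.

Lemma approximableZ (c : R) X : 0 <= c <= 1 -> approximable X -> approximable (fun w => c * X w).
Proof.
move=> /andP[c0 c1] aX.
apply: (approximable_op2 (f := fun a b => c * a) (Y := X)) => //.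
  move=> G X' Y' sG mX _; apply: measurable_wrtM => //; exact: measurable_wrt_cst.
move=> a b a' b'; rewrite -mulrBr normrM (ger0_norm c0) -[leLHS]addr0 lerD//.
by rewrite ler_piMl.
Qed.

Lemma approximable_lim (X_ : nat -> T -> R) X : (forall n, measurable_fun setT (X_ n)) ->
  measurable_fun setT X -> (forall n, approximable (X_ n)) ->
  (forall w, X_ n w @[n --> \oo] --> X w) -> approximable X.
Proof.
move=> mX_ mX aX cX e e0; have e20 : 0 < e / 2 by lra.
have [n [N [mN PN hN]]] : exists n N, [/\ measurable N, (P N <= (e / 2)%:E)%E &
    forall w, ~ N w -> forall m, (n <= m)%N -> `|X_ m w - X w| <= e / 2].
  apply: (@small_deviation _ _ _ P (fun n w => X_ n w - X w) set0) => //.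
  - by move=> n; exact: measurable_funB.
  - move=> w _; rewrite -(subrr (X w)); apply: cvgB => //; exact: cvg_cst.
have [s [Y [N' [s01 mY mN' PN' hN']]]] := aX n _ e20.
exists s, Y, (N `|` N'); split=> //.
- exact: measurableU.
- apply: (le_trans (measureU2 _ _ _)) => //.
  by rewrite (_ : e%:E = (e / 2)%:E + (e / 2)%:E)%E ?leeD// -EFinD; congr EFin; lra.
- move=> w /not_orP[nN nN'].
  have h1 := hN w nN n (leqnn n); have h2 := hN' w nN'.
  rewrite (_ : X w - Y w = (X_ n w - Y w) - (X_ n w - X w)); last by ring.
  by apply: (le_trans (ler_normB _ _)); lra.
Qed.

Let C : set (set T) := [set A | measurable A /\ approximable (\1_A : T -> R)].

(** Complements, finite unions and countable unions of events correspond to [1 - f], [Num.max] and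
    pointwise limits of indicators, and [approximable] is stable under these. *)
Lemma sigma_algebra_approximable : sigma_algebra setT C.
Proof.
have CU A B : C A -> C B -> C (A `|` B).
  move=> [mA aA] [mB aB]; split; first exact: measurableU.
  rewrite (_ : \1_(A `|` B) = (fun w => Num.max (\1_A w) (\1_B w)) :> (T -> R)).
    exact: approximable_max.
  apply/funext => w; rewrite !indicE in_setU.
  by case: (w \in A); case: (w \in B); rewrite /= ?maxxx// /Num.max ?ltr01// ltr10.
have C0 : C set0.
  split; first exact: measurable0.
  rewrite (_ : \1_set0 = (fun=> 0) :> (T -> R)); first exact: approximable_cst.
  by apply/funext => w; rewrite indicE in_set0.
split=> //.
- move=> A [mA aA]; split; first exact: measurableD.
  rewrite (_ : \1_(setT `\` A) = (fun w => 1 - \1_A w) :> (T -> R)).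
    by apply: approximableB => //; exact: approximable_cst.
  apply/funext => w; rewrite !indicE setTD in_setC.
  by case: (w \in A); rewrite ?subrr ?subr0.
move=> A CA; have mU : measurable (\bigcup_k A k).
  by apply: bigcupT_measurable => n; have [] := CA n.
split=> //.
pose U n := \big[setU/set0]_(k < n) A k.
have CUn n : C (U n).
  rewrite /U; elim: n => [|n IH]; first by rewrite big_ord0.
  by rewrite big_ord_recr; exact: CU.
apply: (@approximable_lim (fun n => \1_(U n))).
- by move=> n; apply: measurable_indic; have [] := CUn n.
- exact: measurable_indic.
- by move=> n; have [] := CUn n.
move=> w; rewrite indicE; have [|nw] := pselect ((\bigcup_k A k) w).
  move=> [k _ Ak]; rewrite mem_set; last by exists k.
  apply: cvg_near_cst; exists k.+1 => // n /= kn.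
  by rewrite indicE mem_set// /U -bigcup_mkord; exists k.
rewrite memNset//; apply: cvg_near_cst; apply: nearW => n.
rewrite indicE memNset// /U => h; apply: nw; move: h.
rewrite -bigcup_mkord => -[k _ Ak]; by exists k.
Qed.

(** Left continuity at 1 enters here: [C] is a sigma-algebra containing every [F s] with [s < 1],
    hence also the one they generate. *)
Lemma filtration_approximable (A : set T) : F 1 A -> C A.
Proof.
rewrite (filtration_left_continuous hF); last by rewrite ltr01 lexx.
apply: smallest_sub; first exact: sigma_algebra_approximable.
move=> {}A [s /= s01 FA]; have /andP[s0 s1] := s01.
split; first by apply: (filtration_sub hF) FA; rewrite s0 ltW.
by apply: (approximable_self s01); apply: measurable_wrt_indic => //; exact: sF.
Qed.

(** The sum rounds [x] down to a multiple of [dl], capped at [n%:R * dl]. The saturated case is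
    stated along with the other because the induction passes from one to the other. *)
Lemma staircase (dl x : R) (n : nat) : 0 < dl -> 0 <= x ->
  (n%:R * dl <= x -> \sum_(k < n) dl * (k.+1%:R * dl <= x)%R%:R = n%:R * dl) /\
  (x <= n%:R * dl -> x - dl <= \sum_(k < n) dl * (k.+1%:R * dl <= x)%R%:R <= x).
Proof.
move=> dl0 x0; elim: n => [|n [IH1 IH2]].
  rewrite big_ord0 mul0r; split=> // x0'; apply/andP; split; lra.
rewrite big_ord_recr/= -natr1 mulrDl mul1r; have [h|h] := leP (n%:R * dl + dl) x.
  by rewrite mulr1 IH1; [split=> // ?; apply/andP; split; lra|lra].
rewrite mulr0 addr0; split; first by move=> ?; lra.
move=> _; have [h2|h2] := leP x (n%:R * dl); first exact: IH2.
by rewrite IH1; [apply/andP; split; lra|lra].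
Qed.

Lemma approximable_ge0 X : measurable_wrt (F 1) X -> (forall w, 0 <= X w) ->
  approximable X.
Proof.
move=> mX X0.
have F1C (A : set R) : measurable A -> C (X @^-1` A).
  by move=> mA; apply: filtration_approximable; exact: mX.
have mfX : measurable_fun setT X.
  by apply: (measurable_wrt_fun hF (t := 1)) => //; rewrite ler01 lexx.
pose dl (n : nat) : R := n.+1%:R^-1.
have dl0 n : 0 < dl n by rewrite invr_gt0.
pose A n k := X @^-1` `[(k.+1%:R * dl n), +oo[%classic.
have AE n k w : \1_(A n k) w = (k.+1%:R * dl n <= X w)%R%:R :> R.
  rewrite indicE; congr ((nat_of_bool _)%:R); apply/idP/idP => [/set_mem|h].
    by rewrite /A/= in_itv/= andbT.
  by apply/mem_set; rewrite /A/= in_itv/= andbT.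
(* With [(n + 1)^2] levels of height [1 / (n + 1)] the staircase reaches up to [n + 1], so the steps
   shrink while the range grows. *)
pose S n w : R := \sum_(k < n.+1 * n.+1) dl n * \1_(A n k) w.
apply: (@approximable_lim S) => //.
- move=> n; apply: measurable_sum => k; apply: measurable_funM => //.
  by apply: measurable_indic; have [] := F1C _ (measurable_itv `[(k.+1%:R * dl n), +oo[).
- move=> n; rewrite /S; elim: (n.+1 * n.+1)%N => [|m IH].
    rewrite (_ : (fun w => _) = fun=> 0); first exact: approximable_cst.
    by apply/funext => w; rewrite big_ord0.
  rewrite (_ : (fun w => _) = (fun w => \sum_(k < m) dl n * \1_(A n k) w + dl n * \1_(A n m) w)).
    apply: approximableD => //; apply: approximableZ.
      by rewrite ltW//= invf_le1// ler1n.
    by have [] := F1C _ (measurable_itv `[(m.+1%:R * dl n), +oo[).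
  by apply/funext => w; rewrite big_ord_recr.
move=> w; apply/cvgrPdist_le => e e0; near=> n.
have h1 : dl n <= e.
  have : `|dl n| <= e by near: n; move/cvgr0Pnorm_le : (@cvg_harmonic R); exact.
  by rewrite gtr0_norm.
have h2 : X w <= (n.+1 * n.+1)%:R * dl n.
  rewrite natrM /dl -mulrA mulfV// mulr1.
  have : X w <= n%:R by near: n; exact: nbhs_infty_ger.
  by move=> h; rewrite (le_trans h)// ler_nat.
have [_ /(_ h2)] := staircase (n.+1 * n.+1) (dl0 n) (X0 w).
rewrite /S; under [X in `|_ - X|]eq_bigr do rewrite AE.
by move=> /andP[h3 h4]; rewrite ler_norml; apply/andP; split; lra.
Unshelve. all: by end_near. Qed.

Lemma approximable_F1 X : measurable_wrt (F 1) X -> approximable X.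
Proof.
move=> mX; have s1 : sigma_algebra setT (F 1).
  by apply: (filtration_sigma hF); rewrite ler01 lexx.
rewrite (_ : X = fun w => Num.max (X w) 0 - Num.max (0 - X w) 0).
  have c0 : measurable_wrt (F 1) (fun _ : T => 0 : R) by exact: measurable_wrt_cst.
  apply: approximableB; apply: approximable_ge0.
  - exact: measurable_wrt_max.
  - by move=> w; rewrite le_max lexx orbT.
  - by apply: measurable_wrt_max => //; exact: measurable_wrtB.
  - by move=> w; rewrite le_max lexx orbT.
apply/funext => w; case: (leP (X w) 0) => h1; case: (leP (0 - X w) 0) => h2; lra.
Qed.

End approximation.

(** * Reaching a target within one block *)

Section quadratic_profile.
Context {R : realType}.
Implicit Types (x y K a t h : R) (g : R -> R).

Definition profile x : R := x ^+ 2 / (1 + x ^+ 2).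
Definition profile' x : R := 2 * x / (1 + x ^+ 2) ^+ 2.

Lemma profile_ge0 x : 0 <= profile x.
Proof. by rewrite divr_ge0 ?addr_ge0 ?sqr_ge0. Qed.

Lemma onem_profile x : 1 - profile x = (1 + x ^+ 2)^-1.
Proof. by rewrite /profile; field; have := sqr_ge0 x; lra. Qed.

Lemma profile_le1 x : profile x <= 1.
Proof.
by rewrite -subr_ge0 onem_profile invr_ge0; have := sqr_ge0 x; lra.
Qed.

Lemma profile0 : profile 0 = 0. Proof. by rewrite /profile expr0n mul0r. Qed.

(** The remainder is [(y - x)^2] times an explicit fraction. Its numerator satisfies
    [|1 - x^2 - 2 x y| <= 2 (1 + x^2 + y^2)], and its denominator [D] is at least
    [1 + x^2 + y^2]. *)
Lemma profile_taylor x y :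
  `|profile y - profile x - profile' x * (y - x)| <= 2 * (y - x) ^+ 2.
Proof.
have x0 := sqr_ge0 x; have y0 := sqr_ge0 y.
pose D := (1 + x ^+ 2) ^+ 2 * (1 + y ^+ 2).
have D0 : 0 < D by rewrite /D mulr_gt0 ?exprn_gt0//; lra.
have -> : profile y - profile x - profile' x * (y - x) =
    (y - x) ^+ 2 * ((1 - x ^+ 2 - 2 * (x * y)) / D).
  by rewrite /profile /profile' /D; field; apply/andP; split; lra.
rewrite normrM ger0_norm ?sqr_ge0// mulrC ler_wpM2r ?sqr_ge0//.
rewrite normrM normfV (gtr0_norm D0) ler_pdivrMr//.
have DE : (1 + x ^+ 2 + y ^+ 2) <= D.
  rewrite /D; have : 0 <= x ^+ 2 * y ^+ 2 by rewrite mulr_ge0.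
  have : 0 <= (x ^+ 2) ^+ 2 by rewrite sqr_ge0.
  have : 0 <= (x ^+ 2) ^+ 2 * y ^+ 2 by rewrite mulr_ge0 ?sqr_ge0.
  by move=> *; nra.
have xy1 : 0 <= (x - y) ^+ 2 by rewrite sqr_ge0.
have xy2 : 0 <= (x + y) ^+ 2 by rewrite sqr_ge0.
rewrite ler_norml; apply/andP; split; nra.
Qed.

Definition block_coef K a h g (y : R) (j : nat) : R :=
  y * K * profile' (K * (g (a + j%:R * h) - g a)).

Definition block_integral K a h (m : nat) g (y t : R) : R :=
  \sum_(j < m) block_coef K a h g y j *
    (g (Num.min (a + j.+1%:R * h) t) - g (Num.min (a + j%:R * h) t)).

(** Stopping at [t] leaves the earlier cells unchanged and kills the later ones; only the cell
    containing [t] acquires a new increment, of size at most [om]. The induction also records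
    equality as long as the grid has not passed [t], so that [om ^+ 2] is paid only once. *)
Lemma stopped_quadratic_variation a h (m : nat) g t om : 0 < h -> a <= t ->
  (forall u v, a <= u <= a + m%:R * h -> a <= v <= a + m%:R * h -> `|u - v| <= h ->
     `|g u - g v| <= om) ->
  \sum_(j < m) (g (Num.min (a + j.+1%:R * h) t) - g (Num.min (a + j%:R * h) t)) ^+ 2
    <= \sum_(j < m) (g (a + j.+1%:R * h) - g (a + j%:R * h)) ^+ 2 + om ^+ 2.
Proof.
move=> h0 at_.
pose S n := \sum_(j < n) (g (Num.min (a + j.+1%:R * h) t) - g (Num.min (a + j%:R * h) t)) ^+ 2.
pose V n := \sum_(j < n) (g (a + j.+1%:R * h) - g (a + j%:R * h)) ^+ 2.
have grid_inc (i j : nat) : (i <= j)%N -> a + i%:R * h <= a + j%:R * h.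
  by move=> ij; rewrite lerD2l ler_pM2r// ler_nat.
move=> hom.
suff : forall n, (n <= m)%N -> (a + n%:R * h <= t -> S n = V n) /\ S n <= V n + om ^+ 2.
  by move=> /(_ m (leqnn m))[].
elim=> [_|n IH nm].
  by rewrite /S /V !big_ord0 add0r sqr_ge0.
have [IH1 IH2] := IH (ltnW nm).
have nn1 := grid_inc n n.+1 (leqnSn n).
have SE : S n.+1 = S n + (g (Num.min (a + n.+1%:R * h) t) - g (Num.min (a + n%:R * h) t)) ^+ 2.
  by rewrite /S big_ord_recr.
have VE : V n.+1 = V n + (g (a + n.+1%:R * h) - g (a + n%:R * h)) ^+ 2.
  by rewrite /V big_ord_recr.
have [t1|t1] := leP (a + n.+1%:R * h) t.
  rewrite SE VE (min_idPl t1) (min_idPl (le_trans nn1 t1)) IH1 ?(le_trans nn1 t1)//.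
  by split=> //; rewrite lerDl sqr_ge0.
split; first by move=> h1; lra.
rewrite SE VE (min_idPr (ltW t1)); have [t2|t2] := leP (a + n%:R * h) t.
  rewrite IH1// -addrA lerD2l ler_wpDl ?sqr_ge0//.
  rewrite -(real_normK (num_real (_ - _))) ler_pXn2r ?nnegrE
    ?(le_trans (normr_ge0 _) (hom a a _ _ _))//.
  - apply: hom.
    + by rewrite at_ (le_trans (ltW t1))// grid_inc.
    + by rewrite lerDl mulr_ge0 ?ler0n ?(ltW h0)//= grid_inc// ltnW.
    + rewrite ger0_norm; last by lra.
      by move: t1; rewrite -natr1 mulrDl mul1r; lra.
  - by rewrite lexx lerDl mulr_ge0 ?ler0n ?(ltW h0).
  - by rewrite lexx lerDl mulr_ge0 ?ler0n ?(ltW h0).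
  - by rewrite subrr normr0 ltW.
by rewrite subrr expr0n addr0 (le_trans IH2)// lerD2r lerDl sqr_ge0.
Qed.

(* Taylor's formula along the grid: the Riemann sums of [profile'] against [g]
   telescope up to the (stopped) quadratic variation. *)
Lemma block_integral_approx K a h (m : nat) g y t om : 0 < h ->
  a <= t <= a + m%:R * h ->
  (forall u v, a <= u <= a + m%:R * h -> a <= v <= a + m%:R * h -> `|u - v| <= h ->
     `|g u - g v| <= om) ->
  `|block_integral K a h m g y t - y * profile (K * (g t - g a))| <=
   2 * `|y| * K ^+ 2 *
     (\sum_(j < m) (g (a + j.+1%:R * h) - g (a + j%:R * h)) ^+ 2 + om ^+ 2).
Proof.
move=> h0 /andP[at_ tm] hom.
pose G (j : nat) := g (Num.min (a + j%:R * h) t).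
have G0 : G 0%N = g a by rewrite /G mul0r addr0 (min_idPl at_).
have Gm : G m = g t by rewrite /G (min_idPr tm).
have -> : y * profile (K * (g t - g a)) =
    \sum_(j < m) y * (profile (K * (G j.+1 - g a)) - profile (K * (G j - g a))).
  rewrite -mulr_sumr; congr (_ * _).
  rewrite -(big_mkord xpredT (fun j => profile (K * (G j.+1 - g a)) - profile (K * (G j - g a)))).
  rewrite (telescope_sumr (fun j => profile (K * (G j - g a)))) ?leq0n// Gm G0.
  by rewrite subrr mulr0 profile0 subr0.
rewrite /block_integral -sumrB.
apply: (le_trans (ler_norm_sum _ _ _)).
have c0 : 0 <= 2 * `|y| * K ^+ 2.
  by apply: mulr_ge0; [exact: mulr_ge0|exact: sqr_ge0].
apply: le_trans (ler_wpM2l c0 (stopped_quadratic_variation h0 at_ hom)).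
rewrite mulr_sumr; apply: ler_sum => j _.
rewrite /block_coef -/(G j) -/(G j.+1).
have [t1|t1] := leP (a + j%:R * h) t.
  have GE : G j = g (a + j%:R * h) by rewrite /G (min_idPl t1).
  rewrite -GE.
  have -> : y * K * profile' (K * (G j - g a)) * (G j.+1 - G j) -
     y * (profile (K * (G j.+1 - g a)) - profile (K * (G j - g a))) =
     - (y * (profile (K * (G j.+1 - g a)) - profile (K * (G j - g a)) -
       profile' (K * (G j - g a)) * (K * (G j.+1 - g a) - K * (G j - g a)))) by ring.
  rewrite normrN normrM.
  apply: (le_trans (ler_wpM2l (normr_ge0 y) (profile_taylor _ _))).
  by rewrite le_eqVlt; apply/orP; left; apply/eqP; ring.
have -> : G j.+1 = G j.
  rewrite /G (min_idPr (ltW t1)) (_ : Num.min _ _ = t)//; apply/min_idPr.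
  by rewrite (le_trans (ltW t1))// lerD2l ler_pM2r// ler_nat.
by rewrite !subrr !mulr0 subrr normr0 expr0n mulr0.
Qed.

End quadratic_profile.

(** * A single block driven by fractional Brownian motion *)

Section block.
Context {d : measure_display} {T : measurableType d} {R : realType}.
Variables (P : probability T R) (F : R -> set (set T)) (H : R) (B : R -> T -> R).
Hypotheses (hF : is_complete_lc_filtration P F) (hH : 2^-1 < H < 1)
  (hB : is_fBm P F H B).
Implicit Types (t u v a b c e : R).

Definition ext_path (w : T) (u : R) : R := B (clip u) w.

Lemma continuous_path w : continuous (ext_path w).
Proof. exact: (continuous_comp_clip (@fBm_continuous _ _ _ _ _ _ _ hB w)). Qed.

Lemma measurable_path u : measurable_fun setT (fun w => ext_path w u).
Proof. by apply: (measurable_fBm hF hB); exact: clip01. Qed.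

Lemma pathE w u : 0 <= u <= 1 -> ext_path w u = B u w.
Proof. by move=> u01; rewrite /ext_path clip_id. Qed.

(** The Heine-Cantor argument by sequences: clipping puts the offending pairs in a compact interval
    without changing the values of the path, and since [clip] is 1-Lipschitz, both sequences have
    the same limit along a subsequence. *)
Lemma unif_continuous_path w e : 0 < e ->
  exists n : nat, forall u v, `|u - v| < n.+1%:R^-1 -> `|ext_path w u - ext_path w v| <= e.
Proof.
move=> e0; apply: contrapT => /forallNP nuc.
have {}nuc (n : nat) : exists z : R * R, `|z.1 - z.2| < n.+1%:R^-1 /\
    e < `|ext_path w z.1 - ext_path w z.2|.
  apply: contrapT => /forallNP h; apply: (nuc n) => u v uv.
  by rewrite leNgt; apply/negP => h'; apply: (h (u, v)).
have [z hz] := choice nuc.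
have clip_lip u v : `|clip u - clip v| <= `|u - v|.
  have := ler_norm (u - v); have := ler_norm (- (u - v)); rewrite normrN => h1 h2.
  rewrite ler_norml /clip; case: (ltP u 0) => u0; case: (ltP v 0) => v0;
  case: (leP u 1) => u1; case: (leP v 1) => v1; apply/andP; split; lra.
pose x n := clip (z n).1; pose y n := clip (z n).2.
have bx : bounded_fun x.
  exists 1; split; first exact: num_real.
  move=> M M1 n _ /=; have /andP[h1 h2] := clip01 (z n).1.
  by rewrite /x ger0_norm// (le_trans h2)// ltW.
have [f incf cf] := bolzano_weierstrass bx.
pose l := limn (x \o f).
have cx : (x \o f) n @[n --> \oo] --> l by [].
have clip_path u : ext_path w (clip u) = ext_path w u.
  by rewrite /ext_path (clip_id (clip01 u)).
have lef n : (n <= f n)%N.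
  elim: n => // n IH; apply: (leq_ltn_trans IH).
  rewrite ltnNge; apply/negP => h.
  have E : (f n.+1 <= f n)%N = (n.+1 <= n)%N := incf n.+1 n.
  by move: h; rewrite E ltnn.
have cxy : (x \o f) n - (y \o f) n @[n --> \oo] --> 0.
  apply/cvgr0Pnorm_le => c c0; near=> n.
  apply: (le_trans (clip_lip _ _)); have [h _] := hz (f n).
  apply: (le_trans (ltW h)); apply: (@le_trans _ _ n.+1%:R^-1).
    by rewrite lef_pV2 ?posrE// ler_nat ltnS lef.
  have : `|n.+1%:R^-1 : R| <= c by near: n; move/cvgr0Pnorm_le : (@cvg_harmonic R); exact.
  by rewrite ger0_norm// invr_ge0.
have cy : (y \o f) n @[n --> \oo] --> l.
  rewrite (_ : y \o f = (fun n => (x \o f) n - ((x \o f) n - (y \o f) n))).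
    by rewrite -[l]subr0; apply: cvgB.
  by apply/funext => n; rewrite opprB addrC subrK.
have cpx : ext_path w ((x \o f) n) @[n --> \oo] --> ext_path w l.
  exact: (cvg_comp _ _ cx (@continuous_path w l)).
have cpy : ext_path w ((y \o f) n) @[n --> \oo] --> ext_path w l.
  exact: (cvg_comp _ _ cy (@continuous_path w l)).
have : ext_path w ((x \o f) n) - ext_path w ((y \o f) n) @[n --> \oo] --> 0.
  by rewrite -(subrr (ext_path w l)); apply: cvgB.
move=> /cvgr0Pnorm_le /(_ _ e0)[n _ /(_ n (leqnn n))].
by rewrite /= /x /y !clip_path leNgt; have [_ ->] := hz (f n).
Unshelve. all: by end_near. Qed.

(* Rational times make the oscillation event measurable. *)
Lemma small_modulus c e : 0 < c -> 0 < e -> exists n N,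
  [/\ measurable N, (P N <= e%:E)%E & forall w, ~ N w -> forall u v,
    `|u - v| < (n : nat).+1%:R^-1 -> `|ext_path w u - ext_path w v| <= c].
Proof.
move=> c0 e0.
pose A n (p q : rat) := if `|ratr p - ratr q : R| < n.+1%:R^-1
  then [set w | c < `|ext_path w (ratr p) - ext_path w (ratr q)|] else set0.
pose E n := \bigcup_p \bigcup_q A n p q.
have mE n : measurable (E n).
  apply: bigcupT_measurable_rat => p; apply: bigcupT_measurable_rat => q.
  rewrite /A; case: ifP => // _; apply: measurable_gt_set.
  apply: (measurableT_comp (@normr_measurable _ _)).
  by apply: measurable_funB; exact: measurable_path.
have [n Pn] : exists n, (P (E n) <= e%:E)%E.
  apply: small_tail => //.
    move=> m n mn w [p _ [q _]]; rewrite /A; case: ifPn => // pq h.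
    exists p => //; exists q => //; rewrite /A ifT//; apply: (lt_le_trans pq).
    by rewrite lef_pV2 ?posrE// ler_nat.
  rewrite (_ : \bigcap_n E n = set0) ?measure0//.
  apply/seteqP; split=> // w Ew.
  have [n hn] := unif_continuous_path w c0.
  have [p _ [q _]] := Ew n I; rewrite /A; case: ifPn => // pq /=.
  by rewrite ltNge hn.
exists n, (E n); split=> // w nE u v uv; rewrite leNgt; apply/negP => h.
(* Half of the slack in time and half of the slack in value: moving both points by less than this
   leaves a violating pair, now at rational times. *)
pose r := (n.+1%:R^-1 - `|u - v|) / 2; pose s := (`|ext_path w u - ext_path w v| - c) / 2.
have r0 : 0 < r by rewrite /r divr_gt0// subr_gt0.
have s0 : 0 < s by rewrite /s; lra.
have approx (x : R) : exists p : rat,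
    `|x - ratr p| < r /\ `|ext_path w x - ext_path w (ratr p)| < s.
  have /cvgrPdist_lt /(_ _ s0) := @continuous_path w x.
  move=> /nbhs_ballP[dl /= dl0 hdl].
  have m0 : 0 < Num.min dl r by rewrite lt_min dl0.
  have [|p] := @rat_in_itvoo R x (x + Num.min dl r); first by rewrite ltrDl.
  rewrite in_itv/= => /andP[p1 p2]; exists p.
  have px : `|x - ratr p| < Num.min dl r.
    by rewrite distrC gtr0_norm ?subr_gt0// ltrBlDl.
  move: px; rewrite lt_min => /andP[px1 px2]; split => //.
  by apply: hdl; rewrite /ball/=.
have [p [p1 p2]] := approx u; have [q [q1 q2]] := approx v.
have tri (x1 x2 y1 y2 : R) : `|x1 - y1| <= `|x1 - x2| + `|x2 - y2| + `|y1 - y2|.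
  rewrite (_ : x1 - y1 = (x1 - x2) + (x2 - y2) - (y1 - y2)); last by ring.
  by rewrite (le_trans (ler_normB _ _))// lerD2r ler_normD.
have h1 := tri (ratr p) u (ratr q) v; rewrite (distrC (ratr p) u) (distrC (ratr q) v) in h1.
have h2 := tri (ext_path w u) (ext_path w (ratr p)) (ext_path w v) (ext_path w (ratr q)).
apply: nE; exists p => //; exists q => //; rewrite /A ifT /=.
  by move: h2 p2 q2; rewrite /s; lra.
by move: h1 p1 q1; rewrite /r; move: n.+1%:R^-1 => i; lra.
Qed.

Let V a (h : R) (m : nat) (w : T) : R :=
  \sum_(j < m) (ext_path w (a + j.+1%:R * h) - ext_path w (a + j%:R * h)) ^+ 2.

Let measurable_V a (h : R) m : measurable_fun setT (V a h m).
Proof.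
by apply: measurable_sum => j; apply: measurable_funX; apply: measurable_funB;
  exact: measurable_path.
Qed.

(** The expectation is [m h^(2H)] with [h <= 1 / m], hence at most [m^(1 - 2H)], a negative power of
    [m] because [H > 1/2]. *)
Lemma integral_quadratic_variation a b (m : nat) : 0 <= a -> b <= 1 -> a < b ->
  (0 < m)%N ->
  (\int[P]_w (V a ((b - a) / m%:R) m w)%:E <= ((m%:R : R) `^ (- (2 * H - 1)))%:E)%E.
Proof.
move=> a0 b1 ab m0; have /andP[H0 H1] := hH.
have mp : 0 < m%:R :> R by rewrite ltr0n.
pose h := (b - a) / m%:R; have h0 : 0 < h by rewrite divr_gt0// subr_gt0.
have mh : m%:R * h = b - a by rewrite mulrC divfK// gt_eqF.
have gridb (j : nat) : (j <= m)%N -> 0 <= a + j%:R * h <= 1.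
  move=> jm; apply/andP; split; first by rewrite addr_ge0// mulr_ge0 ?ler0n ?(ltW h0).
  apply: (@le_trans _ _ (a + m%:R * h)); last by rewrite mh; lra.
  by rewrite lerD2l ler_pM2r// ler_nat.
rewrite -/h (_ : (\int[P]_w _)%E = (\int[P]_w (\sum_(j < m)
   ((ext_path w (a + j.+1%:R * h) - ext_path w (a + j%:R * h)) ^+ 2)%:E))%E); last first.
  by apply: eq_integral => w _; rewrite sumEFin.
rewrite ge0_integral_sum//; last 2 first.
- move=> j; apply/measurable_EFinP; apply: measurable_funX.
  by apply: measurable_funB; exact: measurable_path.
- by move=> j w _; rewrite lee_fin sqr_ge0.
rewrite (eq_bigr (fun j => (h `^ (2 * H))%:E)); last first.
  move=> j _; have j1 := gridb j.+1 (ltn_ord j); have j2 := gridb j (ltnW (ltn_ord j)).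
  under eq_integral do rewrite !pathE//.
  rewrite (fBm_increment_sqr hF hH hB)//; congr ((_ `^ _)%:E).
  rewrite -natr1 (_ : _ - _ = h); last by ring.
  by rewrite gtr0_norm.
rewrite sumEFin lee_fin sumr_const card_ord -[leLHS]mulr_natl.
apply: (@le_trans _ _ (m%:R * (m%:R^-1) `^ (2 * H))).
  rewrite ler_wpM2l ?ler0n// ge0_ler_powR ?nnegrE ?invr_ge0 ?(ltW h0) ?ler0n//; first by lra.
  by rewrite /h ler_piMl ?invr_ge0 ?ler0n//; lra.
rewrite -powR_inv1 ?ler0n// -powRrM mulN1r.
rewrite -powR1D//; rewrite le_eqVlt; apply/orP; left; apply/eqP; congr (_ `^ _); ring.
Qed.

(** Markov's inequality for the expected quadratic variation. *)
Lemma small_quadratic_variation a b c e : 0 <= a -> b <= 1 -> a < b ->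
  0 < c -> 0 < e -> exists m0 : nat, forall m, (m0 <= m)%N -> (0 < m)%N ->
  (P [set w | (c < V a ((b - a) / m%:R) m w)%R] <= e%:E)%E.
Proof.
move=> a0 b1 ab c0 e0; have /andP[H0 H1] := hH.
have H2 : 0 < 2 * H - 1 by lra.
have ce : 0 < c * e by rewrite mulr_gt0.
have [M [_ hM]] := (cvgr0Pnorm_lt _).1 (cvgy_powRN H2) _ ce.
pose m0 := (Num.truncn `|M|).+1; exists m0 => m m0m mp.
have Mm : M < m%:R.
  rewrite (le_lt_trans (ler_norm M))//.
  have /andP[_ h] := truncn_itv (normr_ge0 M).
  by rewrite (lt_le_trans h)// ler_nat.
have := hM _ Mm; rewrite ger0_norm ?powR_ge0// => small.
set A := [set w | _]; pose Vm := V a ((b - a) / m%:R) m.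
have mA : measurable A by apply: measurable_gt_set; exact: measurable_V.
have V0 w : 0 <= Vm w by apply: sumr_ge0 => j _; rewrite sqr_ge0.
have : (c%:E * P A <= (c * e)%:E)%E.
  apply: (@le_trans _ _ (\int[P]_w (Vm w)%:E)%E); last first.
    apply: (le_trans (integral_quadratic_variation a0 b1 ab mp)).
    by rewrite lee_fin ltW.
  rewrite -[P A]mul1e -(setIT A) -integral_indic// mul1e -ge0_integralZl//; last 2 first.
  - by apply/measurable_EFinP; exact: measurable_indic.
  - by rewrite lee_fin ltW.
  apply: ge0_le_integral => //.
  - by move=> w _; rewrite mule_ge0 ?lee_fin ?(ltW c0).
  - by apply/measurable_EFinP; apply: measurable_funM => //; exact: measurable_indic.
  - by apply/measurable_EFinP; exact: measurable_V.
  move=> w _; rewrite -EFinM lee_fin indicE.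
  case: (boolP (w \in A)) => [|_]; last by rewrite mulr0.
  by rewrite inE mulr1 => /ltW.
by rewrite EFinM lee_pmul2l ?lte_fin.
Qed.

(** The order of the choices matters: the scale [K] depends only on the increment over the block and
    on [y], a bound [M] for [|y|] is fixed next, and the mesh comes last, since the Riemann sum
    error is multiplied by [M K^2]. Each of the four requirements fails on an event of measure at
    most [e / 4]. *)
Lemma block_exists a b (y : T -> R) e : 0 <= a -> a < b -> b <= 1 ->
  measurable_fun setT y -> 0 < e -> exists K (m : nat) N,
  [/\ (0 < m)%N, measurable N, (P N <= e%:E)%E & forall w, ~ N w ->
     (forall t, a <= t <= b -> `|block_integral K a ((b - a) / m%:R) m (ext_path w) (y w) t -
        y w * profile (K * (ext_path w t - ext_path w a))| <= e) /\
     `|y w| * (1 - profile (K * (ext_path w b - ext_path w a))) <= e].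
Proof.
move=> a0 ab b1 my e0.
have e40 : 0 < e / 4 by lra.
pose X w := ext_path w b - ext_path w a.
have mX : measurable_fun setT X by apply: measurable_funB; exact: measurable_path.
have [n1 [N1 [mN1 PN1 hN1]]] : exists n N, [/\ measurable N, (P N <= (e / 4)%:E)%E &
    forall w, ~ N w -> forall m, (n <= m)%N ->
      `| y w * (1 + (m.+1%:R * X w) ^+ 2)^-1 | <= e].
  apply: (small_deviation (Y := fun n w => y w * (1 + (n.+1%:R * X w) ^+ 2)^-1)
     (N0 := [set w | X w = 0])) => //.
  - move=> n; rewrite (_ : (fun w => _) = (fun w => y w * (1 + (n.+1%:R * X w) ^+ 2) `^ (-1))).
      apply: measurable_funM => //; apply: (measurableT_comp (measurable_powR _)).
      apply: measurable_funD => //; apply: measurable_funX; exact: measurable_funM.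
    by apply/funext => w; rewrite powR_inv1// addr_ge0// sqr_ge0.
  - by have := mX measurableT [set 0] (measurable_set1 0); rewrite setTI.
  - rewrite (_ : [set w | X w = 0] = [set w | B b w - B a w = 0]).
      by apply: (fBm_neq hF hH hB); [apply/andP; split; lra..|rewrite lt_eqF].
    by apply/seteqP; split=> w /=; rewrite /X !pathE//; apply/andP; split; lra.
  move=> w /= /eqP X0; rewrite -[X in _ --> X](mulr0 (y w)).
  apply: cvgM; first exact: cvg_cst.
  have X20 : 0 < X w ^+ 2 by rewrite lt_neqAle eq_sym sqrf_eq0 X0 sqr_ge0.
  apply: (@squeeze_cvgr _ _ _ _ (fun=> 0) (fun n => (X w ^+ 2)^-1 * n.+1%:R^-1)).
  - apply: nearW => n; rewrite invr_ge0 addr_ge0 ?sqr_ge0//= -invfM.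
    have n1 : 1 <= n.+1%:R :> R by rewrite ler1n.
    have pos : 0 < X w ^+ 2 * n.+1%:R by rewrite mulr_gt0.
    have le : X w ^+ 2 * n.+1%:R <= 1 + (n.+1%:R * X w) ^+ 2.
      rewrite exprMn mulrC; apply: ler_wpDl => //; rewrite ler_wpM2r ?sqr_ge0//.
      by rewrite expr2 ler_peMl// (le_trans ler01).
    by rewrite lef_pV2 ?posrE// (lt_le_trans pos).
  - exact: cvg_cst.
  - rewrite -(mulr0 (X w ^+ 2)^-1); apply: cvgM; first exact: cvg_cst.
    exact: cvg_harmonic.
have [n2 [N2 [mN2 PN2 hN2]]] : exists n N, [/\ measurable N, (P N <= (e / 4)%:E)%E &
    forall w, ~ N w -> forall m, (n <= m)%N -> `| y w * m.+1%:R^-1 | <= 1].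
  apply: (small_deviation (Y := fun n w => y w * n.+1%:R^-1) (N0 := set0)) => //.
  - by move=> n; apply: measurable_funM.
  - move=> w _; rewrite -(mulr0 (y w)); apply: cvgM; first exact: cvg_cst.
    exact: cvg_harmonic.
pose K : R := n1.+1%:R; pose M : R := n2.+1%:R.
have K0 : 0 < K by rewrite ltr0Sn.
have M0 : 0 < M by rewrite ltr0Sn.
(* Chosen so that [2 M K^2 (c + c) = e], with one [c] for the quadratic variation and one for
   [om ^+ 2]. *)
pose c := e / (4 * M * K ^+ 2).
have c0 : 0 < c by rewrite divr_gt0// !mulr_gt0.
pose om := Num.min 1 c; have om0 : 0 < om by rewrite lt_min ltr01.
have om2 : om ^+ 2 <= c.
  apply: (@le_trans _ _ om); last by rewrite /om ge_min lexx orbT.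
  by rewrite expr2 ler_piMl ?(ltW om0)// /om ge_min lexx.
have [m1 hm1] := small_quadratic_variation a0 b1 ab c0 e40.
have [m2 [N4 [mN4 PN4 hN4]]] := small_modulus om0 e40.
(* The second successor makes the mesh strictly smaller than [1 / (m2 + 1)], as the modulus of
   continuity requires. *)
pose m := maxn m1 m2.+2.
have mp : (0 < m)%N by rewrite /m leq_max orbT.
pose h := (b - a) / m%:R.
have mpR : 0 < m%:R :> R by rewrite ltr0n.
have h0 : 0 < h by rewrite divr_gt0// subr_gt0.
have mh : m%:R * h = b - a by rewrite mulrC divfK// gt_eqF.
have hm2 : h < m2.+1%:R^-1.
  rewrite /h ltr_pdivrMr// -ltr_pdivrMl ?invr_gt0 ?ltr0Sn// invrK.
  apply: (@le_lt_trans _ _ m2.+1%:R); first by rewrite ler_piMr ?ler0n//; lra.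
  by rewrite ltr_nat /m leq_max ltnSn orbT.
pose N3 := [set w | c < V a h m w].
have mN3 : measurable N3 by apply: measurable_gt_set; exact: measurable_V.
exists K, m, ((N1 `|` N2) `|` (N3 `|` N4)); split=> //.
- by do !apply: measurableU.
- rewrite (_ : e%:E = ((e / 4)%:E + (e / 4)%:E + ((e / 4)%:E + (e / 4)%:E)))%E; last first.
    by rewrite -!EFinD; congr EFin; lra.
  apply: (le_trans (measureU2 _ _ _)); [by apply: measurableU|by apply: measurableU|].
  apply: leeD; apply: (le_trans (measureU2 _ _ _)) => //; apply: leeD => //.
  by apply: hm1 => //; rewrite /m leq_max leqnn.
move=> w /not_orP[/not_orP[nN1 nN2] /not_orP[nN3 nN4]]; split; last first.
  have := hN1 w nN1 n1 (leqnn _).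
  by rewrite normrM onem_profile (ger0_norm (_ : 0 <= (_)^-1))// invr_ge0 addr_ge0// sqr_ge0.
move=> t tab; have yM : `|y w| <= M.
  have := hN2 w nN2 n2 (leqnn _); rewrite normrM (gtr0_norm (_ : 0 < n2.+1%:R^-1)) ?invr_gt0//.
  by rewrite ler_pdivrMr// mul1r.
have tab' : a <= t <= a + m%:R * h by rewrite mh addrC subrK.
have om_ u v : a <= u <= a + m%:R * h -> a <= v <= a + m%:R * h -> `|u - v| <= h ->
    `|ext_path w u - ext_path w v| <= om.
  by move=> _ _ uv; apply: hN4 => //; exact: le_lt_trans hm2.
apply: (le_trans (block_integral_approx K (y w) h0 tab' om_)).
rewrite -/(V a h m w).
have Vc : V a h m w <= c by rewrite leNgt; apply/negP.
apply: (@le_trans _ _ (2 * M * K ^+ 2 * (c + c))); last first.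
  rewrite (_ : 2 * M * K ^+ 2 * (c + c) = e)// /c; field.
  by rewrite !gt_eqF.
apply: ler_pM; first by rewrite mulr_ge0 ?sqr_ge0// mulr_ge0.
- by rewrite addr_ge0 ?sqr_ge0// sumr_ge0// => j _; rewrite sqr_ge0.
- by rewrite ler_wpM2r ?sqr_ge0// ler_wpM2l.
- exact: lerD.
Qed.

End block.

(** * Concatenation of the blocks *)

Section simple_integrand.
Context {d : measure_display} {T : measurableType d} {R : realType}.
Variables (B : R -> T -> R) (tt K : nat -> R) (m : nat -> nat) (y : nat -> T -> R).
Hypotheses (tt0 : 0 <= tt 0%N) (ttS : forall n, tt n < tt n.+1)
  (tt1 : tt n @[n --> \oo] --> (1 : R)) (m0 : forall n, (0 < m n)%N).
Implicit Types (t s x : R).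

Definition mesh n : R := (tt n.+1 - tt n) / (m n)%:R.
Definition pt n (j : nat) : R := tt n + j%:R * mesh n.

Lemma time_mono n k : (n <= k)%N -> tt n <= tt k.
Proof.
by have : nondecreasing_seq tt; [apply/nondecreasing_seqP => i; exact: ltW|exact].
Qed.

Lemma time_ge0 n : 0 <= tt n.
Proof. exact: le_trans tt0 (time_mono (leq0n n)). Qed.

Lemma time_lt1 n : tt n < 1.
Proof.
apply: (lt_le_trans (ttS n)).
have nd : nondecreasing_seq tt by apply/nondecreasing_seqP => i; exact: ltW.
rewrite -(cvg_lim (@norm_hausdorff _ _) tt1); apply: nondecreasing_cvgn_le => //.
by apply/cvg_ex; exists 1.
Qed.

Lemma mesh_gt0 n : 0 < mesh n.
Proof. by rewrite divr_gt0 ?subr_gt0 ?ltr0n. Qed.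

Lemma pt_ge n j : tt n <= pt n j.
Proof. by rewrite lerDl mulr_ge0 ?ler0n// ltW// mesh_gt0. Qed.

Lemma pt_le n j : (j <= m n)%N -> pt n j <= tt n.+1.
Proof.
move=> jm; have E : (m n)%:R * mesh n = tt n.+1 - tt n.
  by rewrite mulrC divfK// gt_eqF// ltr0n.
rewrite (_ : tt n.+1 = tt n + (m n)%:R * mesh n); last by rewrite E; ring.
by rewrite /pt lerD2l ler_pM2r ?mesh_gt0// ler_nat.
Qed.

Lemma pt01 n j : (j <= m n)%N -> 0 <= pt n j < 1.
Proof.
move=> jm; rewrite (le_trans (time_ge0 n) (pt_ge n j))/=.
exact: le_lt_trans (pt_le jm) (time_lt1 n.+1).
Qed.

Definition coef n (w : T) (j : nat) : R :=
  block_coef (K n) (tt n) (mesh n) (ext_path B w) (y n w) j.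

Definition block_value n (w : T) (t : R) : R :=
  block_integral (K n) (tt n) (mesh n) (m n) (ext_path B w) (y n w) t.

(** Each cell gives a jump up at its left end and the opposite jump at its right end, so the
    coefficient acts on the cell open on the left and closed on the right. *)
Definition jumps (n : nat) (w : T) : seq (R * R) :=
  flatten [seq flatten [seq [:: (coef k w j, pt k j); (- coef k w j, pt k j.+1)]
                       | j <- iota 0 (m k)] | k <- iota 0 n].

Lemma big_jumps (f : R -> R) n w :
  \sum_(p <- jumps n w) p.1 * f p.2 =
  \sum_(k < n) \sum_(j < m k) coef k w j * (f (pt k j) - f (pt k j.+1)).
Proof.
rewrite /jumps big_flatten big_map -[X in iota 0 X]subn0 big_mkord.
apply: eq_bigr => k _; rewrite big_flatten big_map -[X in iota 0 X]subn0 big_mkord.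
by apply: eq_bigr => j _; rewrite !big_cons big_nil /=; ring.
Qed.

Lemma mem_jumps n w p : p \in jumps n w -> exists k j, p.2 = pt k j /\ (j <= m k)%N.
Proof.
move=> /flatten_mapP[k _ /flatten_mapP[j]]; rewrite mem_iota add0n => /andP[_ jm].
by rewrite !inE => /orP[|] /eqP -> /=; [exists k, j|exists k, j.+1]; split => //; exact: ltnW.
Qed.

Lemma step_jumps n w x : step (jumps n w) x =
  \sum_(k < n) \sum_(j < m k) coef k w j * ((pt k j < x)%R%:R - (pt k j.+1 < x)%R%:R).
Proof. exact: (big_jumps (fun b => (b < x)%R%:R)). Qed.

Lemma step_jumps_le n n' w x : (n <= n')%N -> x <= tt n ->
  step (jumps n' w) x = step (jumps n w) x.
Proof.
move=> nn' xn; rewrite !step_jumps -(subnKC nn') big_split_ord/= -[RHS]addr0; congr (_ + _).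
apply: big1 => k _; apply: big1 => j _.
have h i : (pt (n + k) i < x) = false.
  apply/negbTE; rewrite -leNgt (le_trans xn)// (le_trans _ (pt_ge _ _))//.
  exact/time_mono/leq_addr.
by rewrite !h subrr mulr0.
Qed.

(** The index depends on [s] alone. For [s < 1] all admissible indices give the same value, because
    later blocks do not act at [s]. At [s = 1] there is none and [get] returns a default, which
    still gives a finite combination of coefficients known by then. *)
Definition integrand (s : R) (w : T) : R :=
  step (jumps (get [set n | s <= tt n]) w) s.

Lemma integrandE n s w : s <= tt n -> integrand s w = step (jumps n w) s.
Proof.
move=> sn; rewrite /integrand; set N := get _.
have sN : s <= tt N by apply: (@getPex _ [set n | s <= tt n]); exists n.
by have [h|h] := leqP N n; [rewrite (step_jumps_le w h)|rewrite (step_jumps_le w (ltnW h))].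
Qed.

Lemma big_jumps_integral n w t : tt n <= t <= tt n.+1 ->
  \sum_(p <- jumps n.+1 w) p.1 * (ext_path B w t - ext_path B w (Num.min p.2 t)) =
  \sum_(k < n) block_value k w (tt k.+1) + block_value n w t.
Proof.
move=> /andP[nt tn].
rewrite (big_jumps (fun b => ext_path B w t - ext_path B w (Num.min b t))).
rewrite big_ord_recr/=; congr (_ + _).
  apply: eq_bigr => k _; apply: eq_bigr => j _.
  have kt : tt k.+1 <= t by apply: (le_trans _ nt); exact/time_mono/ltn_ord.
  have h1 := pt_le (ltnW (ltn_ord j)); have h2 := pt_le (ltn_ord j).
  rewrite (min_idPl (le_trans h1 kt)) (min_idPl (le_trans h2 kt)).
  rewrite -/(pt k j) -/(pt k j.+1) (min_idPl h1) (min_idPl h2).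
  by rewrite /coef; congr (_ * _); ring.
by apply: eq_bigr => j _; rewrite /coef; congr (_ * _); ring.
Qed.

Lemma time_bracket n t : tt n <= t < 1 -> exists k, (n <= k)%N /\ tt k <= t <= tt k.+1.
Proof.
move=> /andP[nt t1].
have [N tN] : exists N, t < tt N.
  have /cvgrPdist_lt /(_ (1 - t)) := tt1.
  rewrite subr_gt0 => /(_ t1)[N _ /(_ N (leqnn N))] /=.
  rewrite ger0_norm ?subr_ge0 ?(ltW (time_lt1 N))// => h; exists N; lra.
elim: N tN => [|N IH] tN.
  by have := le_lt_trans (le_trans (time_mono (leq0n n)) nt) tN; rewrite ltxx.
have [h|h] := ltP t (tt N); first exact: IH.
exists N; split; last by rewrite h ltW.
rewrite -ltnS ltnNge; apply/negP => h'.
by have := lt_le_trans tN (le_trans (time_mono h') nt); rewrite ltxx.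
Qed.

End simple_integrand.

(** * Adaptedness and the recursive choice of the blocks *)

Section construction.
Context {d : measure_display} {T : measurableType d} {R : realType}.
Variables (P : probability T R) (F : R -> set (set T)) (H : R) (B : R -> T -> R).
Hypotheses (hF : is_complete_lc_filtration P F) (hH : 2^-1 < H < 1)
  (hB : is_fBm P F H B).
Implicit Types (t s : R).

(** The next time is the midpoint between 1 and the larger of the current time and the next
    constraint, so the distance to 1 is at least halved at each step. *)
Lemma times_exist (r : nat -> R) : (forall n, 0 <= r n < 1) -> exists tt : nat -> R,
  [/\ 0 <= tt 0%N, forall n, tt n < tt n.+1, tt n @[n --> \oo] --> (1 : R) &
      forall n, r n <= tt n].
Proof.
move=> r01; pose tt := fix tt (n : nat) : R :=
  if n is n'.+1 then (1 + Num.max (tt n') (r n)) / 2 else r 0%N.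
have tt1 n : tt n < 1.
  elim: n => [|n IH]; first by have /andP[] := r01 0%N.
  have /andP[_ h] := r01 n.+1.
  have : Num.max (tt n) (r n.+1) < 1 by rewrite gt_max IH.
  by rewrite /=; lra.
have maxl n : tt n <= Num.max (tt n) (r n.+1) by rewrite le_max lexx.
have maxr n : r n.+1 <= Num.max (tt n) (r n.+1) by rewrite le_max lexx orbT.
exists tt; split.
- by have /andP[] := r01 0%N.
- by move=> n; rewrite /=; have := tt1 n; have := maxl n; lra.
- have cvg1 : 1 - tt n @[n --> \oo] --> (0 : R).
    apply: (@squeeze_cvgr _ _ _ _ (fun=> 0) (geometric (1 : R) 2^-1)).
    + apply: nearW => n; rewrite subr_ge0 (ltW (tt1 n)) /=.
      elim: n => [|n IH].
        by have /andP[h _] := r01 0%N; rewrite expr0 mulr1 /=; lra.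
      by move: IH; rewrite !mul1r exprS /=; have := maxl n; lra.
    + exact: cvg_cst.
    + by apply: cvg_geometric; rewrite ger0_norm; lra.
  rewrite (_ : tt = fun n => 1 - (1 - tt n)); last by apply/funext => n; ring.
  by rewrite -[X in _ --> X]subr0; apply: cvgB => //; exact: cvg_cst.
- case=> [|n] //=; have /andP[_ h] := r01 n.+1; have := maxr n.
  by have := tt1 n.+1; rewrite /=; lra.
Qed.

Lemma measurable_profile' : measurable_fun setT (@profile' R).
Proof.
rewrite (_ : profile' = fun x => 2 * x * ((1 + x ^+ 2) ^+ 2) `^ (-1)).
  apply: measurable_funM; first by measurability.
  apply: (measurableT_comp (measurable_powR _)); apply: measurable_funX.
  by apply: measurable_funD => //; exact: measurable_funX.
by apply/funext => x; rewrite powR_inv1// sqr_ge0.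
Qed.

Lemma measurable_wrt_mono s t (X : T -> R) : 0 <= s -> s <= t -> t <= 1 ->
  measurable_wrt (F s) X -> measurable_wrt (F t) X.
Proof. by move=> s0 st t1 mX A mA; apply: (filtration_mono hF s0 st t1); exact: mX. Qed.

Lemma measurable_wrt_ext_path s t : 0 <= s -> s <= t -> t <= 1 ->
  measurable_wrt (F t) (fun w => ext_path B w s).
Proof.
move=> s0 st t1; have s01 : 0 <= s <= 1 by rewrite s0 (le_trans st).
rewrite /ext_path (clip_id s01); apply: (measurable_wrt_mono s0 st t1).
exact: (fBm_adapted hB).
Qed.

Let sF t : 0 <= t <= 1 -> sigma_algebra setT (F t).
Proof. exact: (filtration_sigma hF). Qed.

Lemma measurable_wrt_block_coef K a h (j : nat) (y : T -> R) s : 0 <= a -> 0 <= h ->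
  a + j%:R * h <= s -> s <= 1 -> measurable_wrt (F a) y ->
  measurable_wrt (F s) (fun w => block_coef K a h (ext_path B w) (y w) j).
Proof.
move=> a0 h0 js s1 my.
have jh0 : 0 <= j%:R * h by rewrite mulr_ge0 ?ler0n.
have as_ : a <= s by rewrite (le_trans _ js)// lerDl.
have s01 : 0 <= s <= 1 by rewrite (le_trans a0 as_).
have sFs := sF s01; rewrite /block_coef.
apply: (measurable_wrtM sFs).
  apply: (measurable_wrtM sFs); last exact: measurable_wrt_cst.
  exact: (measurable_wrt_mono a0 as_).
apply: (measurable_wrt_comp sFs (f := @profile' R)); first exact: measurable_profile'.
apply: (measurable_wrtM sFs); first exact: measurable_wrt_cst.
apply: (measurable_wrtB sFs); apply: measurable_wrt_ext_path => //.
by rewrite addr_ge0.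
Qed.

Lemma measurable_wrt_block_integral K a h m (y : T -> R) s t : 0 <= a -> 0 <= h ->
  a + m%:R * h <= s -> 0 <= t <= s -> s <= 1 -> measurable_wrt (F a) y ->
  measurable_wrt (F s) (fun w => block_integral K a h m (ext_path B w) (y w) t).
Proof.
move=> a0 h0 ms /andP[t0 ts] s1 my.
have s01 : 0 <= s <= 1 by rewrite (le_trans t0 ts).
have sFs := sF s01; rewrite /block_integral.
apply: (measurable_wrt_sum sFs) => j; apply: (measurable_wrtM sFs).
  apply: measurable_wrt_block_coef => //; apply: (le_trans _ ms).
  by rewrite lerD2l ler_wpM2r// ler_nat ltnW.
by apply: (measurable_wrtB sFs); apply: measurable_wrt_ext_path;
  rewrite ?le_min ?ge_min ?t0 ?ts ?orbT ?andbT// addr_ge0// mulr_ge0 ?ler0n.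
Qed.

(** A cell that starts before [s] has a coefficient known at its left end, hence at [s]; for a cell
    that starts at or after [s] both indicators vanish. *)
Lemma adapted_integrand (tt K : nat -> R) (m : nat -> nat) (y : nat -> T -> R) :
  0 <= tt 0%N -> (forall n, tt n < tt n.+1) -> (forall n, (0 < m n)%N) ->
  (forall n, measurable_wrt (F (tt n)) (y n)) ->
  adapted F (integrand B tt K m y).
Proof.
move=> tt0 ttS m0 my s s01; have sFs := sF s01; have /andP[s0 s1] := s01.
rewrite /integrand; set N := get _.
rewrite (_ : (fun w => _) = (fun w => \sum_(k < N) \sum_(j < m k) coef B tt K m y k w j *
   ((pt tt m k j < s)%R%:R - (pt tt m k j.+1 < s)%R%:R))); last first.
  by apply/funext => w; rewrite step_jumps.
apply: (measurable_wrt_sum sFs) => k; apply: (measurable_wrt_sum sFs) => j.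
have h0 := mesh_gt0 ttS m0 k.
have [ps|sp] := ltP (pt tt m k j) s.
  apply: (measurable_wrtM sFs); last exact: measurable_wrt_cst.
  apply: measurable_wrt_block_coef => //; [|exact: ltW|exact: ltW].
  exact: time_ge0 tt0 ttS _.
rewrite (_ : (fun w => _) = fun=> 0); first exact: measurable_wrt_cst.
apply/funext => w; rewrite (_ : (pt tt m k j.+1 < s) = false) ?subrr ?mulr0//.
apply/negbTE; rewrite -leNgt (le_trans sp)// /pt lerD2l ler_wpM2r ?(ltW h0)//.
by rewrite ler_nat.
Qed.

(* Each block is driven towards the current value [z n] of the approximation,
   starting from the value actually reached, so that errors do not accumulate. *)
Lemma blocks_exist (tt e : nat -> R) (z : nat -> T -> R) :
  0 <= tt 0%N -> (forall n, tt n < tt n.+1) -> (forall n, tt n < 1) ->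
  (forall n, measurable_wrt (F (tt n)) (z n)) -> (forall n, 0 < e n) ->
  exists (K : nat -> R) (m : nat -> nat) (I : nat -> T -> R) (N : nat -> set T),
  let y n w := z n w - I n w in
  [/\ forall n, (0 < m n)%N,
      forall n, measurable_wrt (F (tt n)) (y n),
      forall w, I 0%N w = 0 /\
        forall n, I n.+1 w = I n w + block_value B tt K m y n w (tt n.+1),
      forall n, measurable (N n) /\ (P (N n) <= (e n)%:E)%E &
      forall n w, ~ N n w ->
        (forall t, tt n <= t <= tt n.+1 -> `|block_value B tt K m y n w t -
          y n w * profile (K n * (ext_path B w t - ext_path B w (tt n)))| <= e n) /\
        `|y n w| * (1 - profile (K n * (ext_path B w (tt n.+1) - ext_path B w (tt n)))) <= e n].
Proof.
move=> tt0 ttS tt1 mz e0.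
have tt_ge0 n : 0 <= tt n by exact: time_ge0 tt0 ttS _.
have tt01 n : 0 <= tt n <= 1 by rewrite tt_ge0 ltW.
(* The guard makes the choice of block parameters a total function of the index and the target, so
   the recursion below can be written before measurability is proved. *)
pose good (p : nat * (T -> R)) (q : R * nat * set T) := measurable_fun setT p.2 ->
  [/\ (0 < q.1.2)%N, measurable q.2, (P q.2 <= (e p.1)%:E)%E & forall w, ~ q.2 w ->
     (forall t, tt p.1 <= t <= tt p.1.+1 ->
        `|block_integral q.1.1 (tt p.1) ((tt p.1.+1 - tt p.1) / q.1.2%:R) q.1.2
            (ext_path B w) (p.2 w) t -
          p.2 w * profile (q.1.1 * (ext_path B w t - ext_path B w (tt p.1)))| <= e p.1) /\
     `|p.2 w| * (1 - profile (q.1.1 * (ext_path B w (tt p.1.+1) - ext_path B w (tt p.1))))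
       <= e p.1].
have ex_good p : exists q, good p q.
  case: p => n y; have [my|nmy] := pselect (measurable_fun setT y).
    have [K [m [N hN]]] := block_exists hF hH hB (tt_ge0 n) (ttS n) (ltW (tt1 n.+1)) my (e0 n).
    by exists (K, m, N).
  by exists (0, 0%N, set0).
have [blk hblk] := choice ex_good.
(* The parameters of a block are chosen from its target [z n' - I n'], which involves only earlier
   blocks. *)
pose I := fix I (n : nat) : T -> R := if n is n'.+1 then
  (fun w => I n' w + block_integral (blk (n', fun w => z n' w - I n' w)).1.1 (tt n')
     ((tt n'.+1 - tt n') / (blk (n', fun w => z n' w - I n' w)).1.2%:R)
     (blk (n', fun w => z n' w - I n' w)).1.2 (ext_path B w) (z n' w - I n' w) (tt n'.+1))
  else fun=> 0.
pose y n w := z n w - I n w.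
pose K n := (blk (n, y n)).1.1; pose m n := (blk (n, y n)).1.2; pose N n := (blk (n, y n)).2.
have wrt_fun n (X : T -> R) : measurable_wrt (F (tt n)) X -> measurable_fun setT X.
  exact: (measurable_wrt_fun hF (tt01 n)).
have mI n : measurable_wrt (F (tt n)) (I n).
  elim: n => [|n IH]; first by apply: measurable_wrt_cst; exact: sF.
  have sFn := sF (tt01 n.+1).
  have my : measurable_wrt (F (tt n)) (y n) by exact: (measurable_wrtB (sF (tt01 n))).
  have [mp _ _ _] := hblk (n, y n) (wrt_fun n _ my).
  apply: (measurable_wrtD sFn).
    by apply: (measurable_wrt_mono _ _ _ IH) => //; exact: ltW.
  apply: measurable_wrt_block_integral => //.
  - by rewrite divr_ge0 ?ler0n// subr_ge0 ltW.
  - by rewrite mulrC divfK ?gt_eqF ?ltr0n// addrC subrK.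
  - by rewrite tt_ge0 lexx.
  - exact: ltW.
have my n : measurable_wrt (F (tt n)) (y n).
  by apply: (measurable_wrtB (sF (tt01 n))); [exact: mz|exact: mI].
have hn n := hblk (n, y n) (wrt_fun n _ (my n)).
exists K, m, I, N; split => //.
- by move=> n; have [] := hn n.
- by move=> n; have [] := hn n.
- by move=> n w nN; have [_ _ _] := hn n; exact.
Qed.

End construction.

(** * The pathwise integral of the concatenated integrand *)

Section integral_of_integrand.
Context {d : measure_display} {T : measurableType d} {R : realType}.
Variables (P : probability T R) (F : R -> set (set T)) (H : R) (B : R -> T -> R).
Hypotheses (hF : is_complete_lc_filtration P F) (hH : 2^-1 < H < 1)
  (hB : is_fBm P F H B).
Variables (tt K : nat -> R) (m : nat -> nat) (y : nat -> T -> R).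
Hypotheses (tt0 : 0 <= tt 0%N) (ttS : forall n, tt n < tt n.+1)
  (tt1 : tt n @[n --> \oo] --> (1 : R)) (m0 : forall n, (0 < m n)%N).
Notation mu := (@lebesgue_measure R).
Implicit Types (t s al : R) (w : T).

Let psi s w := integrand B tt K m y s w.

Let jumps_ge0 n w : {in jumps B tt K m y n w, forall p, 0 <= p.2}.
Proof.
move=> p /mem_jumps[k [j [-> jm]]].
by have /andP[] := pt01 tt0 ttS tt1 m0 jm.
Qed.

Let psiE n w s : s <= tt n -> psi s w = step (jumps B tt K m y n w) s.
Proof. by move=> sn; rewrite /psi (integrandE _ _ _ ttS m0 _ sn). Qed.

Lemma alpha_norm_integrand al t w n : 0 < al < 1 -> 0 <= t <= tt n ->
  alpha_norm_finite al t (fun s => psi s w).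
Proof.
move=> al01 /andP[t0 tn]; apply: (alpha_norm_step al01 t0 (@jumps_ge0 n w)).
by move=> s /andP[_ st]; apply: psiE; exact: le_trans tn.
Qed.

(** A countable family, hence one null set. As [i] grows the exponents tend to 1 and to [1 - H], so
    every exponent in (1 - H, 1) eventually lies between them. *)
Lemma ae_energy_grid : {ae P, forall w, forall k j (i : nat),
  (mu \x mu)%E.-integrable setT (EFin \o
    energy (1 - i.+1%:R^-1) (1 - H + i.+1%:R^-1) (pt tt m k j) (ext_path B w))}.
Proof.
apply: ae_foralln => k; apply: ae_foralln => j; apply: ae_foralln => i.
apply: (ae_integrable_energy hF hH hB).
- exact: le_trans (time_ge0 tt0 ttS k) (pt_ge ttS m0 k j).
- by rewrite gtrBl invr_gt0.
- by rewrite ltrDl invr_gt0.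
Qed.

(** Nothing is known about the exponent selected by [get] beyond its membership in (1 - H, 1), so
    the energies must serve any such exponent. *)
Lemma gLS_integrand w : (forall k j (i : nat),
  (mu \x mu)%E.-integrable setT (EFin \o
    energy (1 - i.+1%:R^-1) (1 - H + i.+1%:R^-1) (pt tt m k j) (ext_path B w))) ->
  forall n t, tt n <= t <= tt n.+1 ->
  gLS_integral H (fun s => psi s w) (fun s => B s w) t =
  \sum_(k < n) block_value B tt K m y k w (tt k.+1) + block_value B tt K m y n w t.
Proof.
move=> hE n t ntn; have /andP[H0 H1] := hH; have /andP[nt tn] := ntn.
have t0 : 0 <= t by exact: le_trans (time_ge0 tt0 ttS n) nt.
have t1 : t < 1 by exact: le_lt_trans tn (time_lt1 ttS tt1 n.+1).
rewrite /gLS_integral; set al := get _.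
have [/andP[al0 al1] _] : 1 - H < al < 1 /\ alpha_norm_finite al t (fun s => psi s w).
  apply: (@getPex _ [set al | 1 - H < al < 1 /\ alpha_norm_finite al t (fun s => psi s w)]).
  (* Some admissible exponent must exist for [get] to be meaningful; a step function has finite norm
     for every exponent in (0, 1). *)
  exists (1 - H / 2); split; first by apply/andP; split; lra.
  apply: (@alpha_norm_integrand _ _ _ n.+1); first by apply/andP; split; lra.
  by rewrite t0.
have al01 : 0 < al < 1 by apply/andP; split; lra.
rewrite (@gLS_integral_at_eq _ _ _ _ (ext_path B w))//; last first.
  by move=> x /andP[x0 xt]; rewrite (pathE B)// x0 (le_trans xt)// ltW.
have [M hM] := bounded_comp_clip (@fBm_continuous _ _ _ _ _ _ _ hB w).
have cB : continuous (ext_path B w) by exact: continuous_path hB w.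
rewrite (gLS_step (s := jumps B tt K m y n.+1 w) (M := M) al01 t0)//; first last.
- by move=> x /andP[_ xt]; apply: psiE; exact: le_trans tn.
- move=> p /mem_jumps[k [j [-> jm]]] _.
  (* The distance from [al] to the ends of (1 - H, 1) determines which of the countably many
     energies to use. *)
  have e0 : 0 < Num.min (1 - al) (al - (1 - H)) by rewrite lt_min; apply/andP; split; lra.
  have [i hi] : exists i : nat, i.+1%:R^-1 <= Num.min (1 - al) (al - (1 - H)).
    have /cvgr0Pnorm_le /(_ _ e0)[i _ /(_ i (leqnn i))] := @cvg_harmonic R.
    by move=> h; exists i; rewrite (le_trans _ h)//= ler_norm.
  move: hi; rewrite le_min => /andP[hi1 hi2].
  have /andP[p0 _] := pt01 tt0 ttS tt1 m0 jm.
  apply: (integrable_marchaud_energy p0 (ltW t1) _ _ _ (hE k j i)).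
  + by rewrite lerBrDr addrC -lerBrDr.
  + by rewrite addrC -lerBrDr.
  + exact: continuous_measurable_fun.
exact: big_jumps_integral.
Qed.

End integral_of_integrand.

(** * Borel-Cantelli and convergence to the target *)

Lemma geometric_cvg0 {R : realType} (c e : R) : 0 < e ->
  \forall n \near \oo, c * (2 ^ n.+1)%:R^-1 <= e.
Proof.
move=> e0; have h : c * (2 ^ n.+1)%:R^-1 @[n --> \oo] --> (0 : R).
  rewrite (_ : (fun n => _) = geometric (c / 2) 2^-1).
    by apply: cvg_geometric; rewrite ger0_norm; lra.
  by apply/funext => n; rewrite /geometric /= natrX -exprVn exprS mulrA.
near=> n; rewrite (le_trans (ler_norm _))//.
by near: n; move/cvgr0Pnorm_le : h => /(_ _ e0).
Unshelve. all: by end_near. Qed.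

Lemma negligible_lim_sup {d : measure_display} {T : measurableType d} {R : realType}
    (P : probability T R) (A : nat -> set T) : (forall n, measurable (A n)) ->
  (forall n, P (A n) <= (2 / (2 ^ n.+1)%:R)%:E)%E ->
  {ae P, forall w, exists n0 : nat, forall n, (n0 <= n)%N -> ~ A n w}.
Proof.
move=> mA PA; exists (lim_sup_set A); split.
- by apply: bigcapT_measurable => n; apply: bigcup_measurable => k _.
- apply: lim_sup_set_cvg0 => //; apply: (@le_lt_trans _ _ (2 : R)%:E); last exact: ltry.
  apply: (@le_trans _ _ (\sum_(n <oo) (2 / (2 ^ n.+1)%:R : R)%:E)%E).
    by apply: lee_nneseries => n *; [exact: measure_ge0|exact: PA].
  exact: (epsilon_trick0 xpredT).
move=> w /= /forallNP h n _; have := h n => /existsNP[k] /not_implyP[nk /contrapT Ak].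
by exists k.
Qed.

Theorem theorem3p2 (R : realType) (d : measure_display) (T : measurableType d)
    (P : probability T R) (Pcomplete : measure_is_complete P)
    (F : R -> set (set T)) (hF : is_complete_lc_filtration P F)
    (H : R) (hH : 2^-1 < H < 1)
    (B : R -> T -> R) (hB : is_fBm P F H B)
    (xi : T -> R) (hxi : measurable_wrt (F 1) xi) :
  exists psi : R -> T -> R,
    [/\ adapted F psi,
        forall t alpha : R, 0 < t < 1 -> 1 - H < alpha < 2^-1 ->
          {ae P, forall w, alpha_norm_finite alpha t (fun s => psi s w)}
      & {ae P, forall w,
          gLS_integral H (fun s => psi s w) (fun s => B s w) t
            @[t --> 1^'-] --> xi w}].
Proof.
(* One geometric sequence bounds both the errors and the measures of the exceptional sets, so that
   it is summable and consecutive terms compare by a factor 2. *)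
pose e (n : nat) : R := (2 ^ n.+1)%:R^-1.
have e0 n : 0 < e n by rewrite invr_gt0 ltr0n expn_gt0.
have eS n : e n = 2 * e n.+1.
  by rewrite /e (expnS 2 n.+1) natrM invfM mulrA mulfV ?mul1r.
have ex_approx n : exists q : R * (T -> R) * set T,
    [/\ 0 <= q.1.1 < 1, measurable_wrt (F q.1.1) q.1.2, measurable q.2,
        (P q.2 <= (e n)%:E)%E & forall w, ~ q.2 w -> `|xi w - q.1.2 w| <= e n].
  have [s [Y [N h]]] := approximable_F1 hF hxi (e0 n).
  by exists (s, Y, N).
have [q hq] := choice ex_approx.
have [tt [tt0 ttS tt1 rtt]] : exists tt : nat -> R,
    [/\ 0 <= tt 0%N, forall n, tt n < tt n.+1, tt n @[n --> \oo] --> (1 : R) &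
      forall n, (q n).1.1 <= tt n].
  by apply: times_exist => n; have [] := hq n.
have ttlt := time_lt1 ttS tt1.
have mz n : measurable_wrt (F (tt n)) (q n).1.2.
  have [/andP[r0 _] mY _ _ _] := hq n.
  exact: (measurable_wrt_mono hF r0 (rtt n) (ltW (ttlt n)) mY).
have [K [m [I [N /= [m0 my hI mN hN]]]]] := blocks_exist hF hH hB tt0 ttS ttlt mz e0.
set y := (fun n w => (q n).1.2 w - I n w) in my hI hN.
exists (integrand B tt K m y); split.
- exact: (adapted_integrand hF hB).
- move=> t al /andP[t0 t1] /andP[al0 al1]; have /andP[H0 H1] := hH.
  have [n [_ /andP[_ tn]]] : exists n, (0 <= n)%N /\ (0 <= n)%N && (t <= tt n).
    have /cvgrPdist_lt /(_ (1 - t)) := tt1.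
    rewrite subr_gt0 => /(_ t1)[n _ /(_ n (leqnn n))] /=.
    rewrite ger0_norm ?subr_ge0 ?(ltW (ttlt n))// => h.
    by exists n; split=> //=; lra.
  (* Finiteness of the norm holds on every path, since up to a time [t < 1] the integrand is a
     finite step function. *)
  apply: aeW => w; apply: (alpha_norm_integrand B K y tt0 ttS tt1 m0 w (n := n)).
    by apply/andP; split; lra.
  by rewrite (ltW t0).
pose bad n := (q n).2 `|` N n.
have mbad n : measurable (bad n).
  by apply: measurableU; [have [] := hq n|have [] := mN n].
have Pbad n : (P (bad n) <= (2 / (2 ^ n.+1)%:R)%:E)%E.
  have [_ _ mq Pq _] := hq n; have [mNn PN] := mN n.
  apply: (le_trans (measureU2 _ mq mNn)).
  rewrite (_ : (2 / _) = e n + e n) ?EFinD; last by rewrite /e; ring.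
  exact: leeD.
have aeE := ae_energy_grid hF hH hB tt0 ttS m0.
have aeB := negligible_lim_sup mbad Pbad.
apply: filterS2 aeE aeB => w hE [n0 hn0].
have gLS := gLS_integrand hH hB K y tt0 ttS tt1 m0 hE.
have sumI n : \sum_(k < n) block_value B tt K m y k w (tt k.+1) = I n w.
  have [I0 IS] := hI w; elim: n => [|n IH]; first by rewrite big_ord0 I0.
  by rewrite big_ord_recr/= IH IS.
have near_xi n : (n0 <= n)%N -> `|xi w - (q n).1.2 w| <= e n.
  move=> nn0; have [_ _ _ _] := hq n; apply => h.
  by apply: (hn0 n nn0); left.
have block n : (n0 <= n)%N -> ~ N n w by move=> nn0 h; apply: (hn0 n nn0); right.
(* One [e n] for the Riemann sum error, and one for the defect [1 - profile] at the end of the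
   block. *)
have reached n : (n0 <= n)%N -> `|I n.+1 w - (q n).1.2 w| <= 2 * e n.
  move=> nn0; have [h1 h2] := hN n w (block n nn0).
  have {}h1 := h1 (tt n.+1); rewrite lexx (ltW (ttS n)) in h1; have {}h1 := h1 isT.
  have [_ ->] := hI w.
  set p := profile _ in h1 h2; set J := block_value _ _ _ _ _ _ _ _ in h1 *.
  have p1 : 0 <= 1 - p by rewrite subr_ge0 profile_le1.
  rewrite (_ : _ - _ = (J - y n w * p) - y n w * (1 - p)); last by rewrite /y; ring.
  rewrite (le_trans (ler_normB _ _))// normrM (ger0_norm p1); lra.
(* The inequality [n0 < n] is strict because the size of [y n] is estimated through the preceding
   block. The 9 is 1 for the approximation of [xi], 7 for the part of [y n] not yet integrated, and
   1 for the Riemann sum error. *)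
have bound n t : (n0 < n)%N -> tt n <= t <= tt n.+1 ->
    `|xi w - gLS_integral H (fun s => integrand B tt K m y s w) (fun s => B s w) t| <= 9 * e n.
  case: n => // n; rewrite ltnS => nn0 tn; rewrite (gLS n.+1 t tn) sumI.
  have [h1 _] := hN n.+1 w (block n.+1 (leqW nn0)); have {}h1 := h1 t tn.
  have a1 := near_xi n nn0; have a2 := near_xi n.+1 (leqW nn0); have a3 := reached n nn0.
  have en := eS n; have en0 := e0 n.+1.
  set p := profile _ in h1; set J := block_value _ _ _ _ _ _ _ _ in h1 *.
  have p0 : 0 <= p by exact: profile_ge0.
  have p1 : 0 <= 1 - p by rewrite subr_ge0 profile_le1.
  (* In units of [e n.+1]: 2 and 1 for the two approximations of [xi], and 4 for the miss of the
     preceding block. *)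
  have yb : `|y n.+1 w| <= 7 * e n.+1.
    rewrite /y (_ : _ - _ = (xi w - (q n).1.2 w) - (xi w - (q n.+1).1.2 w) -
      (I n.+1 w - (q n).1.2 w)); last by ring.
    rewrite (le_trans (ler_normB _ _))// (le_trans (lerD (ler_normB _ _) (lexx _)))//.
    lra.
  rewrite (_ : xi w - (I n.+1 w + J) = (xi w - (q n.+1).1.2 w) + y n.+1 w * (1 - p) -
    (J - y n.+1 w * p)); last by rewrite /y; ring.
  rewrite (le_trans (ler_normB _ _))// (le_trans (lerD (ler_normD _ _) (lexx _)))//.
  have : `|y n.+1 w * (1 - p)| <= 7 * e n.+1.
    rewrite normrM (ger0_norm p1) -[leRHS]mulr1 ler_pM//.
    by rewrite gerBl.
  lra.
apply/cvgrPdist_le => c c0.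
have [n1 _ hn1] := geometric_cvg0 9 c0.
pose n2 := maxn n0.+1 n1.
near=> t.
have t1 : t < 1 by near: t; exact: nbhs_left_lt.
have tn2 : tt n2 <= t by near: t; apply: nbhs_left_ge.
have [|k [n2k tk]] := time_bracket ttS tt1 (n := n2) (t := t).
  by rewrite tn2.
have n0k : (n0 < k)%N by apply: leq_trans n2k; rewrite leq_max leqnn.
rewrite (le_trans (bound k t n0k tk))// hn1//=.
by apply: leq_trans n2k; rewrite leq_max leqnn orbT.
Unshelve. all: by end_near. Qed.
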